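(* Let $\theta\in(0,\pi/2)$. For every $\varepsilon>0$ there are $\delta>0$ and $d_0$ such that if $d\ge d_0$ and $\lambda\ge \big(\sqrt{2}\sin\frac{\theta}{2}+\delta\big)^{-d}$, then $$\alpha_{d}^{\theta}(\lambda)\ge \Big(\log\frac{\sin\theta}{\sqrt{2}\sin\frac{\theta}{2}}-\varepsilon\Big)\, d\cdot s_d(\theta)^{-1}.$$ In particular, $A(d,\theta)\geq (1+o(1))\log\frac{\sin\theta}{\sqrt{2}\sin\frac{\theta}{2}}\cdot d\cdot s_d(\theta)^{-1}$ as $d\to\infty$.
   Context: Let $\mathbb{S}_{d-1}=\{x\in\mathbb R^d:\|x\|=1\}$ with normalised surface measure $s$ ($s(\mathbb{S}_{d-1})=1$). Let $C_\theta(x)=\{y\in\mathbb{S}_{d-1}:\langle x,y\rangle\ge\cos\theta\}$ and $s_d(\theta)=s(C_\theta(x))$. The hard cap model with angle $\theta$ at fugacity $\lambda>0$ on $\mathbb{S}_{d-1}$ is the random finite set $X\subseteq\mathbb{S}_{d-1}$ obtained from a Poisson point process on $\mathbb{S}_{d-1}$ of intensity $\lambda$ with respect to $s$, conditioned on $\langle x,y\rangle\le\cos\theta$ for all distinct $x,y\in X$; $\alpha_d^\theta(\lambda)=\mathbb E[|X|]$. $A(d,\theta)$ is the maximum size of a set $\{x_1,\dots,x_k\}\subseteq\mathbb{S}_{d-1}$ with $\langle x_i,x_j\rangle\le\cos\theta$ for all $i\ne j$. Logarithms are natural. *)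

(* Defs.v *)
From HB Require Import structures.
From mathcomp Require Import all_boot all_order all_algebra finmap.
From mathcomp Require Import all_classical all_reals all_analysis.

Set Implicit Arguments.
Unset Strict Implicit.
Unset Printing Implicit Defensive.

Import Order.TTheory GRing.Theory Num.Theory.
Import numFieldNormedType.Exports.

Local Open Scope classical_set_scope.
Local Open Scope ring_scope.

(* [n.-tuple T] carries the product sigma-algebra, so that [mpower mu n] is the
   n-fold product measure; it is a measure as soon as [mu] is sigma-finite. *)
Fixpoint mpower (R : realType) (disp : measure_display)
    (T : measurableType disp) (mu : set T -> \bar R) (n : nat) :
    set (n.-tuple T) -> \bar R :=
  match n with
  | 0 => dirac [tuple]
  | m.+1 => pushforward (mu \x @mpower R disp T mu m)%E
              (fun p : T * m.-tuple T => [tuple of p.1 :: p.2])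
  end.
Arguments mpower {R disp T} mu n _.

Section euclidean_sphere.
Variables (R : realType) (d : nat).
Implicit Types (x y : d.-tuple R) (theta : R).

Definition dotp x y : R := \sum_(i < d) tnth x i * tnth y i.

Definition enorm x : R := Num.sqrt (dotp x x).

Definition sphere : set (d.-tuple R) := [set x | enorm x = 1].

Definition lebesgue_measure_tuple : set (d.-tuple R) -> \bar R :=
  mpower (@lebesgue_measure R) d.

Definition punctured_ball : set (d.-tuple R) := [set x | 0 < enorm x <= 1].

Definition radial_proj x : d.-tuple R := [tuple tnth x i / enorm x | i < d].

(* The normalised surface measure, as a measure on R^d carried by the sphere:
   the surface measure of A is proportional to the Lebesgue measure of the cone
   {r a : a in A, 0 < r <= 1}, which is the part of the ball that the radial
   projection sends to A. *)
Definition surface_measure (A : set (d.-tuple R)) : \bar R :=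
  (lebesgue_measure_tuple (punctured_ball `&` radial_proj @^-1` A) *
   (fine (lebesgue_measure_tuple punctured_ball))^-1%:E)%E.

Definition cap theta x : set (d.-tuple R) :=
  [set y | sphere y /\ cos theta <= dotp x y].

Definition pole : d.-tuple R := [tuple (nat_of_ord i == 0)%:R | i < d].

(* By rotation invariance the centre of the cap is irrelevant (for 0 < d). *)
Definition cap_measure theta : R := fine (surface_measure (cap theta pole)).

End euclidean_sphere.

(* Finite subsets of T.  A set of configurations is measurable when its
   preimage by (t_0, ..., t_(k-1)) |-> {t_0, ..., t_(k-1)} is, for every k. *)
Section configuration.
Variables (disp : measure_display) (T : measurableType disp).

Definition configuration : Type := {fset T}.

HB.instance Definition _ := Choice.on configuration.
HB.instance Definition _ := isPointed.Build configuration fset0.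

Definition config_of_tuple (k : nat) (t : k.-tuple T) : configuration :=
  [fset x in (t : seq T)]%fset.

Definition config_measurable : set (set configuration) :=
  [set B | forall k, measurable (@config_of_tuple k @^-1` B)].

Let config_measurable0 : config_measurable set0.
Proof. by move=> k; rewrite preimage_set0. Qed.

Let config_measurableC B : config_measurable B -> config_measurable (~` B).
Proof. by move=> mB k; rewrite preimage_setC; apply: measurableC; exact: mB. Qed.

Let config_measurable_bigcup (F : (set configuration)^nat) :
  (forall i, config_measurable (F i)) -> config_measurable (\bigcup_i F i).
Proof.
by move=> mF k; rewrite preimage_bigcup; apply: bigcupT_measurable => i; exact: mF.
Qed.

HB.instance Definition _ := @isMeasurable.Build default_measure_display
  configuration config_measurable
  config_measurable0 config_measurableC config_measurable_bigcup.

End configuration.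

(* Law of the Poisson point process with intensity lambda * s, for a probability
   measure s: a Poisson(lambda) number of independent points of law s. *)
Definition poisson_process (R : realType) (disp : measure_display)
    (T : measurableType disp) (s : set T -> \bar R) (lambda : R)
    (B : set (configuration T)) : \bar R :=
  (\sum_(0 <= k <oo)
    (poisson_pmf lambda k)%:E * pushforward (mpower s k) (@config_of_tuple _ T k) B)%E.

Section hard_cap_model.
Variables (R : realType) (d : nat).
Implicit Types theta lambda : R.

Definition hard_cap theta : set (configuration (d.-tuple R)) :=
  [set X | forall x y, x \in (X : {fset _}) -> y \in (X : {fset _}) -> x != y ->
    dotp x y <= cos theta].

Definition hard_cap_law theta lambda (B : set (configuration (d.-tuple R))) :
    \bar R :=
  let P := poisson_process (@surface_measure R d) lambda in
  (P (B `&` hard_cap theta) * (fine (P (hard_cap theta)))^-1%:E)%E.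

Definition expected_size theta lambda : R :=
  fine (\int[hard_cap_law theta lambda]_X (#|` (X : {fset _})|%:R)%:E)%E.

Definition spherical_code theta (C : {fset d.-tuple R}) : Prop :=
  (forall x, x \in C -> sphere x) /\ hard_cap theta C.

Definition max_code_size theta : nat :=
  xget 0%N [set n | (exists2 C, spherical_code theta C & #|` C| = n) /\
                    (forall C, spherical_code theta C -> (#|` C| <= n)%N)].

End hard_cap_model.

(* Main.v *)
(* Let Z_D and M_D be the partition function and the unnormalised mean size of
   the model restricted to D.  Resampling the points in the cap of a uniformly
   chosen point v turns any local inequality K Z_D <= M_D + e, valid for all
   D, into the global bound K <= (s_d(theta) + e / lambda) E|X|.

   For the local inequality: if D is small, then Z_D <= exp (lambda |D|) is
   absorbed in e.  Otherwise, by monotonicity in the fugacity, one may lower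
   lambda until lambda |D| is about L d, and it suffices that the pairs of
   points of D at angle less than theta form a vanishing proportion of D^2.
   This holds as soon as |D| is exponentially larger than
   (sqrt 2 sin (theta / 2))^d: then no large part of D can correlate by more
   than sqrt (cos theta) with a direction, so if many pairs had inner product
   at least t, k such points with a large common neighbourhood would, by the
   mean bound applied to their sum, produce many pairs with inner product at
   least t + eta; iterating pushes the inner product above 1. *)

Require Import Defs.
From HB Require Import structures.
From mathcomp Require Import all_boot all_order all_algebra finmap.
From mathcomp Require Import all_classical all_reals all_analysis.
From mathcomp Require Import measurable_realfun.
From mathcomp Require Import ring lra zify.

Set Implicit Arguments.
Unset Strict Implicit.
Unset Printing Implicit Defensive.

Import Order.TTheory GRing.Theory Num.Theory.
Import numFieldNormedType.Exports.

Local Open Scope classical_set_scope.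
Local Open Scope ring_scope.

(** * Bounded measurable functions *)

(** The threshold comes from q = sqrt 2 sin (theta / 2), for which q ^ 2 = 1 - cos theta. The points
    with inner product at least t with a fixed direction have measure about (1 - t ^ 2) ^ (d / 2),
    so a set of measure above rho ^ d with rho > q cannot lie in such a cap for some t with t ^ 2 <
    cos theta. In the bootstrap, k points with pairwise inner products at most t' have a sum of
    squared norm at most k + k ^ 2 t'; if their common t-neighbourhood has mean correlation at most
    r with every direction, then t ^ 2 <= r ^ 2 (1 / k + t'). Since r ^ 2 < cos theta <= t, this
    forces t' above t by a fixed amount. Neither k nor the number of rounds depends on d, so
    starting from a proportion of order 1 / d costs only a power of d, against the exponential gap
    between rho and q + delta. The constant of the theorem comes from the case of small D: it needs
    K exp K' <= e with e a small multiple of s_d(theta) lambda. As s_d(theta) is about (sin theta) ^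
    d and lambda can be lowered to about q ^ (- d), this allows K' close to d log (sin theta /
    q). *)

Section bounded_measurable.
Context {R : realType}.

(** Such functions are integrable for every probability and, unlike integrable functions, closed
    under products, so side conditions follow the shape of the integrand. *)
Definition bmeas d (T : measurableType d) (f : T -> R) : Prop :=
  measurable_fun setT f /\ exists M : R, forall x, `|f x| <= M.

Context d (T : measurableType d).
Implicit Types f g : T -> R.

Lemma bmeas_cst (c : R) : bmeas (fun _ : T => c).
Proof. by split; [exact: measurable_cst | exists `|c|]. Qed.

Lemma bmeasD f g : bmeas f -> bmeas g -> bmeas (fun x => f x + g x).
Proof.
move=> [mf [M Mf]] [mg [N Ng]]; split; first exact: measurable_funD.
by exists (M + N) => x; rewrite (le_trans (ler_normD _ _))// lerD.
Qed.

Lemma bmeasM f g : bmeas f -> bmeas g -> bmeas (fun x => f x * g x).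
Proof.
move=> [mf [M Mf]] [mg [N Ng]]; split; first exact: measurable_funM.
by exists (M * N) => x; rewrite normrM ler_pM.
Qed.

Lemma bmeasN f : bmeas f -> bmeas (fun x => - f x).
Proof.
move=> [mf [M Mf]]; split; first exact: measurableT_comp.
by exists M => x; rewrite normrN.
Qed.

Lemma bmeasB f g : bmeas f -> bmeas g -> bmeas (fun x => f x - g x).
Proof. by move=> bf bg; apply: bmeasD => //; exact: bmeasN. Qed.

Lemma bmeas_sum (J : Type) (s : seq J) (F : J -> T -> R) :
  (forall j, bmeas (F j)) -> bmeas (fun x => \sum_(j <- s) F j x).
Proof.
move=> bF; elim: s => [|j s IH].
  rewrite (_ : (fun _ => _) = fun=> 0); first exact: bmeas_cst.
  by apply/funext => x; rewrite big_nil.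
rewrite (_ : (fun _ => _) = fun x => F j x + \sum_(i <- s) F i x).
  exact: bmeasD.
by apply/funext => x; rewrite big_cons.
Qed.

Lemma bmeas_indic (A : set T) : measurable A -> bmeas (\1_A : T -> R).
Proof.
move=> mA; split; first exact: measurable_indic.
by exists 1 => x; rewrite indicE; case: (_ \in _); rewrite ?normr1 ?normr0.
Qed.

Lemma bmeas_comp d' (S : measurableType d') (g : S -> T) f :
  measurable_fun setT g -> bmeas f -> bmeas (fun x => f (g x)).
Proof.
move=> mg [mf [M Mf]]; split; last by exists M => x; exact: Mf.
exact: measurableT_comp.
Qed.

End bounded_measurable.

Section probability_Rintegral.
Context {R : realType} d (T : measurableType d) (P : probability T R).
Implicit Types f g : T -> R.

Lemma bmeas_integrable f : bmeas f -> P.-integrable setT (EFin \o f).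
Proof.
move=> [mf [M Mf]]; apply: measurable_bounded_integrable => //.
  exact: le_lt_trans (probability_le1 P measurableT) (ltry _).
exists M; split; first exact: num_real.
by move=> y My x _; exact: le_trans (Mf x) (ltW My).
Qed.

Lemma bRintegralD f g : bmeas f -> bmeas g ->
  \int[P]_x (f x + g x) = \int[P]_x f x + \int[P]_x g x.
Proof. by move=> ? ?; apply: RintegralD => //; exact: bmeas_integrable. Qed.

Lemma bRintegralB f g : bmeas f -> bmeas g ->
  \int[P]_x (f x - g x) = \int[P]_x f x - \int[P]_x g x.
Proof. by move=> ? ?; apply: RintegralB => //; exact: bmeas_integrable. Qed.

Lemma bRintegralZl (c : R) f : bmeas f ->
  \int[P]_x (c * f x) = c * \int[P]_x f x.
Proof. by move=> ?; apply: RintegralZl => //; exact: bmeas_integrable. Qed.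

Lemma bRintegralZr (c : R) f : bmeas f ->
  \int[P]_x (f x * c) = \int[P]_x f x * c.
Proof. by move=> ?; apply: RintegralZr => //; exact: bmeas_integrable. Qed.

Lemma le_bRintegral f g : bmeas f -> bmeas g -> (forall x, f x <= g x) ->
  \int[P]_x f x <= \int[P]_x g x.
Proof. by move=> ? ? ?; apply: le_Rintegral => //; exact: bmeas_integrable. Qed.

Lemma bRintegral_cst (c : R) : \int[P]_x c = c.
Proof. 
rewrite Rintegral_cst// -[RHS]mulr1; congr (_ * _).
exact: (congr1 fine (probability_setT P)).
Qed.

Lemma bRintegral_sum (J : Type) (s : seq J) (F : J -> T -> R) :
  (forall j, bmeas (F j)) ->
  \int[P]_x (\sum_(j <- s) F j x) = \sum_(j <- s) \int[P]_x F j x.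
Proof.
move=> bF; elim: s => [|j s IH].
  rewrite big_nil -[RHS](bRintegral_cst 0).
  by apply: eq_Rintegral => x _; rewrite big_nil.
rewrite big_cons -IH -bRintegralD//; last exact: bmeas_sum.
by apply: eq_Rintegral => x _; rewrite big_cons.
Qed.

Lemma Rintegral_indicT (A : set T) : measurable A ->
  \int[P]_x (\1_A x) = fine (P A).
Proof. by move=> mA; rewrite /Rintegral integral_indic// setIT. Qed.

End probability_Rintegral.

Section parametrized_Rintegral.
Context {R : realType} d (T : measurableType d) (P : probability T R).

Lemma bmeas_Rintegral d' (S : measurableType d') (F : S -> T -> R) :
  bmeas (fun z : S * T => F z.1 z.2) -> bmeas (fun p => \int[P]_x F p x).
Proof.
move=> [mF [M MF]].
have bFp p : bmeas (F p).
  split; last by exists M => x; exact: (MF (p, x)).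
  exact: (measurableT_comp mF (pair1_measurable p)).
have MI p : `|\int[P]_x F p x| <= M.
  apply: le_trans (le_normr_Rintegral _ (bmeas_integrable P (bFp p))) _ => //.
  rewrite -[leRHS](bRintegral_cst P); apply: le_bRintegral.
  - case: (bFp p) => mFp [N NF]; split; first exact: measurableT_comp.
    by exists N => x; rewrite normr_id.
  - exact: bmeas_cst.
  - by move=> x; exact: (MF (p, x)).
split; last by exists M.
(* shifting by the bound M reduces measurability to the non-negative case *)
have mFM : measurable_fun setT (fun z : S * T => (F z.1 z.2 + M)%:E).
  by apply/measurable_EFinP; apply: measurable_funD.
have FM0 z : (0 <= (F z.1 z.2 + M)%:E)%E.
  by rewrite lee_fin -lerBlDr sub0r; have /ler_normlP[] := MF z; rewrite lerNl.
have := measurable_fun_fubini_tonelli_F (m2 := P) _ mFM FM0.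
rewrite /fubini_F /= => mI.
rewrite (_ : (fun _ => _) =
  fun p => fine (\int[P]_y (F p y + M)%:E)%E - M).
  apply: measurable_funB => //.
  exact: measurableT_comp mI.
apply/funext => p; apply/eqP; rewrite eq_sym subr_eq; apply/eqP.
by rewrite -[X in _ + X](bRintegral_cst P) -bRintegralD//; exact: bmeas_cst.
Qed.

Lemma Rintegral_swap (F : T -> T -> R) :
  bmeas (fun z : T * T => F z.1 z.2) ->
  \int[P]_x \int[P]_y F x y = \int[P]_y \int[P]_x F x y.
Proof.
move=> bF; have bi := bmeas_integrable (P \x P)%E bF.
have bFx x : bmeas (F x).
  by apply: (bmeas_comp (g := pair x) _ bF); exact: pair1_measurable.
have bFy y : bmeas (F ^~ y).
  by apply: (bmeas_comp (g := pair ^~ y) _ bF); exact: pair2_measurable.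
have E1 x : (\int[P]_y (F x y)%:E = (\int[P]_y F x y)%R%:E)%E.
  by rewrite /Rintegral fineK//; apply: integrable_fin_num => //; exact: bmeas_integrable.
have E2 y : (\int[P]_x (F x y)%:E = (\int[P]_x F x y)%R%:E)%E.
  by rewrite /Rintegral fineK//; apply: integrable_fin_num => //; exact: bmeas_integrable.
have := Fubini bi => /=.
under eq_integral do rewrite E1.
under [RHS]eq_integral do rewrite E2.
by move=> /(congr1 fine).
Qed.

End parametrized_Rintegral.

(** * Hard-core coefficients *)

(** Pascal's rule: when n points are split into two kinds, one more point joins either the first
    kind or the second. *)
Lemma pascal_sum (R : nzRingType) n (B : nat -> nat -> R) :
  \sum_(m < n.+1) 'C(n, m)%:R * B m.+1 (n - m)%N +
  \sum_(m < n.+1) 'C(n, m)%:R * B m (n - m).+1 =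
  \sum_(m < n.+2) 'C(n.+1, m)%:R * B m (n.+1 - m)%N.
Proof.
rewrite [RHS]big_ord_recl [X in _ + X = _]big_ord_recl !bin0 !subn0.
rewrite [LHS]addrCA; congr (_ + _).
under [RHS]eq_bigr => m _ do rewrite lift0 binS subSS natrD mulrDl.
rewrite big_split /= addrC; congr (_ + _).
rewrite [RHS]big_ord_recr /= bin_small// mul0r addr0.
by apply: eq_bigr => m _; rewrite /bump add1n subnSK.
Qed.

Section hard_core_coefficients.
Context {R : realType} d (T : measurableType d) (P : probability T R).
Variable h : T -> T -> R.
Hypothesis h_bmeas : bmeas (fun z : T * T => h z.1 z.2).
Hypothesis h01 : forall x y, 0 <= h x y <= 1.
Hypothesis h_sym : forall x y, h x y = h y x.
Implicit Types phi psi : T -> R.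

(** Weights replace subsets: fixing a point x turns [phi] into [phi * h x], again a weight, and the
    inductions on the number of points run along this operation. *)
Definition weight phi : Prop := bmeas phi /\ forall x, 0 <= phi x <= 1.

(* [coef k phi] is the integral of the product of [phi (x_i)] and of [h x_i x_j]
   (i < j) over k-tuples of points. *)
Fixpoint coef k phi : R :=
  if k is k'.+1 then \int[P]_x (phi x * coef k' (fun y => phi y * h x y)) else 1.

Definition conflict phi : R :=
  \int[P]_x (phi x * \int[P]_y (phi y * (1 - h x y))).

Lemma bmeas_h x : bmeas (h x).
Proof.
by apply: (bmeas_comp (g := pair x) _ h_bmeas); exact: pair1_measurable.
Qed.

Lemma bmeas_mul_h d' (S : measurableType d') (phi : S -> T -> R) :
  bmeas (fun z : S * T => phi z.1 z.2) ->
  bmeas (fun w : (S * T) * T => phi w.1.1 w.2 * h w.1.2 w.2).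
Proof.
move=> bphi; apply: bmeasM.
- apply: (bmeas_comp (g := fun w : (S * T) * T => (w.1.1, w.2)) _ bphi).
  apply: measurable_fun_pair => //.
  exact: (measurableT_comp measurable_fst measurable_fst).
- apply: (bmeas_comp (g := fun w : (S * T) * T => (w.1.2, w.2)) _ h_bmeas).
  apply: measurable_fun_pair => //.
  exact: (measurableT_comp measurable_snd measurable_fst).
Qed.

(** The parameter space is arbitrary because each step of the induction turns the integrated point
    into a further parameter, passing from [S] to [S * T]. *)
Lemma bmeas_coef k : forall d' (S : measurableType d') (phi : S -> T -> R),
  bmeas (fun z : S * T => phi z.1 z.2) -> bmeas (fun p => coef k (phi p)).
Proof.
elim: k => [|k IH] d' S phi bphi; first exact: bmeas_cst.
apply: (bmeas_Rintegral P (F := fun p x => phi p x * coef k (fun y => phi p y * h x y))).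
apply: bmeasM => //.
apply: (IH _ _ (fun (z : S * T) y => phi z.1 y * h z.2 y)).
exact: bmeas_mul_h.
Qed.

Lemma bmeas_mul_h1 phi : bmeas phi ->
  bmeas (fun z : T * T => phi z.2 * h z.1 z.2).
Proof. by move=> bphi; apply: bmeasM => //; exact: bmeas_comp bphi. Qed.

Lemma bmeas_coef_h k phi : bmeas phi ->
  bmeas (fun x => coef k (fun y => phi y * h x y)).
Proof.
move=> bphi; apply: (@bmeas_coef _ _ _ (fun x y => phi y * h x y)).
exact: bmeas_mul_h1.
Qed.

Lemma bmeas_coef_step k phi psi : bmeas phi -> bmeas psi ->
  bmeas (fun x => psi x * coef k (fun y => phi y * h x y)).
Proof. by move=> ? ?; apply: bmeasM => //; exact: bmeas_coef_h. Qed.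

Lemma bmeas_deg phi : bmeas phi ->
  bmeas (fun x => \int[P]_y (phi y * (1 - h x y))).
Proof.
move=> bphi; apply: (bmeas_Rintegral P (F := fun x y => phi y * (1 - h x y))).
apply: bmeasM; first exact: bmeas_comp bphi.
by apply: bmeasB => //; exact: bmeas_cst.
Qed.

Lemma weight_mul phi psi : weight phi -> weight psi ->
  weight (fun y => phi y * psi y).
Proof.
move=> [bp p01] [bq q01]; split; first exact: bmeasM.
move=> y; have /andP[? ?] := p01 y; have /andP[? ?] := q01 y.
by rewrite mulr_ge0//= mulr_ile1.
Qed.

Lemma weight_h x : weight (h x).
Proof. by split; [exact: bmeas_h | move=> y; exact: h01]. Qed.

Lemma weight_mul_h x phi : weight phi -> weight (fun y => phi y * h x y).
Proof. by move=> wphi; apply: weight_mul => //; exact: weight_h. Qed.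

Lemma mul_h_le x phi y : weight phi -> phi y * h x y <= phi y.
Proof.
move=> [_ /(_ y)/andP[p0 _]]; have /andP[? ?] := h01 x y.
by rewrite ler_piMr.
Qed.

Lemma coef_ge0 k : forall phi, weight phi -> 0 <= coef k phi.
Proof.
elim: k => [//|k IH] phi wphi /=; apply: Rintegral_ge0 => x _.
apply: mulr_ge0; first by have [_ /(_ x)/andP[]] := wphi.
by apply: IH; exact: weight_mul_h.
Qed.

Lemma le_coef k : forall phi psi, weight phi -> weight psi ->
  (forall x, phi x <= psi x) -> coef k phi <= coef k psi.
Proof.
elim: k => [//|k IH] phi psi wp wq pq /=.
have [bp p01] := wp; have [bq q01] := wq.
apply: le_bRintegral; [exact: bmeas_coef_step|exact: bmeas_coef_step|move=> x].
have /andP[p0 _] := p01 x; apply: ler_pM => //.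
  by apply: coef_ge0; exact: weight_mul_h.
apply: IH; [exact: weight_mul_h|exact: weight_mul_h|move=> y].
by have /andP[? ?] := h01 x y; rewrite ler_wpM2r.
Qed.

Lemma coef_le_expn k phi : weight phi -> coef k phi <= (\int[P]_x phi x) ^+ k.
Proof.
move=> wp; have [bp p01] := wp.
elim: k => [//|k IH] /=; rewrite exprS.
rewrite -bRintegralZr//; apply: le_bRintegral.
- exact: bmeas_coef_step.
- by apply: bmeasM => //; exact: bmeas_cst.
- move=> x; have /andP[p0 _] := p01 x; rewrite ler_wpM2l//.
  apply: le_trans IH; apply: le_coef => //; first exact: weight_mul_h.
  by move=> y; exact: mul_h_le.
Qed.

Lemma deg_ge0 phi x : weight phi -> 0 <= \int[P]_y (phi y * (1 - h x y)).
Proof.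
move=> [_ p01]; apply: Rintegral_ge0 => y _.
have /andP[? _] := p01 y; have /andP[_ ?] := h01 x y.
by rewrite mulr_ge0// subr_ge0.
Qed.

Lemma conflict_ge0 phi : weight phi -> 0 <= conflict phi.
Proof.
move=> wp; apply: Rintegral_ge0 => x _.
by have [_ /(_ x)/andP[? _]] := wp; rewrite mulr_ge0// deg_ge0.
Qed.

Lemma le_conflict phi psi : weight phi -> weight psi ->
  (forall x, phi x <= psi x) -> conflict phi <= conflict psi.
Proof.
move=> wp wq pq; have [bp p01] := wp; have [bq q01] := wq.
apply: le_bRintegral.
- by apply: bmeasM => //; exact: bmeas_deg.
- by apply: bmeasM => //; exact: bmeas_deg.
- move=> x; have /andP[p0 _] := p01 x; apply: ler_pM => //.
    exact: deg_ge0.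
  have b1h : bmeas (fun y => 1 - h x y).
    by apply: bmeasB; [exact: bmeas_cst|exact: bmeas_h].
  apply: le_bRintegral; [exact: bmeasM|exact: bmeasM|move=> y].
  by have /andP[_ ?] := h01 x y; rewrite ler_wpM2r// subr_ge0.
Qed.

Lemma Rintegral_mul_h x phi : bmeas phi ->
  \int[P]_y (phi y * h x y) =
  \int[P]_y phi y - \int[P]_y (phi y * (1 - h x y)).
Proof.
move=> bp; rewrite -bRintegralB//.
  by apply: eq_Rintegral => y _; ring.
by apply: bmeasM => //; apply: bmeasB; [exact: bmeas_cst|exact: bmeas_h].
Qed.

(** A further point placed without constraint contributes the first product. It conflicts with one
    of the k others in at most k ways, and dropping the interactions of that other point leaves a
    [k.-1]-point coefficient times [conflict phi]. *)
Lemma coef_succ_ge k : forall phi, weight phi ->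
  coef k phi * \int[P]_x phi x - k%:R * coef k.-1 phi * conflict phi
  <= coef k.+1 phi.
Proof.
elim: k => [|k IH] phi wp; have [bp p01] := wp.
  rewrite mul1r !mul0r subr0 le_eqVlt; apply/orP; left; apply/eqP.
  by apply: eq_Rintegral => x _; rewrite mulr1.
set E := conflict phi; set I1 := \int[P]_x phi x.
pose g x := coef k (fun y => phi y * h x y).
pose g' x := coef k.-1 (fun y => phi y * h x y).
pose dg x := \int[P]_y (phi y * (1 - h x y)).
have bg : bmeas g by exact: bmeas_coef_h.
have bg' : bmeas g' by exact: bmeas_coef_h.
have bdg : bmeas dg by exact: bmeas_deg.
(* The induction hypothesis for [phi * h x] bounds the integrand below by [phi x * (g x * (I1 - dg
   x) - k%:R * g' x * E)]. In [lo] the factor [g x] of [dg x] is enlarged to the constant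
   [coef k phi], so that integration produces [conflict phi]. *)
pose lo x := (phi x * g x) * I1 - coef k phi * (phi x * dg x)
  - k%:R * E * (phi x * g' x).
have le_lo x : lo x <= phi x * coef k.+1 (fun y => phi y * h x y).
  have wx := weight_mul_h x wp.
  have /andP[p0 _] := p01 x.
  have Ex : conflict (fun y => phi y * h x y) <= E.
    by apply: le_conflict => // y; exact: mul_h_le.
  have gk : g x <= coef k phi by apply: le_coef => // y; exact: mul_h_le.
  have d0 : 0 <= dg x by exact: deg_ge0.
  have g'0 : 0 <= g' x by exact: coef_ge0.
  apply: le_trans (_ : phi x * (g x * (I1 - dg x) - k%:R * g' x * E) <= _).
    rewrite /lo -subr_ge0.
    rewrite (_ : _ - _ = phi x * ((coef k phi - g x) * dg x)); last by ring.
    by rewrite mulr_ge0// mulr_ge0// subr_ge0.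
  rewrite ler_wpM2l//; apply: le_trans (IH _ wx).
  by rewrite Rintegral_mul_h// lerD2l lerN2 ler_wpM2l// mulr_ge0.
have blo1 : bmeas (fun x => phi x * g x * I1).
  by apply: bmeasM; [exact: bmeasM|exact: bmeas_cst].
have blo2 : bmeas (fun x => coef k phi * (phi x * dg x)).
  by apply: bmeasM; [exact: bmeas_cst|exact: bmeasM].
have blo3 : bmeas (fun x => k%:R * E * (phi x * g' x)).
  by apply: bmeasM; [exact: bmeas_cst|exact: bmeasM].
have blo12 := bmeasB blo1 blo2.
apply: le_trans (_ : \int[P]_x lo x <= _); last first.
  apply: le_bRintegral => //; first exact: bmeasB.
  exact: (@bmeas_coef_step k.+1).
rewrite /lo bRintegralB// bRintegralB// bRintegralZr; last exact: bmeasM.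
rewrite bRintegralZl; last exact: bmeasM.
rewrite bRintegralZl; last exact: bmeasM.
rewrite -[\int[P]_x (phi x * dg x)]/E -[\int[P]_x (phi x * g x)]/(coef k.+1 phi) /=.
have -> : k%:R * E * \int[P]_x (phi x * g' x) = k%:R * E * coef k phi.
  (* For k = 0 the truncated [k.-1] is harmless, as the factor [k%:R] vanishes. *)
  by case: (k) @g' {bg' lo le_lo blo3} => [|k'] g'; rewrite ?mul0r.
rewrite le_eqVlt; apply/orP; left; apply/eqP.
by rewrite -natr1; ring.
Qed.

(** The integral over m points weighted by [phi] and k points weighted by [psi], with a factor [h]
    for every pair among the m + k points. *)
Fixpoint mixed_coef m k phi psi : R :=
  if m is m'.+1 then
    \int[P]_x (phi x *
      mixed_coef m' k (fun y => phi y * h x y) (fun y => psi y * h x y))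
  else coef k psi.

Lemma bmeas_mixed_coef m k : forall d' (S : measurableType d')
    (phi psi : S -> T -> R),
  bmeas (fun z : S * T => phi z.1 z.2) -> bmeas (fun z : S * T => psi z.1 z.2) ->
  bmeas (fun p => mixed_coef m k (phi p) (psi p)).
Proof.
elim: m => [|m IH] d' S phi psi bp bq; first exact: bmeas_coef.
apply: (bmeas_Rintegral P (F := fun p x => phi p x *
  mixed_coef m k (fun y => phi p y * h x y) (fun y => psi p y * h x y))).
apply: bmeasM => //.
apply: (IH _ _ (fun (z : S * T) y => phi z.1 y * h z.2 y)
               (fun (z : S * T) y => psi z.1 y * h z.2 y)); exact: bmeas_mul_h.
Qed.

Lemma bmeas_mixed_step m k phi psi chi : bmeas phi -> bmeas psi -> bmeas chi ->
  bmeas (fun x => chi x *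
    mixed_coef m k (fun y => phi y * h x y) (fun y => psi y * h x y)).
Proof.
move=> bp bq bc; apply: bmeasM => //.
by apply: (@bmeas_mixed_coef _ _ _ _ (fun x y => phi y * h x y)
   (fun x y => psi y * h x y)); exact: bmeas_mul_h1.
Qed.

Lemma mixed_coef_ge0 m k : forall phi psi, weight phi -> weight psi ->
  0 <= mixed_coef m k phi psi.
Proof.
elim: m => [|m IH] phi psi wp wq /=; first exact: coef_ge0.
apply: Rintegral_ge0 => x _.
apply: mulr_ge0; first by have [_ /(_ x)/andP[]] := wp.
by apply: IH; exact: weight_mul_h.
Qed.

(** By Fubini and the symmetry of [h], a [psi]-point that is integrated first can be moved past the
    [phi]-points one at a time. *)
Lemma mixed_coefS m k : forall phi psi, bmeas phi -> bmeas psi ->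
  \int[P]_x (psi x *
    mixed_coef m k (fun y => phi y * h x y) (fun y => psi y * h x y)) =
  mixed_coef m k.+1 phi psi.
Proof.
elim: m => [//|m IH] phi psi bp bq.
pose G x y := psi x * (phi y * h x y * mixed_coef m k
  (fun z => phi z * h x z * h y z) (fun z => psi z * h x z * h y z)).
transitivity (\int[P]_x \int[P]_y G x y).
  apply: eq_Rintegral => x _ /=; rewrite -bRintegralZl//.
  have bhx chi : bmeas chi -> bmeas (fun y => chi y * h x y).
    by move=> bc; apply: bmeasM => //; exact: bmeas_h.
  by apply: bmeas_mixed_step; exact: bhx.
rewrite Rintegral_swap; last first.
  apply: bmeasM; first exact: (bmeas_comp (g := fst)).
  apply: bmeasM; first exact: bmeas_mul_h1.
  pose phi2 (w : T * T) z := phi z * h w.1 z * h w.2 z.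
  pose psi2 (w : T * T) z := psi z * h w.1 z * h w.2 z.
  apply: (@bmeas_mixed_coef m k _ _ phi2 psi2).
  - exact: (@bmeas_mul_h _ _ (fun x y => phi y * h x y) (bmeas_mul_h1 bp)).
  - exact: (@bmeas_mul_h _ _ (fun x y => psi y * h x y) (bmeas_mul_h1 bq)).
apply: eq_Rintegral => y _.
change (\int[P]_x G x y = phi y *
  mixed_coef m k.+1 (fun z => phi z * h y z) (fun z => psi z * h y z)).
have bhy chi : bmeas chi -> bmeas (fun x => chi x * h y x).
  by move=> bc; apply: bmeasM => //; exact: bmeas_h.
rewrite -IH; [|exact: bhy|exact: bhy].
rewrite -bRintegralZl; last by apply: bmeas_mixed_step; exact: bhy.
apply: eq_Rintegral => x _; rewrite /G [h x y]h_sym.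
have sw chi : (fun z => chi z * h x z * h y z) = (fun z => chi z * h y z * h x z).
  by apply/funext => z; rewrite mulrAC.
by rewrite !sw; ring.
Qed.

(** A binomial theorem: each of the n points is charged to [phi] or to [psi], and by symmetry only
    the number m of the former matters. *)
Lemma coef_add_mixed n : forall phi psi, bmeas phi -> bmeas psi ->
  coef n (fun x => phi x + psi x) =
  \sum_(m < n.+1) 'C(n, m)%:R * mixed_coef m (n - m) phi psi.
Proof.
have distr phi psi x : (fun y => (phi y + psi y) * h x y) =
    (fun y => phi y * h x y + psi y * h x y).
  by apply/funext => y; rewrite mulrDl.
elim: n => [|n IH] phi psi bp bq.
  by rewrite big_ord1 bin0 subn0 mul1r.
have bhx x chi : bmeas chi -> bmeas (fun y => chi y * h x y).
  by move=> bc; apply: bmeasM => //; exact: bmeas_h.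
have half chi : bmeas chi -> \int[P]_x (chi x * coef n (fun y => (phi y + psi y) * h x y)) =
    \sum_(m < n.+1) 'C(n, m)%:R * \int[P]_x (chi x * mixed_coef m (n - m)
      (fun y => phi y * h x y) (fun y => psi y * h x y)).
  move=> bc; transitivity (\int[P]_x \sum_(m < n.+1) 'C(n, m)%:R * (chi x *
      mixed_coef m (n - m) (fun y => phi y * h x y) (fun y => psi y * h x y))).
    apply: eq_Rintegral => x _; rewrite distr IH; [|exact: bhx|exact: bhx].
    by rewrite mulr_sumr; apply: eq_bigr => m _; rewrite mulrCA.
  have bm m : bmeas (fun x => chi x * mixed_coef m (n - m)
      (fun y => phi y * h x y) (fun y => psi y * h x y)).
    exact: bmeas_mixed_step.
  rewrite bRintegral_sum; last first.
    by move=> m; apply: bmeasM => //; exact: bmeas_cst.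
  by apply: eq_bigr => m _; rewrite bRintegralZl.
rewrite /=.
transitivity (\int[P]_x (phi x * coef n (fun y => (phi y + psi y) * h x y)) +
              \int[P]_x (psi x * coef n (fun y => (phi y + psi y) * h x y))).
  have bpq : bmeas (fun x => phi x + psi x) by exact: bmeasD.
  rewrite -bRintegralD; [|exact: bmeas_coef_step|exact: bmeas_coef_step].
  by apply: eq_Rintegral => x _; rewrite mulrDl.
rewrite !half// -(pascal_sum _ (fun m k => mixed_coef m k phi psi)).
by congr (_ + _); apply: eq_bigr => m _; rewrite mixed_coefS.
Qed.

(** One marked [psi]-point and n further points of either kind: this is how the mean number of
    [psi]-points enters [local_bound_split]. *)
Lemma coef_mixed_shift n phi psi : bmeas phi -> bmeas psi ->
  \int[P]_x (psi x * coef n (fun y => (phi y + psi y) * h x y)) =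
  \sum_(m < n.+1) 'C(n, m)%:R * mixed_coef m (n - m).+1 phi psi.
Proof.
move=> bp bq.
have bhx x chi : bmeas chi -> bmeas (fun y => chi y * h x y).
  by move=> bc; apply: bmeasM => //; exact: bmeas_h.
transitivity (\int[P]_x \sum_(m < n.+1) 'C(n, m)%:R * (psi x *
    mixed_coef m (n - m) (fun y => phi y * h x y) (fun y => psi y * h x y))).
  apply: eq_Rintegral => x _.
  rewrite (_ : (fun y => _) = (fun y => phi y * h x y + psi y * h x y)); last first.
    by apply/funext => y; rewrite mulrDl.
  rewrite coef_add_mixed; [|exact: bhx|exact: bhx].
  by rewrite mulr_sumr; apply: eq_bigr => m _; rewrite mulrCA.
have bm m : bmeas (fun x => psi x * mixed_coef m (n - m)
    (fun y => phi y * h x y) (fun y => psi y * h x y)).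
  exact: bmeas_mixed_step.
rewrite bRintegral_sum; last by move=> m; apply: bmeasM => //; exact: bmeas_cst.
by apply: eq_bigr => m _; rewrite bRintegralZl// mixed_coefS.
Qed.

(** Fixing the [phi]-points only shrinks [psi], so a linear inequality known for all weights below
    [omega] applies to what remains and can be integrated over the [phi]-points. This is why the
    local inequality is wanted for all such weights. *)
Lemma mixed_coef_lincomb_le (N : nat) (c : nat -> R) (e : R) omega m :
  (forall psi, weight psi -> (forall x, psi x <= omega x) ->
    \sum_(k < N) c k * coef k psi <= e) ->
  forall phi psi, weight phi -> weight psi -> (forall x, psi x <= omega x) ->
  \sum_(k < N) c k * mixed_coef m k phi psi <= e * coef m phi.
Proof.
move=> ce; elim: m => [|m IH] phi psi wp wq qo; first by rewrite mulr1; exact: ce.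
have [bp p01] := wp; have [bq _] := wq.
pose F k x := phi x * mixed_coef m k (fun y => phi y * h x y) (fun y => psi y * h x y).
have bF k : bmeas (F k) by exact: bmeas_mixed_step.
have bm k : bmeas (fun x => c k * F k x) by apply: bmeasM => //; exact: bmeas_cst.
have -> : \sum_(k < N) c k * mixed_coef m.+1 k phi psi =
    \int[P]_x \sum_(k < N) c k * F k x.
  rewrite (bRintegral_sum P (index_enum _) (F := fun (k : 'I_N) x => c k * F k x))//.
  by apply: eq_bigr => k _; rewrite bRintegralZl.
rewrite /= -bRintegralZl; last exact: bmeas_coef_step.
apply: le_bRintegral.
- exact: bmeas_sum.
- by apply: bmeasM; [exact: bmeas_cst|exact: bmeas_coef_step].
move=> x; rewrite /F; under eq_bigr do rewrite mulrCA.
rewrite -mulr_sumr mulrCA ler_wpM2l//; first by have /andP[] := p01 x.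
apply: IH; [exact: weight_mul_h|exact: weight_mul_h|].
by move=> y; exact: le_trans (mul_h_le _ _ wq) (qo y).
Qed.

End hard_core_coefficients.

(** * Partition function and mean size as polynomials in the fugacity *)

Section partition_function.
Context {R : realType}.
Implicit Types (lam : R) (a : nat -> R) (N : nat).

(** The Poisson weight without its factor exp (- lam), which cancels in the mean size. *)
Definition fugw lam n : R := lam ^+ n / n`!%:R.

Lemma fugw_ge0 lam n : 0 <= lam -> 0 <= fugw lam n.
Proof. by move=> l0; rewrite divr_ge0// exprn_ge0. Qed.

Lemma fugwS lam n : n.+1%:R * fugw lam n.+1 = lam * fugw lam n.
Proof.
rewrite /fugw factS natrM exprS; have f0 : n`!%:R != 0 :> R.
  by rewrite pnatr_eq0 -lt0n fact_gt0.
have n0 : n.+1%:R != 0 :> R by rewrite pnatr_eq0.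
move: n0 f0; move: (n.+1%:R : R) (n`!%:R : R) (lam ^+ n) => q f l n0 f0.
by field; rewrite n0 f0.
Qed.

Lemma fugw_mul lam m k :
  fugw lam m * fugw lam k = fugw lam (m + k) * 'C(m + k, m)%:R.
Proof.
have f0 n : n`!%:R != 0 :> R by rewrite pnatr_eq0 -lt0n fact_gt0.
have := bin_fact (leq_addr k m); rewrite addKn => /(congr1 (fun n => n%:R : R)).
rewrite !natrM /fugw exprD => <-.
have C0 : 'C(m + k, m)%:R != 0 :> R by rewrite pnatr_eq0 -lt0n bin_gt0 leq_addr.
by field; rewrite !f0 C0.
Qed.

Lemma triangle_sum N (F : nat -> nat -> R) :
  (forall m k, (N < m + k)%N -> F m k = 0) ->
  \sum_(n < N.+1) \sum_(m < n.+1) F m (n - m)%N =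
  \sum_(m < N.+1) \sum_(k < N.+1) F m k.
Proof.
move=> F0.
transitivity (\sum_(n < N.+1) \sum_(m < N.+1 | (m <= n)%N) F m (n - m)%N).
  apply: eq_bigr => n _; rewrite (big_ord_widen_cond N.+1 xpredT (fun m => F m (n - m)%N))//.
rewrite (exchange_big_dep xpredT)//=; apply: eq_bigr => m _.
have -> : \sum_(k < N.+1) F m k = \sum_(k < (N - m).+1) F m k.
  rewrite [RHS](big_ord_widen_cond N.+1 xpredT (F m)) ?ltnS ?leq_subr//=.
  rewrite [LHS](bigID (fun k : 'I_N.+1 => (k < (N - m).+1)%N))/=.
  rewrite [X in _ + X]big1 ?addr0// => k; rewrite -leqNgt => Nk.
  by apply: F0; move: Nk; clear; lia.
rewrite -(big_mkord xpredT (fun k => F m k)).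
rewrite -(big_mkord (fun n => m <= n)%N (fun n => F m (n - m)%N)).
rewrite (big_cat_nat (n := m)) //=; last by rewrite ltnW.
rewrite big_nat_cond big1 ?add0r; last first.
  by move=> n /andP[/andP[_ nm]]; rewrite leqNgt nm.
rewrite big_nat_cond (eq_bigl (fun n => m <= n < N.+1)%N); last first.
  by move=> n /=; rewrite andbC andbA andbb.
rewrite -big_nat -{1}[nat_of_ord m]add0n big_addn subSn//; last by rewrite -ltnS.
by apply: eq_bigr => k _; rewrite addnK.
Qed.

(** The product rule for exponential generating functions; truncation is exact because [B] vanishes
    beyond total degree N. *)
Lemma fugw_convolution lam N (B : nat -> nat -> R) :
  (forall m k, (N < m + k)%N -> B m k = 0) ->
  \sum_(n < N.+1) fugw lam n * \sum_(m < n.+1) 'C(n, m)%:R * B m (n - m)%N =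
  \sum_(m < N.+1) fugw lam m * \sum_(k < N.+1) fugw lam k * B m k.
Proof.
move=> B0.
transitivity (\sum_(n < N.+1) \sum_(m < n.+1)
    fugw lam m * fugw lam (n - m)%N * B m (n - m)%N).
  apply: eq_bigr => n _; rewrite mulr_sumr; apply: eq_bigr => m _.
  by rewrite mulrA fugw_mul subnKC// -ltnS.
rewrite (triangle_sum (F := fun m k => fugw lam m * fugw lam k * B m k)).
  by apply: eq_bigr => m _; rewrite mulr_sumr; apply: eq_bigr => k _; rewrite mulrA.
by move=> m k mk; rewrite B0// mulr0.
Qed.

(** In the model N is the maximal code size, beyond which the coefficients vanish, so these finite
    sums are the full series. *)
Definition Zsum N a lam : R := \sum_(k < N.+1) fugw lam k * a k.
Definition Msum N a lam : R := \sum_(k < N.+1) k%:R * fugw lam k * a k.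

Lemma Msum_shift N a lam : a N.+1 = 0 ->
  Msum N a lam = lam * \sum_(k < N.+1) fugw lam k * a k.+1.
Proof.
move=> aN; rewrite /Msum big_ord_recl !mul0r add0r big_ord_recr/= aN mulr0 addr0.
rewrite mulr_sumr; apply: eq_bigr => k _.
by rewrite /bump /= add1n fugwS mulrA.
Qed.

Lemma Zsum_ge1 N a lam : 0 <= lam -> a 0%N = 1 -> (forall k, 0 <= a k) ->
  1 <= Zsum N a lam.
Proof.
move=> l0 a0 a_ge0; rewrite /Zsum big_ord_recl a0 /fugw expr0 divr1 mulr1.
by rewrite lerDl sumr_ge0// => k _; rewrite mulr_ge0// fugw_ge0.
Qed.

Lemma Msum_ge0 N a lam : 0 <= lam -> (forall k, 0 <= a k) -> 0 <= Msum N a lam.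
Proof.
by move=> l0 a_ge0; apply: sumr_ge0 => k _; rewrite mulr_ge0// mulr_ge0// fugw_ge0.
Qed.

(* Chebyshev's sum inequality: the mean size is non-decreasing in the fugacity. *)
Lemma Msum_Zsum_cross N a lam1 lam2 : 0 <= lam1 -> lam1 <= lam2 ->
  (forall k, 0 <= a k) ->
  Msum N a lam1 * Zsum N a lam2 <= Msum N a lam2 * Zsum N a lam1.
Proof.
move=> l0 l12 a0; have l20 := le_trans l0 l12.
rewrite -subr_ge0; set D := _ - _.
pose g (i j : nat) := a i * a j * (i%:R * (fugw lam2 i * fugw lam1 j - fugw lam1 i * fugw lam2 j)).
have DE : D = \sum_(i < N.+1) \sum_(j < N.+1) g i j.
  rewrite /D /Msum /Zsum !big_distrlr /= -sumrB; apply: eq_bigr => i _.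
  by rewrite -sumrB; apply: eq_bigr => j _; rewrite /g; ring.
(* After symmetrisation in i and j, each term is a product of two factors of the same sign. *)
have D2 : D + D = \sum_(i < N.+1) \sum_(j < N.+1) (g i j + g j i).
  rewrite {2}DE exchange_big /= DE -big_split /=; apply: eq_bigr => i _.
  by rewrite -big_split.
suff : 0 <= D + D by lra.
rewrite D2.
apply: sumr_ge0 => i _; apply: sumr_ge0 => j _.
have key (m n : nat) : (m <= n)%N -> fugw lam2 m * fugw lam1 n <= fugw lam1 m * fugw lam2 n.
  move=> mn; rewrite /fugw.
  have E l : l ^+ n = l ^+ m * l ^+ (n - m) :> R by rewrite -exprD subnKC.
  rewrite !E -subr_ge0.
  rewrite (_ : _ - _ = lam1 ^+ m * lam2 ^+ m / m`!%:R / n`!%:R *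
    (lam2 ^+ (n - m) - lam1 ^+ (n - m))); last by ring.
  by apply: mulr_ge0; rewrite ?subr_ge0 ?lerXn2r ?nnegrE// ?mulr_ge0 ?exprn_ge0 ?invr_ge0.
rewrite /g (_ : _ + _ = a i * a j *
  ((i%:R - j%:R) * (fugw lam2 i * fugw lam1 j - fugw lam1 i * fugw lam2 j))); last by ring.
apply: mulr_ge0; first exact: mulr_ge0.
have [ij|ji] := leqP i j.
  by apply: mulr_le0; rewrite subr_le0 ?ler_nat//; exact: key.
apply: mulr_ge0; rewrite subr_ge0 ?ler_nat ?(ltnW ji)//.
by rewrite mulrC [leRHS]mulrC; apply: key; exact: ltnW.
Qed.

Lemma Zsum_le_expR N a lam (I1 : R) : 0 <= lam -> 0 <= I1 ->
  (forall k, a k <= I1 ^+ k) -> Zsum N a lam <= expR (lam * I1).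
Proof.
move=> l0 I0 aI; apply: le_trans (_ : series (exp_coeff (lam * I1)) N.+1 <= _).
  rewrite /series /= big_mkord; apply: ler_sum => k _.
  rewrite exp_coeffE /= exprMn mulrA -/(_ / _) [X in X * _]mulrC.
  by rewrite ler_wpM2l// mulr_ge0 ?invr_ge0 ?exprn_ge0.
apply: nondecreasing_cvgn_le; last exact: is_cvg_series_exp_coeff.
apply/nondecreasing_seqP => n; rewrite /series /= big_nat_recr//= lerDl.
by apply: exp_coeff_ge0; exact: mulr_ge0.
Qed.

(** The extension inequality of [coef_succ_ge] is summed against the fugacity weights: its
    correction lowers the index once more, which yields a second factor [lam]. *)
Lemma Msum_ge N a lam (I1 E : R) : 0 <= lam -> 0 <= E -> (forall k, 0 <= a k) ->
  a N.+1 = 0 ->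
  (forall k, a k * I1 - k%:R * a k.-1 * E <= a k.+1) ->
  (lam * I1 - lam ^+ 2 * E) * Zsum N a lam <= Msum N a lam.
Proof.
move=> l0 E0 a0 aN aS; rewrite Msum_shift//.
apply: le_trans (_ : lam * \sum_(k < N.+1) fugw lam k * (a k * I1 - k%:R * a k.-1 * E) <= _).
  have -> : \sum_(k < N.+1) fugw lam k * (a k * I1 - k%:R * a k.-1 * E) =
     I1 * Zsum N a lam - E * \sum_(k < N.+1) k%:R * fugw lam k * a k.-1.
    rewrite /Zsum !mulr_sumr -sumrB; apply: eq_bigr => k _; ring.
  have : \sum_(k < N.+1) k%:R * fugw lam k * a k.-1 <= lam * Zsum N a lam.
    rewrite big_ord_recl !mul0r add0r /Zsum big_ord_recr /= mulrDr mulr_sumr.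
    rewrite -[leLHS]addr0 lerD//.
      by apply: ler_sum => k _; rewrite /bump /= add1n fugwS mulrA.
    by rewrite mulr_ge0// mulr_ge0// fugw_ge0.
  set S := \sum_(k < _) _ => SZ; rewrite mulrBl mulrBr.
  rewrite -mulrA lerD2l lerN2 expr2 -!mulrA ler_wpM2l//.
  by rewrite mulrCA ler_wpM2l.
rewrite ler_wpM2l//; apply: ler_sum => k _; rewrite ler_wpM2l//.
exact: fugw_ge0.
Qed.

End partition_function.

(** * From the local inequality to the global occupancy bound *)

Section occupancy_bound.
Context {R : realType} d (T : measurableType d) (P : probability T R).
Variable h : T -> T -> R.
Hypothesis h_bmeas : bmeas (fun z : T * T => h z.1 z.2).
Hypothesis h01 : forall x y, 0 <= h x y <= 1.
Hypothesis h_sym : forall x y, h x y = h y x.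
Variables (lam K e : R) (N : nat) (omega : T -> R).
Hypothesis lam_gt0 : 0 < lam.
Hypothesis e_ge0 : 0 <= e.
Hypothesis w_omega : weight omega.
Hypothesis coef_omega0 : forall k, (N < k)%N -> coef P h k omega = 0.
Implicit Types phi psi D : T -> R.

Let Z D := Zsum N (fun k => coef P h k D) lam.
Let M D := Msum N (fun k => coef P h k D) lam.

Hypothesis local_bound : forall D, weight D -> (forall x, D x <= omega x) ->
  K * Z D <= M D + e.

(* Conditioning on the points weighted by [phi] leaves a hard-core model on the
   points weighted by [psi]. *)
Lemma local_bound_split phi psi : weight phi -> weight psi ->
  (fun x => phi x + psi x) = omega ->
  K * Z omega <= lam * \sum_(n < N.+1) fugw lam n *
      \int[P]_x (psi x * coef P h n (fun y => omega y * h x y)) + e * Z phi.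
Proof.
move=> wp wq pqo.
have [bp p01] := wp; have [bq q01] := wq; have l0 := ltW lam_gt0.
pose B m k := mixed_coef P h m k phi psi.
(* The binomial expansion of a vanishing coefficient of [omega] has non-negative terms, so each term
   vanishes. *)
have B0 m k : (N < m + k)%N -> B m k = 0.
  move=> Nmk; have := coef_omega0 Nmk; rewrite -pqo coef_add_mixed//.
  have F0 (i : 'I_(m + k).+1) : true ->
      0 <= 'C(m + k, i)%:R * mixed_coef P h i (m + k - i) phi psi.
    by move=> _; rewrite mulr_ge0// mixed_coef_ge0.
  move=> /eqP; rewrite psumr_eq0// => /allP/(_ (inord m)).
  rewrite mem_index_enum => /(_ isT) /=.
  rewrite inordK ?ltnS ?leq_addr// addKn mulf_eq0 pnatr_eq0.
  by rewrite eqn0Ngt bin_gt0 leq_addr => /eqP.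
have ZE : Z omega = \sum_(m < N.+1) fugw lam m * \sum_(k < N.+1) fugw lam k * B m k.
  rewrite -fugw_convolution// /Z /Zsum -pqo; apply: eq_bigr => n _.
  by rewrite coef_add_mixed.
have ME : \sum_(n < N.+1) fugw lam n *
      \int[P]_x (psi x * coef P h n (fun y => omega y * h x y)) =
    \sum_(m < N.+1) fugw lam m * \sum_(k < N.+1) fugw lam k * B m k.+1.
  rewrite -(fugw_convolution lam (B := fun m k => B m k.+1)); last first.
    by move=> m k mk; apply: B0; rewrite addnS ltnS ltnW.
  apply: eq_bigr => n _; congr (_ * _); rewrite -coef_mixed_shift//.
  by rewrite -pqo.
(* Written as a bound on the sum of [(K - k%:R) * fugw lam k * coef k D], the local inequality is
   linear in the coefficients, hence passes to the mixed ones. *)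
have Bm m : \sum_(k < N.+1) (K - k%:R) * fugw lam k * B m k <= e * coef P h m phi.
  apply: (mixed_coef_lincomb_le h_bmeas h01 (omega := omega)
    (c := fun k => (K - k%:R) * fugw lam k)) => //.
    move=> D wD Do.
    have := local_bound wD Do; rewrite -lerBlDl; apply: le_trans.
    rewrite /Z /M /Zsum /Msum mulr_sumr -sumrB; apply: ler_sum => k _.
    by rewrite le_eqVlt; apply/orP; left; apply/eqP; ring.
  by move=> x; rewrite -pqo lerDr; have /andP[] := p01 x.
have Bm' m : K * (\sum_(k < N.+1) fugw lam k * B m k) <=
    lam * (\sum_(k < N.+1) fugw lam k * B m k.+1) + e * coef P h m phi.
  have := Bm m; rewrite -lerBlDl; apply: le_trans.
  rewrite -(Msum_shift lam (a := B m)); last by apply: B0; rewrite addnS ltnS leq_addl.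
  rewrite /Msum mulr_sumr -sumrB; apply: ler_sum => k _.
  by rewrite le_eqVlt; apply/orP; left; apply/eqP; ring.
rewrite ZE ME /Z /Zsum !mulr_sumr -big_split /=; apply: ler_sum => m _.
rewrite mulrCA [lam * _]mulrCA [e * _]mulrCA -mulrDr ler_wpM2l//.
exact: fugw_ge0.
Qed.

Variable kappa : R.
Hypothesis omega1 : \int[P]_x omega x = 1.
Hypothesis cap_le : forall x, omega x * \int[P]_v (omega v * (1 - h v x)) <= kappa * omega x.

(** The split is taken with [psi] the part of [omega] in conflict with v, then averaged over v. A
    given point conflicts with v with probability at most [kappa], so the points resampled
    contribute at most [kappa * M omega]. The error involves the average of Z over the weights
    [omega * h v], which is M / lam because v itself acts as one more point. *)
Lemma occupancy_bound : K * Z omega <= (kappa + e / lam) * M omega.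
Proof.
have [bo o01] := w_omega; have l0 := ltW lam_gt0.
have b1h : bmeas (fun z : T * T => 1 - h z.1 z.2).
  by apply: bmeasB => //; exact: bmeas_cst.
have b1hv v : bmeas (fun x => 1 - h v x).
  by apply: (bmeas_comp (g := pair v) _ b1h); exact: pair1_measurable.
have w1h v : weight (fun x => 1 - h v x).
  split => // x; have /andP[h0 h1] := h01 v x.
  by rewrite subr_ge0 h1 lerBlDr lerDl.
pose cx n x := coef P h n (fun y => omega y * h x y).
have bcx n : bmeas (cx n) by exact: bmeas_coef_h.
pose J n v := \int[P]_x (omega x * (1 - h v x) * cx n x).
have bJF n : bmeas (fun z : T * T => omega z.2 * (1 - h z.1 z.2) * cx n z.2).
  apply: bmeasM; last exact: bmeas_comp (bcx n).
  by apply: bmeasM => //; exact: bmeas_comp bo.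
have bJ n : bmeas (J n).
  exact: (bmeas_Rintegral P (F := fun v x => omega x * (1 - h v x) * cx n x)).
have split_v v : K * Z omega <= lam * (\sum_(n < N.+1) fugw lam n * J n v) +
    e * (\sum_(n < N.+1) fugw lam n * cx n v).
  apply: (local_bound_split (phi := fun y => omega y * h v y)
    (psi := fun y => omega y * (1 - h v y))).
  - exact: weight_mul_h.
  - exact: weight_mul.
  - by apply/funext => x; ring.
have bs1 (f : nat -> T -> R) : (forall n, bmeas (f n)) ->
    bmeas (fun v => \sum_(n < N.+1) fugw lam n * f n v).
  by move=> bf; apply: bmeas_sum => n; apply: bmeasM => //; exact: bmeas_cst.
have Iom (f : nat -> T -> R) : (forall n, bmeas (f n)) ->
    \int[P]_v (omega v * \sum_(n < N.+1) fugw lam n * f n v) =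
    \sum_(n < N.+1) fugw lam n * \int[P]_v (omega v * f n v).
  move=> bf.
  transitivity (\int[P]_v \sum_(n < N.+1) fugw lam n * (omega v * f n v)).
    apply: eq_Rintegral => v _; rewrite mulr_sumr; apply: eq_bigr => n _.
    by rewrite mulrCA.
  have bof n : bmeas (fun v => omega v * f n v) by exact: bmeasM.
  rewrite (bRintegral_sum P (index_enum _)
    (F := fun (n : 'I_N.+1) v => fugw lam n * (omega v * f n v))); last first.
    by move=> n; apply: bmeasM => //; exact: bmeas_cst.
  by apply: eq_bigr => n _; rewrite bRintegralZl.
have b1 := bs1 _ bJ; have b2 := bs1 _ bcx.
have b3 : bmeas (fun v => omega v * \sum_(n < N.+1) fugw lam n * J n v) by exact: bmeasM.
have b4 : bmeas (fun v => omega v * \sum_(n < N.+1) fugw lam n * cx n v) by exact: bmeasM.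
have step : K * Z omega <=
    lam * (\sum_(n < N.+1) fugw lam n * \int[P]_v (omega v * J n v)) +
    e * (\sum_(n < N.+1) fugw lam n * coef P h n.+1 omega).
  rewrite -(Iom _ bJ).
  have -> : \sum_(n < N.+1) fugw lam n * coef P h n.+1 omega =
     \sum_(n < N.+1) fugw lam n * \int[P]_v (omega v * cx n v) by [].
  rewrite -(Iom _ bcx) -[leLHS]mul1r -omega1 -bRintegralZr//.
  rewrite -bRintegralZl// -bRintegralZl// -bRintegralD; last 2 first.
  - by apply: bmeasM => //; exact: bmeas_cst.
  - by apply: bmeasM => //; exact: bmeas_cst.
  apply: le_bRintegral.
  - by apply: bmeasM => //; exact: bmeas_cst.
  - by apply: bmeasD; apply: bmeasM => //; exact: bmeas_cst.
  - move=> v; rewrite [lam * _]mulrCA [e * _]mulrCA -mulrDr ler_wpM2l//.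
    by have /andP[] := o01 v.
have ME : lam * (\sum_(n < N.+1) fugw lam n * coef P h n.+1 omega) = M omega.
  by rewrite /M (Msum_shift lam (a := fun k => coef P h k omega))// coef_omega0.
have JE n : \int[P]_v (omega v * J n v) <= kappa * coef P h n.+1 omega.
  have -> : \int[P]_v (omega v * J n v) =
      \int[P]_x (omega x * (\int[P]_v (omega v * (1 - h v x))) * cx n x).
    transitivity (\int[P]_v \int[P]_x (omega v * (omega x * (1 - h v x) * cx n x))).
      apply: eq_Rintegral => v _; rewrite bRintegralZl//.
      by apply: bmeasM => //; exact: bmeasM.
    rewrite Rintegral_swap; last first.
      by apply: bmeasM; [exact: bmeas_comp bo|exact: bJF].
    apply: eq_Rintegral => x _.
    have bvx : bmeas (fun v => omega v * (1 - h v x)).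
      apply: bmeasM => //.
      by apply: (bmeas_comp (g := pair ^~ x) _ b1h); exact: pair2_measurable.
    rewrite mulrAC -bRintegralZl//; apply: eq_Rintegral => v _; ring.
  rewrite /= -bRintegralZl; last exact: bmeas_coef_step.
  apply: le_bRintegral.
  - apply: bmeasM => //; apply: bmeasM => //.
    apply: (bmeas_Rintegral P (F := fun x v => omega v * (1 - h v x))).
    apply: bmeasM; first exact: bmeas_comp bo.
    apply: (bmeas_comp (g := fun z : T * T => (z.2, z.1)) _ b1h).
    exact: measurable_fun_pair.
  - by apply: bmeasM; [exact: bmeas_cst|exact: bmeas_coef_step].
  - move=> x; rewrite mulrA ler_wpM2r//.
    by apply: coef_ge0 => //; exact: weight_mul_h.
apply: le_trans step _; rewrite mulrDl -ME lerD//.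
  rewrite [leRHS]mulrCA ler_wpM2l// mulr_sumr; apply: ler_sum => n _.
  by rewrite mulrCA ler_wpM2l// fugw_ge0.
by rewrite mulrA divfK// gt_eqF.
Qed.

End occupancy_bound.

(** * The local inequality from a bound on conflicting pairs *)

Section local_occupancy.
Context {R : realType} d (T : measurableType d) (P : probability T R).
Variable h : T -> T -> R.
Hypothesis h_bmeas : bmeas (fun z : T * T => h z.1 z.2).
Hypothesis h01 : forall x y, 0 <= h x y <= 1.
Hypothesis h_sym : forall x y, h x y = h y x.

(* If D has small mass the partition function is bounded; otherwise the fugacity
   is lowered until the expected number of points of an ideal gas on D is [K']. *)
Lemma local_occupancy (D : T -> R) N (lam K K' p e : R) :
  weight D -> coef P h N.+1 D = 0 -> 0 < lam -> 0 <= K -> 0 < K' ->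
  K * expR K' <= e -> K <= K' - K' ^+ 2 * p ->
  (K' < lam * \int[P]_x D x -> conflict P h D <= p * (\int[P]_x D x) ^+ 2) ->
  K * Zsum N (fun k => coef P h k D) lam <= Msum N (fun k => coef P h k D) lam + e.
Proof.
move=> wD aN l0 K0 K'0 Ke KK' cD.
set I1 := \int[P]_x D x in cD *; set a := fun k => coef P h k D.
have a0 k : 0 <= a k by exact: coef_ge0.
have e0 : 0 <= e by apply: le_trans Ke; rewrite mulr_ge0// expR_ge0.
have I0 : 0 <= I1 by apply: Rintegral_ge0 => x _; have [_ /(_ x)/andP[]] := wD.
have [lI|lI] := leP (lam * I1) K'.
  rewrite -[leLHS]add0r lerD ?Msum_ge0 ?(ltW l0)//; apply: le_trans Ke.
  rewrite ler_wpM2l//; apply: le_trans (_ : expR (lam * I1) <= _).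
    by apply: Zsum_le_expR; rewrite ?(ltW l0)// => k; exact: coef_le_expn.
  by rewrite ler_expR.
have Ip : 0 < I1.
  by rewrite lt_def I0 andbT; apply: contraTneq lI => ->; rewrite mulr0 -leNgt ltW.
pose l' := K' / I1.
have l'0 : 0 < l' by rewrite divr_gt0.
have l'l : l' <= lam by rewrite /l' ler_pdivrMr// ltW.
have Z1 l : 0 <= l -> 1 <= Zsum N a l by move=> ?; exact: Zsum_ge1.
have M' : K * Zsum N a l' <= Msum N a l'.
  apply: le_trans (_ : (l' * I1 - l' ^+ 2 * conflict P h D) * Zsum N a l' <= _).
    rewrite ler_wpM2r ?(le_trans ler01 (Z1 _ (ltW l'0)))//.
    apply: (le_trans KK'); rewrite /l' divfK ?gt_eqF// lerD2l lerN2.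
    rewrite expr_div_n -mulrA ler_wpM2l ?exprn_ge0 ?(ltW K'0)//.
    by rewrite ler_pdivrMl ?exprn_gt0// mulrC cD.
  apply: Msum_ge => //; [exact: ltW|exact: conflict_ge0|].
  by move=> k; exact: coef_succ_ge.
have := Msum_Zsum_cross N (ltW l'0) l'l a0 => cross.
have Zp : 0 < Zsum N a l' by apply: lt_le_trans (Z1 _ (ltW l'0)).
apply: le_trans (_ : Msum N a lam <= _); last by rewrite lerDl.
rewrite -(ler_pM2r Zp); apply: le_trans cross.
rewrite mulrAC ler_wpM2r//.
exact: le_trans ler01 (Z1 _ (ltW l0)).
Qed.

End local_occupancy.

(** * The correlation bootstrap *)

Lemma sumr_le_const_seq (R : realDomainType) (T : eqType) (xs : seq T) (f : T -> R) (c : R) :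
  {in xs, forall x, f x <= c} -> \sum_(x <- xs) f x <= (size xs)%:R * c.
Proof.
elim: xs => [|x xs IH] fc; first by rewrite big_nil mul0r.
rewrite big_cons /= -natr1 addrC mulrDl mul1r lerD//.
  by apply: IH => y ys; apply: fc; rewrite inE ys orbT.
by apply: fc; rewrite mem_head.
Qed.

Section correlation_bootstrap.
Context {R : realType} d (T : measurableType d) (P : probability T R).
Variables (g : T -> T -> R) (omega : T -> R).
Hypothesis g_meas : measurable_fun setT (fun z : T * T => g z.1 z.2).
Hypothesis g_sym : forall x y, g x y = g y x.
Hypothesis g_le1 : forall x y, 0 < omega x -> 0 < omega y -> g x y <= 1.
Implicit Types (phi psi : T -> R) (t : R).

Definition adj t x y : R := (t <= g x y)%R%:R.

Definition degree t phi x : R := \int[P]_y (phi y * adj t x y).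

Definition density t phi : R := \int[P]_x (phi x * degree t phi x).

Lemma bmeas_adj t : bmeas (fun z : T * T => adj t z.1 z.2).
Proof.
rewrite (_ : (fun _ => _) = \1_[set z : T * T | t <= g z.1 z.2]).
  apply: bmeas_indic.
  have := g_meas measurableT (measurable_itv `[t, +oo[).
  rewrite setTI; congr (measurable _); apply/seteqP.
  by split => z /=; rewrite in_itv /= andbT.
by apply/funext => z; rewrite indicE /adj; congr (nat_of_bool _)%:R; apply/idP/idP; rewrite inE.
Qed.

Lemma bmeas_adj1 t x : bmeas (adj t x).
Proof.
by apply: (bmeas_comp (g := pair x) _ (bmeas_adj t)); exact: pair1_measurable.
Qed.

Lemma adj01 t x y : 0 <= adj t x y <= 1.
Proof. by rewrite /adj; case: (t <= g x y); rewrite ?lexx ?ler01. Qed.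

Lemma adj_sym t x y : adj t x y = adj t y x.
Proof. by rewrite /adj g_sym. Qed.

Lemma bmeas_degree t phi : bmeas phi -> bmeas (degree t phi).
Proof.
move=> bp; apply: (bmeas_Rintegral P (F := fun x y => phi y * adj t x y)).
by apply: bmeasM; [exact: bmeas_comp bp|exact: bmeas_adj].
Qed.

Lemma degree_le t phi x : weight phi -> 0 <= degree t phi x <= \int[P]_y phi y.
Proof.
move=> [bp p01]; apply/andP; split.
  apply: Rintegral_ge0 => y _; have /andP[? _] := p01 y.
  by have /andP[? _] := adj01 t x y; exact: mulr_ge0.
apply: le_bRintegral => //; first by apply: bmeasM => //; exact: bmeas_adj1.
by move=> y; have /andP[? _] := p01 y; have /andP[? ?] := adj01 t x y; rewrite ler_piMr.
Qed.

Lemma bmeas_lt (f : T -> R) (c : R) : bmeas f -> bmeas (fun x => (c < f x)%R%:R : R).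
Proof.
move=> [mf _]; rewrite (_ : (fun _ => _) = \1_[set x | c < f x]).
  apply: bmeas_indic.
  have := mf measurableT _ (measurable_itv `]c, +oo[).
  rewrite setTI; congr (measurable _); apply/seteqP.
  by split => z /=; rewrite in_itv /= andbT.
by apply/funext => z; rewrite indicE; congr (nat_of_bool _)%:R; apply/idP/idP; rewrite inE.
Qed.

Variables (r beta : R) (phi : T -> R).
Hypothesis w_phi : weight phi.
Hypothesis phi_omega : forall x, phi x <= omega x.
Local Notation sigma := (\int[P]_x phi x).
Hypothesis sigma_gt0 : 0 < sigma.
Hypothesis r_ge0 : 0 <= r.

(** For an inner product [g] this is the squared norm of the sum of the points. *)
Definition gram (xs : seq T) : R := \sum_(x <- xs) \sum_(y <- xs) g x y.

(* No sub-weight of [phi] that is not too small is concentrated near a direction. *)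
Hypothesis mean_bound : forall psi xs, weight psi -> (forall x, psi x <= omega x) ->
  beta * sigma <= \int[P]_x psi x -> {in xs, forall x, 0 < omega x} ->
  \int[P]_y (psi y * \sum_(x <- xs) g x y) <=
    r * Num.sqrt (gram xs) * \int[P]_y psi y.
(** The inner product is unbounded on the whole space; it becomes bounded after multiplication by a
    weight carried by the sphere. *)
Hypothesis bmeas_g : forall psi x, weight psi -> (forall y, psi y <= omega y) ->
  0 < omega x -> bmeas (fun y => psi y * g x y).

(* Greedy choice: as long as few pairs are [t']-correlated, one can pick points
   pairwise not [t']-correlated whose common [t]-neighbourhood stays large. *)
Lemma greedy_neighbourhood (t t' p : R) (k j : nat) :
  0 <= t' -> 0 < p -> p * sigma ^+ 2 <= density t phi ->
  density t' phi < (p / (4 * k.+1%:R)) ^+ 2 * sigma ^+ 2 -> (j <= k)%N ->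
  exists (xs : seq T) (psi : T -> R),
    [/\ size xs = j, weight psi,
     forall y, 0 < psi y -> [/\ psi y <= phi y, p / 2 * sigma <= degree t phi y
        & {in xs, forall x, t <= g x y}],
     {in xs, forall x, 0 < omega x /\
        degree t' phi x <= p / (4 * k.+1%:R) * sigma}
     & gram xs <= j%:R + j%:R ^+ 2 * t' /\
       (p / 8) ^+ j * (p / 2) * sigma <= \int[P]_y psi y].
Proof.
(* By Markov's inequality the points of [t']-degree above [u * sigma] have mass at most [u * sigma].
   The value of [u] makes the removal of these and of the [t']-neighbourhoods of the points already
   chosen cost at most [p / 4 * sigma], half of the [t]-degree that is available. *)
move=> t'0 p0 dt dt'; have [bp p01] := w_phi; set u := p / (4 * k.+1%:R) in dt' *.
have u0 : 0 < u by rewrite divr_gt0.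
have uk : k.+1%:R * u = p / 4.
  have q0 : k.+1%:R != 0 :> R by rewrite pnatr_eq0.
  by rewrite /u; move: (k.+1%:R : R) q0 => q q0; field.
elim: j => [|j IH] jk.
  (* Points of low [t]-degree account for at most half of the density, so those of high degree have
     mass at least [p / 2 * sigma]. *)
  pose hi x : R := 1 - (degree t phi x < p / 2 * sigma)%R%:R.
  have bhi : bmeas hi.
    apply: bmeasB; first exact: bmeas_cst.
    rewrite (_ : (fun _ => _) = fun x => (- (p / 2 * sigma) < - degree t phi x)%R%:R).
      by apply: bmeas_lt; apply: bmeasN; exact: bmeas_degree.
    by apply/funext => x; rewrite ltrN2.
  have hi01 x : 0 <= hi x <= 1 by rewrite /hi; case: (_ < _) => /=; lra.
  exists [::], (fun x => phi x * hi x); split => //.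
  - by apply: weight_mul.
  - move=> y; have /andP[py0 _] := p01 y; rewrite /hi; case: (ltP (degree t phi y)) => /= h.
      by rewrite subrr mulr0 ltxx.
    by rewrite subr0 mulr1.
  split; first by rewrite /gram big_nil expr0n mul0r addr0.
  rewrite expr0 mul1r -(ler_pM2r sigma_gt0).
  have bph : bmeas (fun x => phi x * hi x) by exact: bmeasM.
  have : density t phi <= (\int[P]_y (phi y * hi y)) * sigma + p / 2 * sigma * sigma.
    rewrite -bRintegralZr// -[X in _ + X]bRintegralZl// -bRintegralD; last 2 first.
    - by apply: bmeasM => //; exact: bmeas_cst.
    - by apply: bmeasM => //; exact: bmeas_cst.
    apply: le_bRintegral.
    - by apply: bmeasM => //; exact: bmeas_degree.
    - by apply: bmeasD; apply: bmeasM => //; exact: bmeas_cst.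
    move=> x; have /andP[px0 _] := p01 x; have /andP[d0 d1] := degree_le t x w_phi.
    have hs : 0 <= p / 2 * sigma by rewrite mulr_ge0 ?ltW// divr_gt0.
    rewrite /hi; case: (ltP (degree t phi x)) => /= hh.
      by rewrite subrr mulr0 mul0r add0r mulrC ler_wpM2r// ltW.
    rewrite subr0 mulr1; apply: le_trans (_ : phi x * sigma <= _).
      by rewrite ler_wpM2l.
    by rewrite lerDl mulr_ge0.
  move: dt; rewrite expr2; nra.
have [xs [psi [sz wpsi psiP xsP [gr Ipsi]]]] := IH (ltnW jk).
have [bpsi psi01] := wpsi.
pose good x : R := (degree t' phi x <= u * sigma)%R%:R * \prod_(z <- xs) (1 - adj t' z x).
have badj1 z : bmeas (fun x => 1 - adj t' z x).
  by apply: bmeasB; [exact: bmeas_cst|exact: bmeas_adj1].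
have wgood : weight good.
  apply: weight_mul.
    split; last by move=> x; case: (degree t' phi x <= _); rewrite ?lexx ?ler01.
    rewrite (_ : (fun _ => _) = fun x => 1 - (u * sigma < degree t' phi x)%R%:R).
      apply: bmeasB; first exact: bmeas_cst.
      by apply: bmeas_lt; exact: bmeas_degree.
    by apply/funext => x; case: leP => _; rewrite ?subr0 ?subrr.
  elim: (xs) => [|z zs IHz].
    rewrite (_ : (fun _ => _) = fun=> 1); last by apply/funext => x; rewrite big_nil.
    by split; [exact: bmeas_cst|move=> _; rewrite ler01 lexx].
  rewrite (_ : (fun _ => _) = fun x => (1 - adj t' z x) * \prod_(i <- zs) (1 - adj t' i x)).
    apply: weight_mul => //; split => // x.
    by have /andP[? ?] := adj01 t' z x; lra.
  by apply/funext => x; rewrite big_cons.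
have [bgood good01] := wgood.
pose gam x := phi x * good x.
have wgam : weight gam by exact: weight_mul.
have [bgam gam01] := wgam.
have bad_mass : \int[P]_x (phi x * (u * sigma < degree t' phi x)%R%:R) <= u * sigma.
  have us0 : 0 < u * sigma by rewrite mulr_gt0.
  rewrite -(ler_pM2r us0) -bRintegralZr; last first.
    by apply: bmeasM => //; apply: bmeas_lt; exact: bmeas_degree.
  apply: le_trans (_ : density t' phi <= _); last first.
    by rewrite -expr2 exprMn; exact: ltW.
  apply: le_bRintegral.
  - apply: bmeasM; last exact: bmeas_cst.
    by apply: bmeasM => //; apply: bmeas_lt; exact: bmeas_degree.
  - by apply: bmeasM => //; exact: bmeas_degree.
  move=> x; have /andP[px0 _] := p01 x; have /andP[d0 _] := degree_le t' x w_phi.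
  rewrite -mulrA ler_wpM2l//; case: (ltP (u * sigma)) => [h|_]; first by rewrite mul1r ltW.
  by rewrite mul0r.
have bNadj z : bmeas (fun x => phi x * adj t' z x).
  by apply: bmeasM => //; exact: bmeas_adj1.
have gam_ge x : phi x - phi x * (u * sigma < degree t' phi x)%R%:R
    - \sum_(z <- xs) phi x * adj t' z x <= gam x.
  have /andP[px0 _] := p01 x; rewrite -mulr_sumr.
  rewrite (_ : _ - _ - _ = phi x * (1 - (u * sigma < degree t' phi x)%R%:R -
    \sum_(z <- xs) adj t' z x)); last by ring.
  rewrite ler_wpM2l//.
  have prod_ge (zs : seq T) : 1 - \sum_(z <- zs) adj t' z x <= \prod_(z <- zs) (1 - adj t' z x) <= 1.
    elim: zs => [|z zs /andP[IH1 IH2]]; first by rewrite !big_nil subr0 lexx.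
    rewrite !big_cons; have /andP[a0 a1] := adj01 t' z x.
    have s0 : 0 <= \prod_(z <- zs) (1 - adj t' z x).
      by apply: prodr_ge0 => i _; have /andP[_ ?] := adj01 t' i x; rewrite subr_ge0.
    apply/andP; split; nra.
  have /andP[h1 h2] := prod_ge xs.
  have s0 : 0 <= \sum_(z <- xs) adj t' z x.
    by apply: sumr_ge0 => i _; have /andP[] := adj01 t' i x.
  by rewrite /good; case: (leP (degree t' phi x)) => _ /=; lra.
have gam_deg y : 0 < psi y -> p / 4 * sigma <= \int[P]_x (gam x * adj t x y).
  move=> /psiP[_ dy xsy].
  have bay : bmeas (fun x => adj t x y).
    rewrite (_ : (fun _ => _) = adj t y); first exact: bmeas_adj1.
    by apply/funext => x; exact: adj_sym.
  have bphi_bad : bmeas (fun x => phi x * (u * sigma < degree t' phi x)%R%:R).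
    by apply: bmeasM => //; apply: bmeas_lt; exact: bmeas_degree.
  apply: le_trans (_ : \int[P]_x (phi x * adj t y x -
      phi x * (u * sigma < degree t' phi x)%R%:R - \sum_(z <- xs) phi x * adj t' z x) <= _).
    rewrite bRintegralB; last 2 first.
    - by apply: bmeasB => //; apply: bmeasM => //; exact: bmeas_adj1.
    - exact: bmeas_sum.
    rewrite bRintegralB//; last by apply: bmeasM => //; exact: bmeas_adj1.
    rewrite (bRintegral_sum P)//.
    have : \sum_(z <- xs) \int[P]_x (phi x * adj t' z x) <= j%:R * (u * sigma).
      rewrite -sz; apply: sumr_le_const_seq => z zxs.
      by have [_ ?] := xsP _ zxs.
    move: bad_mass dy; rewrite /degree.
    have : (j%:R + 1) * (u * sigma) <= p / 4 * sigma.
      rewrite -uk mulrA ler_wpM2r ?(ltW sigma_gt0)// ler_wpM2r ?(ltW u0)//.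
      by rewrite natr1 ler_nat ltnS ltnW.
    by lra.
  apply: le_bRintegral.
  - apply: bmeasB; last exact: bmeas_sum.
    by apply: bmeasB => //; apply: bmeasM => //; exact: bmeas_adj1.
  - exact: bmeasM.
  move=> x; have := gam_ge x; rewrite [adj t y x]adj_sym.
  have /andP[a0 a1] := adj01 t x y; have /andP[px0 _] := p01 x.
  have B0 : 0 <= phi x * (u * sigma < degree t' phi x)%R%:R by rewrite mulr_ge0.
  have S0 : 0 <= \sum_(z <- xs) phi x * adj t' z x.
    by apply: sumr_ge0 => z _; have /andP[? _] := adj01 t' z x; rewrite mulr_ge0.
  move: B0 S0; set B := phi x * _; set S := \sum_(z <- xs) _ => B0 S0 gx.
  nra.
have Ipsi0 : 0 < \int[P]_y psi y.
  apply: lt_le_trans Ipsi; rewrite !mulr_gt0// ?exprn_gt0// divr_gt0//.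
(* Double counting of the [t]-adjacent pairs formed by an admissible new point and a point of the
   current common neighbourhood. *)
have double : p / 4 * sigma * \int[P]_y psi y <=
    \int[P]_x (gam x * degree t psi x).
  have -> : \int[P]_x (gam x * degree t psi x) =
      \int[P]_y (psi y * \int[P]_x (gam x * adj t x y)).
    transitivity (\int[P]_x \int[P]_y (gam x * (psi y * adj t x y))).
      apply: eq_Rintegral => x _; rewrite bRintegralZl//.
      by apply: bmeasM => //; exact: bmeas_adj1.
    rewrite Rintegral_swap; last first.
      apply: bmeasM; first exact: bmeas_comp bgam.
      by apply: bmeasM; [exact: bmeas_comp bpsi|exact: bmeas_adj].
    apply: eq_Rintegral => y _; rewrite -bRintegralZl.
      by apply: eq_Rintegral => x _; ring.
    apply: bmeasM => //.
    by rewrite (_ : (fun _ => _) = adj t y); [exact: bmeas_adj1|apply/funext => x; exact: adj_sym].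
  rewrite -bRintegralZl//; apply: le_bRintegral.
  - by apply: bmeasM => //; exact: bmeas_cst.
  - apply: bmeasM => //.
    apply: (bmeas_Rintegral P (F := fun y x => gam x * adj t x y)).
    apply: bmeasM; first exact: bmeas_comp bgam.
    apply: (bmeas_comp (g := fun z : T * T => (z.2, z.1)) _ (bmeas_adj t)).
    exact: measurable_fun_pair.
  move=> y; have /andP[py0 _] := psi01 y; rewrite mulrC.
  have [->|py] := eqVneq (psi y) 0; first by rewrite !mul0r.
  by rewrite ler_wpM2l// gam_deg// lt_def py.
(* Averaging suggests [p / 4]; asking only for [p / 8] leaves a strict contradiction although
   integrals are compared weakly. *)
have [x [gx dx]] : exists x, 0 < gam x /\ p / 8 * \int[P]_y psi y <= degree t psi x.
  apply: contrapT => /forallNP nx.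
  suff : \int[P]_x (gam x * degree t psi x) <= p / 8 * (\int[P]_y psi y) * sigma.
    move=> le8; have : p / 4 * sigma * \int[P]_y psi y <=
      p / 8 * (\int[P]_y psi y) * sigma by exact: le_trans double le8.
    have : 0 < p * (sigma * \int[P]_y psi y) by rewrite !mulr_gt0.
    by move: (\int[P]_y psi y) (sigma) => a b; lra.
  rewrite -bRintegralZl//; apply: le_bRintegral.
  - by apply: bmeasM => //; exact: bmeas_degree.
  - by apply: bmeasM => //; exact: bmeas_cst.
  move=> x; have /andP[gx0 _] := gam01 x; have /andP[px0 _] := p01 x.
  have p8 : 0 <= p / 8 * \int[P]_y psi y by rewrite mulr_ge0 ?ltW// divr_gt0.
  have [->|gx] := eqVneq (gam x) 0; first by rewrite mul0r mulr_ge0.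
  have gxp : 0 < gam x by rewrite lt_def gx.
  have : degree t psi x <= p / 8 * \int[P]_y psi y.
    by apply: ltW; rewrite ltNge; apply/negP => hx; exact: (nx x).
  move=> hx; apply: le_trans (_ : gam x * (p / 8 * \int[P]_y psi y) <= _).
    by rewrite ler_wpM2l.
  rewrite mulrC ler_wpM2l// /gam.
  by have /andP[? ?] := good01 x; rewrite ler_piMr.
have px : 0 < phi x.
  have /andP[px0 _] := p01 x; rewrite lt_def px0 andbT.
  by apply: contraTneq gx => /eqP; rewrite /gam => /eqP ->; rewrite mul0r ltxx.
have goodx : good x != 0 by apply: contraTneq gx; rewrite /gam => ->; rewrite mulr0 ltxx.
have ox : 0 < omega x by exact: lt_le_trans px (phi_omega x).
have dx' : degree t' phi x <= u * sigma.
  by move: goodx; rewrite /good; case: (leP (degree t' phi x)) => //; rewrite mul0r eqxx.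
have gz z : z \in xs -> g z x <= t'.
  move=> zxs; move: goodx; rewrite /good mulf_eq0 negb_or => /andP[_].
  rewrite prodf_seq_neq0 => /allP/(_ _ zxs) /=; rewrite /adj.
  by case: (leP t' (g z x)) => [|/ltW//]; rewrite subrr eqxx.
exists (x :: xs), (fun y => psi y * adj t x y); split.
- by rewrite /= sz.
- by apply: weight_mul => //; split; [exact: bmeas_adj1|move=> y; exact: adj01].
- move=> y; have /andP[py0 _] := psi01 y; rewrite /adj.
  case: (leP t (g x y)) => h; last by rewrite mulr0 ltxx.
  rewrite mulr1 => /psiP[? ? xsy]; split => // z.
  by rewrite inE => /predU1P[->//|]; exact: xsy.
- by move=> z; rewrite inE => /predU1P[->//|]; exact: xsP.
split; last first.
  rewrite exprS -!(mulrA (p / 8)); apply: le_trans dx.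
  by rewrite ler_wpM2l// ltW// divr_gt0.
have -> : gram (x :: xs) = g x x + 2 * (\sum_(z <- xs) g z x) + gram xs.
  rewrite /gram big_cons big_cons; under [X in _ + X]eq_bigr do rewrite big_cons.
  rewrite big_split /= (eq_bigr (fun z => g z x)); last by move=> z _; exact: g_sym.
  by ring.
have : \sum_(z <- xs) g z x <= j%:R * t'.
  by rewrite -sz; apply: sumr_le_const_seq.
have := g_le1 ox ox; move: gr; rewrite -natr1; lra.
Qed.

(** Otherwise the greedy choice yields k points whose sum has squared norm at most k + k ^ 2 t' and
    which all correlate by at least t with a weight [psi] of large mass. The mean bound then gives k
    t <= r sqrt (k + k ^ 2 t'), against the assumed gap. *)
Lemma density_step (t t' p : R) (k : nat) :
  0 <= t -> 0 <= t' -> 0 < p -> (0 < k)%N -> r ^+ 2 * (k%:R^-1 + t') < t ^+ 2 ->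
  beta <= (p / 8) ^+ k * (p / 2) ->
  p * sigma ^+ 2 <= density t phi ->
  (p / (4 * k.+1%:R)) ^+ 2 * sigma ^+ 2 <= density t' phi.
Proof.
move=> t0 t'0 p0 k0 rt bet dt; rewrite leNgt; apply/negP => dt'.
have [xs [psi [sz wpsi psiP xsP [gr Ipsi]]]] :=
  greedy_neighbourhood t'0 p0 dt dt' (leqnn k).
have [bpsi psi01] := wpsi.
have psio x : psi x <= omega x.
  have /andP[px0 _] := psi01 x.
  have [px|px] := eqVneq (psi x) 0.
    by rewrite px; have [_ /(_ x)/andP[? _]] := w_phi; exact: le_trans (phi_omega x).
  by have [|? _ _] := psiP x; [rewrite lt_def px|exact: le_trans (phi_omega x)].
have Ipsi0 : 0 < \int[P]_y psi y.
  by apply: lt_le_trans Ipsi; rewrite !mulr_gt0// ?exprn_gt0// divr_gt0.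
have bI : beta * sigma <= \int[P]_y psi y.
  by apply: le_trans Ipsi; rewrite ler_wpM2r// ltW.
have := mean_bound wpsi psio bI (fun x xs_x => (xsP x xs_x).1).
have lo : k%:R * t * \int[P]_y psi y <= \int[P]_y (psi y * \sum_(x <- xs) g x y).
  rewrite -bRintegralZl//; apply: le_bRintegral.
  - by apply: bmeasM => //; exact: bmeas_cst.
  - have : {in xs, forall x, 0 < omega x} by move=> x /xsP[].
    elim: (xs) => [|z zs IHz] zo.
      rewrite (_ : (fun _ => _) = fun=> 0); first exact: bmeas_cst.
      by apply/funext => y; rewrite big_nil mulr0.
    rewrite (_ : (fun _ => _) = fun y => psi y * g z y + psi y * \sum_(x <- zs) g x y).
      apply: bmeasD; first by apply: bmeas_g => //; apply: zo; rewrite mem_head.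
      by apply: IHz => x xz; apply: zo; rewrite inE xz orbT.
    by apply/funext => y; rewrite big_cons mulrDr.
  move=> y; have /andP[py0 _] := psi01 y; rewrite mulrC.
  have [->|py] := eqVneq (psi y) 0; first by rewrite !mul0r.
  rewrite ler_wpM2l//; have [|_ _ xsy] := psiP y; first by rewrite lt_def py.
  rewrite -lerN2 -sumrN -mulrN -sz; apply: sumr_le_const_seq => x xxs.
  by rewrite lerN2; exact: xsy.
move=> /(le_trans lo); rewrite ler_pM2r// => kt.
have G0 : 0 <= k%:R + k%:R ^+ 2 * t' by rewrite addr_ge0// mulr_ge0// exprn_ge0.
have : (k%:R * t) ^+ 2 <= r ^+ 2 * (k%:R + k%:R ^+ 2 * t').
  apply: le_trans (_ : (r * Num.sqrt (k%:R + k%:R ^+ 2 * t')) ^+ 2 <= _).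
    rewrite lerXn2r ?nnegrE ?mulr_ge0 ?sqrtr_ge0//.
    by apply: le_trans kt _; rewrite ler_wpM2l// ler_wsqrtr.
  by rewrite exprMn sqr_sqrtr.
have kp : 0 < k%:R :> R by rewrite ltr0n.
rewrite leNgt => /negP; apply.
rewrite (_ : k%:R + _ = k%:R ^+ 2 * (k%:R^-1 + t')); last first.
  by rewrite mulrDr expr2 mulfK ?gt_eqF.
by rewrite exprMn mulrCA ltr_pM2l// exprn_gt0.
Qed.

(** Each round raises the correlation level by [eta] and replaces p by (p / (4 (k + 1))) ^ 2. After
    n rounds the level exceeds 1, where no pair remains and a positive density is absurd. The
    exponent in [beta] keeps the mean bound applicable in every round. *)
Lemma density_bootstrap (c eta p : R) (k n : nat) :
  0 <= c -> 0 <= eta -> 0 < p -> p <= 1 -> (0 < k)%N ->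
  r ^+ 2 <= c -> r ^+ 2 * (k%:R^-1 + eta) < c * (c - r ^+ 2) ->
  1 < c + n%:R * eta ->
  beta <= (p / (8 * k.+1%:R)) ^+ (k.+1 * 4 ^ n) ->
  density c phi < p * sigma ^+ 2.
Proof.
move=> c0 eta0 p0 p1 k0 rc gap cn bet; rewrite ltNge; apply/negP => dc.
have [bp p01] := w_phi.
have : exists t, [/\ c <= t, 1 < t + n%:R * eta & p * sigma ^+ 2 <= density t phi].
  by exists c.
elim: n p p0 p1 {dc cn} bet => [|n IH] p p0 p1 bet [t [ct tn dt]].
  suff d0 : density t phi = 0.
    by move: dt; rewrite d0 leNgt mulr_gt0// exprn_gt0.
  rewrite /density -[RHS](bRintegral_cst P 0); apply: eq_Rintegral => x _.
  rewrite /degree; have [->|px] := eqVneq (phi x) 0; first by rewrite mul0r.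
  apply/eqP; rewrite mulf_eq0; apply/orP; right; apply/eqP.
  rewrite -[RHS](bRintegral_cst P 0); apply: eq_Rintegral => y _.
  have [->|py] := eqVneq (phi y) 0; first by rewrite mul0r.
  have pos z : phi z != 0 -> 0 < omega z.
    move=> pz; apply: lt_le_trans (phi_omega z).
    by have /andP[? _] := p01 z; rewrite lt_def pz.
  rewrite /adj; case: leP => [tg|_]; last by rewrite mulr0.
  by move: tn; rewrite mul0r addr0 => /(le_lt_trans _)-/(_ _ (le_trans tg (g_le1 (pos _ px) (pos _ py)))); rewrite ltxx.
set K1 := k.+1%:R : R; have K1_ge1 : 1 <= K1 by rewrite ler1n.
pose w := p / (8 * K1).
have w0 : 0 < w by rewrite divr_gt0// mulr_gt0// (lt_le_trans ltr01).
have wK : w * (8 * K1) = p by rewrite /w divfK// gt_eqF// mulr_gt0// (lt_le_trans ltr01).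
have w1 : w <= 1 by nra.
have t0 : 0 <= t by exact: le_trans ct.
apply: (IH ((p / (4 * K1)) ^+ 2)) => //.
- by rewrite exprn_gt0// divr_gt0// mulr_gt0// (lt_le_trans ltr01).
- rewrite exprn_ile1// ?divr_ge0 ?(ltW p0)//.
    by rewrite mulr_ge0// (le_trans ler01).
  by rewrite ler_pdivrMr; nra.
(* The next value of p, divided by [8 * K1], is at least [w ^+ 4]: hence the factor 4 per round in
   the exponent. *)
- apply: le_trans bet _; rewrite -/K1 -/w expnS mulnCA exprM.
  rewrite lerXn2r ?nnegrE ?exprn_ge0 ?(ltW w0)//.
    by rewrite divr_ge0 ?exprn_ge0 ?divr_ge0 ?mulr_ge0 ?(ltW p0) ?(le_trans ler01 K1_ge1).
  have -> : (p / (4 * K1)) ^+ 2 / (8 * K1) = w ^+ 2 / (2 * K1).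
    have q0 : K1 != 0 by rewrite gt_eqF// (lt_le_trans ltr01).
    by rewrite /w; move: (K1) q0 => q q0; field.
  rewrite ler_pdivlMr; last by nra.
  have : w ^+ 2 * (2 * K1) <= 1 by nra.
  by have := exprn_ge0 2 (ltW w0); rewrite -[w ^+ 4]/(w ^+ (2 + 2)) exprD; nra.
exists (t + eta); split.
- by rewrite (le_trans ct)// lerDl.
- by move: tn; rewrite -natr1; lra.
apply: (density_step (t := t)) => //.
- by rewrite addr_ge0.
(* The requirement at level t is r ^ 2 (1 / k + eta) < t (t - r ^ 2), whose right side increases
   with t, so the gap at [c] serves all rounds. *)
- have : c * (c - r ^+ 2) <= t * (t - r ^+ 2) by rewrite ler_pM// ?subr_ge0// lerD2r.
  by move: gap; rewrite expr2; nra.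
apply: le_trans bet _; rewrite -/K1 -/w.
apply: le_trans (_ : w ^+ k.+1 <= _).
  by rewrite ler_wiXn2l ?(ltW w0)// leq_pmulr// expn_gt0.
rewrite exprSr ler_pM ?exprn_ge0 ?(ltW w0)//.
  rewrite lerXn2r ?nnegrE ?(ltW w0) ?divr_ge0 ?(ltW p0)//.
  by rewrite /w ler_pdivrMr; nra.
by rewrite /w ler_pdivrMr; nra.
Qed.

End correlation_bootstrap.

(** * Product Lebesgue measure and the sphere *)

Section measurable_tuple_cons.
Context d (T : measurableType d) (n : nat).

Lemma measurable_tuple_cons :
  measurable_fun setT (fun p : T * n.-tuple T => [tuple of p.1 :: p.2]).
Proof. exact: (measurable_cons measurable_fst measurable_snd). Qed.

Lemma measurable_tuple_cons1 (x : T) :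
  measurable_fun setT (fun t : n.-tuple T => [tuple of x :: t]).
Proof. exact: (measurable_cons (measurable_cst x) (@measurable_id _ _ setT)). Qed.

Definition tuple_uncons (t : n.+1.-tuple T) : T * n.-tuple T :=
  (thead t, [tuple of behead t]).

Lemma tuple_uncons_cons (p : T * n.-tuple T) : tuple_uncons [tuple of p.1 :: p.2] = p.
Proof.
case: p => x t; rewrite /tuple_uncons theadE /=; congr pair.
by apply: val_inj.
Qed.

Lemma measurable_tuple_uncons : measurable_fun setT tuple_uncons.
Proof.
apply: measurable_fun_pair; [exact: measurable_tnth|exact: measurable_behead].
Qed.

End measurable_tuple_cons.

Section product_pushforward.
Context {R : realType} d1 d2 d3 (T : measurableType d1) (U : measurableType d2)
  (V : measurableType d3).
Variables (mu : {sigma_finite_measure set T -> \bar R})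
  (m : {sigma_finite_measure set U -> \bar R}).
Variables (f : T * U -> V) (g : V -> T * U).
Hypotheses (mf : measurable_fun setT f) (mg : measurable_fun setT g)
  (fK : cancel f g).

Definition product_pushforward : set V -> \bar R := pushforward (mu \x m)%E f.

Let pp0 : product_pushforward set0 = 0%E.
Proof. by rewrite /product_pushforward /pushforward preimage_set0 measure0. Qed.

Let pp_ge0 A : (0 <= product_pushforward A)%E.
Proof. by rewrite /product_pushforward /pushforward; apply: measure_ge0. Qed.

Let pp_sigma_additive : semi_sigma_additive product_pushforward.
Proof.
move=> F mF tF mUF; rewrite /product_pushforward /pushforward preimage_bigcup.
apply: measure_semi_sigma_additive.
- by move=> i; rewrite -[X in measurable X]setTI; exact: mf.
- apply/trivIsetP => /= i j _ _ ij; rewrite -preimage_setI.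
  by move/trivIsetP : tF => /(_ _ _ _ _ ij) ->//; rewrite preimage_set0.
- by rewrite -preimage_bigcup -[X in measurable X]setTI; exact: mf.
Qed.

HB.instance Definition _ := isMeasure.Build _ _ _ product_pushforward
  pp0 pp_ge0 pp_sigma_additive.

Let pp_sigma_finite : sigma_finite setT product_pushforward.
Proof.
have /sigma_finiteP[F [FT ndF FP]] := sigma_finiteT mu.
have /sigma_finiteP[G [GT ndG GP]] := sigma_finiteT m.
exists (fun i => g @^-1` (F i `*` G i)).
  apply/esym/seteqP; split => // v _.
  have : (\bigcup_i F i) (g v).1 by rewrite -FT.
  have : (\bigcup_i G i) (g v).2 by rewrite -GT.
  move=> [j _ Gj] [i _ Fi]; exists (maxn i j) => //; split.
  - by move: Fi; apply/subsetPset/ndF/leq_maxl.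
  - by move: Gj; apply/subsetPset/ndG/leq_maxr.
move=> i; have [mFi Fioo] := FP i; have [mGi Gioo] := GP i; split.
  by rewrite -[X in measurable X]setTI; apply: mg => //; exact: measurableX.
rewrite /product_pushforward /pushforward -comp_preimage.
rewrite (_ : _ \o _ = idfun); last by apply/funext => p; exact: fK.
rewrite preimage_id product_measure1E// lte_mul_pinfty// ge0_fin_numE//.
Qed.

HB.instance Definition _ := Measure_isSigmaFinite.Build _ _ _ product_pushforward
  pp_sigma_finite.

Lemma product_pushforward_measure :
  {m' : {sigma_finite_measure set V -> \bar R} |
    pushforward (mu \x m)%E f = m' :> (set V -> \bar R)}.
Proof. by exists product_pushforward. Qed.

End product_pushforward.

Section mpower.
Context {R : realType} d (T : measurableType d).
Implicit Types (mu : {sigma_finite_measure set T -> \bar R}).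

(** [mpower] is a bare function given by recursion; rewriting along this equality makes the theory
    of bundled measures applicable to it. *)
Lemma mpower_measure mu n :
  {m : {sigma_finite_measure set (n.-tuple T) -> \bar R} |
    mpower mu n = m :> (set _ -> \bar R)}.
Proof.
elim: n => [|n [m IH]].
  by exists (@dirac _ _ ([tuple] : 0.-tuple T) R).
rewrite /= IH; apply: (product_pushforward_measure mu m
  (@measurable_tuple_cons _ T n) (@measurable_tuple_uncons _ T n)).
exact: tuple_uncons_cons.
Qed.

Lemma mpowerS (mu : set T -> \bar R) n (A : set (n.+1.-tuple T)) :
  mpower mu n.+1 A =
  (\int[mu]_x mpower mu n [set t : n.-tuple T | A [tuple of x :: t]])%E.
Proof.
rewrite /= /pushforward /product_measure1; congr integral; apply/funext => x /=.
by congr (mpower mu n _); apply/seteqP; split=> t; rewrite /xsection /= ?inE.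
Qed.

Lemma measurable_mpower_section d' (S : measurableType d') mu n
    (A : set (S * n.-tuple T)) : measurable A ->
  measurable_fun setT (fun x => mpower mu n [set t : n.-tuple T | A (x, t)]).
Proof.
have [m ->] := mpower_measure mu n => mA.
have := measurable_fun_xsection m mA; congr (measurable_fun _ _).
by apply/funext => x /=; congr (m _); apply/seteqP; split=> t; rewrite /xsection /= ?inE.
Qed.

Lemma mpower_ge0 mu n A : (0 <= mpower mu n A)%E.
Proof. by have [m ->] := mpower_measure mu n; exact: measure_ge0. Qed.

Lemma le_mpower mu n A B : measurable A -> measurable B -> A `<=` B ->
  (mpower mu n A <= mpower mu n B)%E.
Proof.
by have [m ->] := mpower_measure mu n => mA mB AB; apply: le_measure; rewrite ?inE.
Qed.

End mpower.

(** * Lebesgue measure under affine maps; boxes and cylinders *)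

Section affine.
Context {R : realType}.
Local Notation leb := (@lebesgue_measure R).

Lemma measurable_affine (r b : R) :
  measurable_fun setT (fun x : measurableTypeR R => (r * x + b : measurableTypeR R)).
Proof. by apply: measurable_funD => //; exact: measurable_funM. Qed.

(** Both sides are measures in A that agree on half-open intervals. *)
Lemma lebesgue_affine (r b : R) (A : set R) : 0 < r -> measurable A ->
  (leb A = r%:E * leb [set x | A (r * x + b)%R])%E.
Proof.
move=> r0 mA; pose rn := NngNum (ltW r0).
pose f (x : measurableTypeR R) : measurableTypeR R := r * x + b.
have mf : measurable_fun setT f := measurable_affine r b.
transitivity (pushforward (mscale rn leb) f A) => //.
apply: lebesgue_measure_unique => //= _ [[u v]] _ <-.
rewrite /pushforward /mscale /=.
have -> : f @^-1` `]u, v]%classic = `](u - b) / r, (v - b) / r]%classic.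
  apply/seteqP; split => x /=; rewrite !in_itv/= /f ltr_pdivrMr// ler_pdivlMr//;
  by rewrite ltrBlDr lerBrDr mulrC.
rewrite !lebesgue_measure_itv/= !lte_fin ltr_pM2r ?invr_gt0// ltrD2r.
case: ifP => uv; last by rewrite mule0.
rewrite -EFinB -EFinM; congr EFin.
by field; rewrite gt_eqF.
Qed.

Lemma ge0_integral_affine (r b : R) (f : R -> \bar R) : 0 < r ->
  measurable_fun setT f -> (forall x, (0 <= f x)%E) ->
  (\int[leb]_x f x = r%:E * \int[leb]_x f (r * x + b)%R)%E.
Proof.
move=> r0 mf f0; pose rn := NngNum (ltW r0).
pose g (x : measurableTypeR R) : measurableTypeR R := r * x + b.
have mg : measurable_fun setT g := measurable_affine r b.
transitivity (\int[pushforward (mscale rn leb) g]_x f x)%E.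
  apply: eq_measure_integral => // A mA _.
  exact: (lebesgue_affine b r0 mA).
rewrite (ge0_integral_pushforward mg)// preimage_setT ge0_integral_mscale//.
- have : measurable_fun setT (f \o g) by apply: measurableT_comp mg.
  by apply.
- by move=> x _; exact: f0.
Qed.

Local Notation lebn := (mpower (@lebesgue_measure R)).

Definition affine_tuple n (r : R) (b t : n.-tuple R) : n.-tuple R :=
  [tuple r * tnth t i + tnth b i | i < n].

Lemma affine_tuple_cons n r (b : n.+1.-tuple R) x (t : n.-tuple R) :
  affine_tuple r b [tuple of x :: t] =
  [tuple of (r * x + thead b) :: affine_tuple r [tuple of behead b] t].
Proof.
apply: eq_from_tnth => i; rewrite tnth_mktuple.
have [j ->|->] := unliftP ord0 i.
  by rewrite !tnthS tnth_mktuple (tuple_eta b) tnthS /= !(tnth_nth 0).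
by rewrite !tnth0.
Qed.

Lemma measurable_affine_tuple n (r : R) (b : n.-tuple R) :
  measurable_fun setT (affine_tuple r b).
Proof.
apply/measurable_fun_tnthP => i.
rewrite (_ : _ \o _ = fun t => r * tnth t i + tnth b i).
  apply: measurable_funD => //; apply: measurable_funM => //.
  exact: measurable_tnth.
by apply/funext => t /=; rewrite tnth_mktuple.
Qed.

Lemma mpower_affine n (r : R) (b : n.-tuple R) (A : set (n.-tuple R)) :
  0 < r -> measurable A ->
  (lebn n A = (r ^+ n)%:E * lebn n [set t : n.-tuple R | A (affine_tuple r b t)])%E.
Proof.
move=> r0; elim: n b A => [|n IH] b A mA.
  rewrite expr0 mul1e; congr (mpower _ _ _); apply/seteqP.
  by split => t; rewrite /= (tuple0 t) [affine_tuple _ _ _]tuple0.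
rewrite !mpowerS.
pose F x := lebn n [set t : n.-tuple R | A [tuple of x :: t]].
have mcA : measurable ((fun p : R * n.-tuple R => [tuple of p.1 :: p.2]) @^-1` A).
  by rewrite -[X in measurable X]setTI; exact: measurable_tuple_cons.
have mF : measurable_fun setT F.
  exact: (measurable_mpower_section lebesgue_measure mcA).
have F0 x : (0 <= F x)%E by exact: mpower_ge0.
rewrite (ge0_integral_affine (thead b) r0 mF F0) exprS EFinM -muleA; congr (_ * _)%E.
have mA1 x : measurable [set t : n.-tuple R | A [tuple of x :: t]].
  have := measurable_tuple_cons1 (n := n) x measurableT mA.
  by rewrite setTI.
have -> : (fun x => F (r * x + thead b)) = fun x => ((r ^+ n)%:E *
    lebn n [set t : n.-tuple R | A (affine_tuple r b [tuple of x :: t])])%E.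
  apply/funext => x; rewrite /F (IH [tuple of behead b] _ (mA1 _)).
  congr (_ * _)%E; congr (mpower _ _ _); apply/seteqP.
  by split => t; rewrite /= affine_tuple_cons.
rewrite ge0_integralZl_EFin//.
- by move=> x _; exact: mpower_ge0.
- apply: (measurable_mpower_section lebesgue_measure
    (A := [set p : R * n.-tuple R | A (affine_tuple r b [tuple of p.1 :: p.2])])).
  rewrite -[X in measurable X]setTI.
  have := measurableT_comp (measurable_affine_tuple r b) (@measurable_tuple_cons _ R n).
  by apply.
- by rewrite exprn_ge0// ltW.
Qed.

Lemma mpower_rect n (a b : R) (C : set (n.-tuple R)) : a <= b -> measurable C ->
  (lebn n.+1 [set t : n.+1.-tuple R | (a <= thead t <= b)%R /\ C [tuple of behead t]] =
   (b - a)%:E * lebn n C)%E.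
Proof.
move=> ab mC.
have lab : lebesgue_measure `[a, b]%classic = (b - a)%:E.
  rewrite lebesgue_measure_itv/= lte_fin; case: ltP => // ba.
  by rewrite (le_anti (introT andP (conj ab ba))) subrr.
rewrite mpowerS (_ : (fun x => _) = fun x => (lebn n C * (\1_`[a, b] x)%:E)%E).
  rewrite ge0_integralZl//.
  - by rewrite integral_indic// setIT muleC; congr (_ * _)%E.
  - by apply/measurable_EFinP; exact: measurable_indic.
  - exact: mpower_ge0.
have bh x (t : n.-tuple R) : [tuple of behead [tuple of x :: t]] = t by apply: val_inj.
apply/funext => x; rewrite indicE; case: (boolP (x \in `[a, b]%classic)).
  rewrite inE /= in_itv /= => xab; rewrite mule1; congr (mpower _ _ _).
  by apply/seteqP; split => t /=; rewrite theadE bh; [case|].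
rewrite notin_setE /= in_itv /= => xab; rewrite mule0.
rewrite (_ : [set t | _] = set0); first by have [m ->] := mpower_measure (@lebesgue_measure R) n.
by apply/seteqP; split => t //= []; rewrite theadE.
Qed.

Lemma measurable_box n (a b : R) :
  measurable [set t : n.-tuple R | forall i, a <= tnth t i <= b].
Proof.
rewrite (_ : [set t | _] = \bigcap_(i in setT) ((fun t => tnth t i) @^-1` `[a, b])).
  apply: fin_bigcap_measurable => [|i _]; first exact: finite_finset.
  by rewrite -[X in measurable X]setTI; exact: measurable_tnth.
apply/seteqP; split => t /= h i; first by move=> _; rewrite /= in_itv /= h.
by have := h i I; rewrite /= in_itv.
Qed.

Lemma mpower_box n (a b : R) : a <= b ->
  lebn n [set t : n.-tuple R | forall i, a <= tnth t i <= b] = ((b - a) ^+ n)%:E.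
Proof.
move=> ab; elim: n => [|n IH].
  by rewrite /= diracE mem_set ?expr0//= => -[].
rewrite exprS EFinM -IH -mpower_rect//; last exact: measurable_box.
congr (mpower _ _ _); apply/seteqP; split => t /=.
  move=> h; split; first exact: h.
  by move=> i; have := h (lift ord0 i); rewrite (tuple_eta t) tnthS /= !(tnth_nth 0).
move=> [h0 h] i; have [j ->|->//] := unliftP ord0 i.
by have := h j; rewrite (tuple_eta t) tnthS /= !(tnth_nth 0).
Qed.

End affine.

Section dot_product.
Context {R : realType}.
Local Notation lebn := (mpower (@lebesgue_measure R)).
Implicit Types n : nat.

Lemma dotpC n (x y : n.-tuple R) : dotp x y = dotp y x.
Proof. by apply: eq_bigr => i _; rewrite mulrC. Qed.

Lemma dotp_cons n a b (x y : n.-tuple R) :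
  dotp [tuple of a :: x] [tuple of b :: y] = a * b + dotp x y.
Proof.
rewrite /dotp big_ord_recl !tnth0; congr (_ + _).
by apply: eq_bigr => i _; rewrite !tnthS.
Qed.

Lemma dotp_ge0 n (x : n.-tuple R) : 0 <= dotp x x.
Proof. by apply: sumr_ge0 => i _; rewrite -expr2 sqr_ge0. Qed.

Lemma dotp_affine n r (b x y : n.-tuple R) :
  dotp (affine_tuple r b x) y = r * dotp x y + dotp b y.
Proof.
rewrite /dotp mulr_sumr -big_split /=; apply: eq_bigr => i _.
by rewrite tnth_mktuple mulrDl mulrA.
Qed.

Lemma dotp_affine2 n r (b x : n.-tuple R) :
  dotp (affine_tuple r b x) (affine_tuple r b x) =
  r ^+ 2 * dotp x x + 2 * r * dotp b x + dotp b b.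
Proof.
by rewrite dotp_affine !(dotpC _ (affine_tuple _ _ _)) !dotp_affine [dotp x b]dotpC; ring.
Qed.

Lemma dotp_cauchy n (x y : n.-tuple R) : dotp x y ^+ 2 <= dotp x x * dotp y y.
Proof.
have nn (a b : R) : 0 <= a ^+ 2 * dotp x x - 2 * a * b * dotp x y + b ^+ 2 * dotp y y.
  rewrite (_ : _ + _ = \sum_(i < n) (a * tnth x i - b * tnth y i) ^+ 2).
    by apply: sumr_ge0 => i _; rewrite sqr_ge0.
  rewrite /dotp !mulr_sumr -sumrB -big_split; apply: eq_bigr => i _ /=; ring.
have [y0|y0] := eqVneq (dotp y y) 0.
  have [->|D0] := eqVneq (dotp x y) 0; first by rewrite expr0n y0 mulr0.
  (* This value makes the quadratic form equal to -1 when [dotp y y] vanishes and [dotp x y] does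
     not. *)
  have := nn 1 ((dotp x x + 1) / (2 * dotp x y)).
  rewrite y0 mulr0 addr0 expr1n mul1r mulr1 (_ : 2 * _ * _ = dotp x x + 1).
    by rewrite opprD addrA subrr add0r oppr_ge0 ler10.
  by field.
have yp : 0 < dotp y y by rewrite lt_def y0 dotp_ge0.
have := nn (dotp y y) (dotp x y).
rewrite (_ : _ + _ = dotp y y * (dotp x x * dotp y y - dotp x y ^+ 2)); last by ring.
by rewrite pmulr_rge0// subr_ge0.
Qed.

Lemma sqr_enorm n (x : n.-tuple R) : enorm x ^+ 2 = dotp x x.
Proof. by rewrite sqr_sqrtr// dotp_ge0. Qed.

Lemma enorm_ge0 n (x : n.-tuple R) : 0 <= enorm x.
Proof. exact: sqrtr_ge0. Qed.

Lemma sphereE n (x : n.-tuple R) : sphere x <-> dotp x x = 1.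
Proof.
rewrite /sphere /enorm /=; split => [h|->]; last by rewrite sqrtr1.
by rewrite -sqr_enorm /enorm h expr1n.
Qed.

Lemma dotp_radial n (x y : n.-tuple R) :
  dotp (radial_proj x) y = dotp x y / enorm x.
Proof.
rewrite /dotp mulr_suml; apply: eq_bigr => i _.
by rewrite tnth_mktuple mulrAC.
Qed.

Lemma sphere_radial n (x : n.-tuple R) : 0 < enorm x -> sphere (radial_proj x).
Proof.
move=> x0; apply/sphereE; rewrite dotp_radial dotpC dotp_radial -sqr_enorm.
by rewrite expr2 mulfK ?divff// gt_eqF.
Qed.

Lemma measurable_dotp n :
  measurable_fun setT (fun z : n.-tuple R * n.-tuple R => dotp z.1 z.2).
Proof.
apply: measurable_sum => i; apply: measurable_funM.
- exact: (measurableT_comp (measurable_tnth i) measurable_fst).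
- exact: (measurableT_comp (measurable_tnth i) measurable_snd).
Qed.

Lemma measurable_dotp1 n (x : n.-tuple R) : measurable_fun setT (dotp x).
Proof.
apply: measurable_sum => i; apply: measurable_funM => //.
exact: measurable_tnth.
Qed.

Lemma measurable_dotpxx n : measurable_fun setT (fun x : n.-tuple R => dotp x x).
Proof.
by apply: measurable_sum => i; apply: measurable_funM; exact: measurable_tnth.
Qed.

Lemma measurable_enorm n : measurable_fun setT (@enorm R n).
Proof.
rewrite (_ : @enorm R n = Num.sqrt \o (fun x : n.-tuple R => dotp x x))//.
apply: measurableT_comp; last exact: measurable_dotpxx.
by apply: continuous_measurable_fun; exact: sqrt_continuous.
Qed.

Lemma measurable_inv : measurable_fun setT (fun x : R => x^-1).
Proof.
rewrite -(setvU [set (0 : R)]).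
have m0 : measurable [set (0 : R)] by [].
apply/(measurable_funU _ (measurableC m0) m0); split.
  apply: open_continuous_measurable_fun.
    by apply: closed_openC; rewrite -set_itv1; exact: interval_closed.
  by move=> x; rewrite inE /= => /eqP x0; exact: inv_continuous.
exact: measurable_fun_set1.
Qed.

Lemma measurable_radial n : measurable_fun setT (@radial_proj R n).
Proof.
apply/measurable_fun_tnthP => i.
rewrite (_ : _ \o _ = fun x => tnth x i * (enorm x)^-1).
  apply: measurable_funM; first exact: measurable_tnth.
  have : measurable_fun setT (GRing.inv \o @enorm R n).
    by apply: measurableT_comp; [exact: measurable_inv|exact: measurable_enorm].
  by [].
by apply/funext => x /=; rewrite tnth_mktuple.
Qed.

Lemma measurable_le (d : measure_display) (T : measurableType d) (f g : T -> R) :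
  measurable_fun setT f -> measurable_fun setT g ->
  measurable [set x | f x <= g x].
Proof.
move=> mf mg.
have := measurable_fun_ler mf mg measurableT (Y := [set true]) I; rewrite setTI.
by congr measurable; apply/seteqP; split => x /=; case: (_ <= _).
Qed.

Lemma measurable_lt (d : measure_display) (T : measurableType d) (f g : T -> R) :
  measurable_fun setT f -> measurable_fun setT g ->
  measurable [set x | f x < g x].
Proof.
move=> mf mg.
have := measurable_fun_ltr mf mg measurableT (Y := [set true]) I; rewrite setTI.
by congr measurable; apply/seteqP; split => x /=; case: (_ < _).
Qed.

End dot_product.

(** * Volumes of balls *)

Section volumes.
Context {R : realType}.
Local Notation lebn := (mpower (@lebesgue_measure R)).
Implicit Types n : nat.

Definition eball n (r : R) : set (n.-tuple R) := [set x | dotp x x <= r ^+ 2].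

Lemma measurable_eball n r : measurable (@eball n r).
Proof. by apply: measurable_le; [exact: measurable_dotpxx|]. Qed.

Lemma measurable_punctured_ball n : measurable (@punctured_ball R n).
Proof.
rewrite (_ : @punctured_ball R n = [set x | 0 < enorm x] `&` [set x | enorm x <= 1]).
  by apply: measurableI; [apply: measurable_lt|apply: measurable_le] => //;
    exact: measurable_enorm.
by apply/seteqP; split => x; rewrite /punctured_ball /=;
  [move=> /andP[] | move=> [? ?]; apply/andP].
Qed.

Lemma eball_le2 n : (lebn n (@eball n 1) <= (2 ^+ n)%:E)%E.
Proof.
rewrite (_ : 2 = 1 - (-1) :> R); last by lra.
rewrite -mpower_box; last by lra.
apply: le_mpower; [exact: measurable_eball|exact: measurable_box|].
move=> x /= x1 i; rewrite -ler_norml.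
rewrite -(ler_pXn2r (n := 2))// ?nnegrE// -normrX ger0_norm ?sqr_ge0//.
apply: le_trans x1; rewrite /dotp (bigD1 i)//= -expr2 lerDl.
by apply: sumr_ge0 => j _; rewrite -expr2 sqr_ge0.
Qed.

Lemma eball_gt0 n : (0 < lebn n (@eball n 1))%E.
Proof.
(* The cube of half-side [a] lies in the ball because each squared coordinate is at most a ^ 2 <= a
   and n a <= 1; the successor covers n = 0. *)
set a := n.+1%:R^-1 : R.
have a0 : 0 < a by rewrite invr_gt0.
apply: lt_le_trans (_ : (((a - (- a)) ^+ n)%:E <= _)%E).
  by rewrite lte_fin exprn_gt0//; lra.
rewrite -mpower_box; last by lra.
apply: le_mpower; [exact: measurable_box|exact: measurable_eball|].
move=> x /= xa; rewrite /eball /= expr1n.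
apply: le_trans (_ : \sum_(i < n) n.+1%:R^-1 <= _).
  apply: ler_sum => i _; have := xa i; rewrite -/a => /andP[h1 h2].
  have a1 : a <= 1 by rewrite invf_le1// ler1n.
  nra.
rewrite sumr_const card_ord -[_ *+ n]mulr_natl ler_pdivrMr// mul1r ler_nat.
exact: leqnSn.
Qed.

Lemma eball_scale n (r : R) : 0 < r ->
  (lebn n (@eball n r) = (r ^+ n)%:E * lebn n (@eball n 1))%E.
Proof.
move=> r0; pose z := [tuple (0 : R) | i < n].
rewrite (mpower_affine z r0 (@measurable_eball n r)); congr (_ * mpower _ _ _)%E.
have z0 (x : n.-tuple R) : dotp z x = 0.
  by rewrite /dotp big1// => i _; rewrite tnth_mktuple mul0r.
apply/seteqP; split => x; rewrite /eball /= dotp_affine2 !z0 !mulr0 !addr0.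
  by rewrite expr1n -[leRHS]mulr1 ler_pM2l// exprn_gt0.
by rewrite expr1n => x1; rewrite -[leRHS]mulr1 ler_pM2l// exprn_gt0.
Qed.

Lemma eball_translate n (r : R) (b : n.-tuple R) :
  lebn n [set x | eball r (affine_tuple 1 b x)] = lebn n (@eball n r).
Proof. by rewrite [RHS](mpower_affine b ltr01 (@measurable_eball n r)) expr1n mul1e. Qed.

(** The two sets differ by the origin, a degenerate box, which is null in positive dimension. *)
Lemma punctured_ballE n : (0 < n)%N ->
  lebn n (@punctured_ball R n) = lebn n (@eball n 1).
Proof.
move=> n0; have [m mE] := mpower_measure (@lebesgue_measure R) n.
pose box0 := [set t : n.-tuple R | forall i, 0 <= tnth t i <= (0 : R)].
have m0 : lebn n box0 = 0%E by rewrite mpower_box// subrr expr0n eqn0Ngt n0.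
have mb0 : measurable box0 by exact: measurable_box.
have sub : @eball n 1 `<=` @punctured_ball R n `|` box0.
  move=> x; rewrite /eball /punctured_ball /= expr1n => x1.
  have [x0|x0] := eqVneq (dotp x x) 0.
    right => i; have : dotp x x == 0 by rewrite x0.
    rewrite /dotp psumr_eq0; last by move=> j _; rewrite -expr2 sqr_ge0.
    by move=> /allP/(_ i); rewrite mem_index_enum mulf_eq0 orbb => /(_ isT)/eqP ->; rewrite lexx.
  left; rewrite sqrtr_gt0 lt_def x0 dotp_ge0/= /enorm.
  by rewrite -sqrtr1 ler_wsqrtr.
apply/eqP; rewrite eq_le; apply/andP; split.
  apply: le_mpower; [exact: measurable_punctured_ball|exact: measurable_eball|].
  move=> x /= /andP[_ x1]; rewrite /eball /= -sqr_enorm lerXn2r// nnegrE//.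
  exact: enorm_ge0.
apply: (@le_trans _ _ (lebn n (@punctured_ball R n `|` box0))).
  apply: le_mpower => //; [exact: measurable_eball|apply: measurableU => //].
  exact: measurable_punctured_ball.
move: m0; rewrite mE => m0; apply: le_trans (measureU2 _ _ _) _ => //.
  exact: measurable_punctured_ball.
by rewrite [X in (_ + X)%E](_ : _ = 0%E) ?adde0.
Qed.

End volumes.

Section normalized_pushforward.
Context {R : realType} d1 d2 (T : measurableType d1) (V : measurableType d2).
Variables (m : {measure set T -> \bar R}) (B : set T) (f : T -> V).
Hypotheses (mB : measurable B) (B_gt0 : (0 < m B)%E) (B_lty : (m B < +oo)%E)
  (mf : measurable_fun setT f).

Definition normalized_pushforward (A : set V) : \bar R :=
  (m (B `&` f @^-1` A) * (fine (m B))^-1%:E)%E.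

Let np0 : normalized_pushforward set0 = 0%E.
Proof. by rewrite /normalized_pushforward preimage_set0 setI0 measure0 mul0e. Qed.

Let fB_ge0 : 0 <= (fine (m B))^-1.
Proof. by rewrite invr_ge0 fine_ge0. Qed.

Let np_ge0 A : (0 <= normalized_pushforward A)%E.
Proof. by rewrite /normalized_pushforward mule_ge0// lee_fin. Qed.

Let npE : normalized_pushforward =
  pushforward (mscale (NngNum fB_ge0) (mrestr m mB)) f.
Proof.
apply/funext => A; rewrite /pushforward /mscale /= /mrestr.
by rewrite /normalized_pushforward muleC setIC.
Qed.

Let np_sigma_additive : semi_sigma_additive normalized_pushforward.
Proof. by rewrite npE; exact: measure_semi_sigma_additive. Qed.

HB.instance Definition _ := isMeasure.Build _ _ _ normalized_pushforward
  np0 np_ge0 np_sigma_additive.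

Let npT : normalized_pushforward setT = 1%E.
Proof.
rewrite /normalized_pushforward preimage_setT setIT -(@fineK _ (m B)).
  by rewrite -EFinM divff// gt_eqF// fine_gt0// B_gt0.
by rewrite ge0_fin_numE.
Qed.

HB.instance Definition _ := Measure_isProbability.Build _ _ _
  normalized_pushforward npT.

Lemma normalized_pushforward_probability :
  {s : probability V R | normalized_pushforward = s :> (set V -> \bar R)}.
Proof. by exists normalized_pushforward. Qed.

End normalized_pushforward.

(** * Surface measure of caps, through the solid cones over them *)

Section surface.
Context {R : realType}.
Local Notation lebn := (mpower (@lebesgue_measure R)).
Implicit Types n : nat.

Lemma punctured_ball_gt0 n : (0 < n)%N -> (0 < lebn n (@punctured_ball R n))%E.
Proof. by move=> n0; rewrite punctured_ballE// eball_gt0. Qed.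

Lemma punctured_ball_lty n : (0 < n)%N -> (lebn n (@punctured_ball R n) < +oo)%E.
Proof.
by move=> n0; rewrite punctured_ballE//; exact: le_lt_trans (eball_le2 n) (ltry _).
Qed.

Lemma surface_probability n : (0 < n)%N ->
  {s : probability (n.-tuple R) R | @surface_measure R n = s :> (set _ -> \bar R)}.
Proof.
move=> n0; have [m mE] := mpower_measure (@lebesgue_measure R) n.
have B0 := punctured_ball_gt0 n0; have B1 := punctured_ball_lty n0.
have [s sE] := normalized_pushforward_probability (m := m)
  (@measurable_punctured_ball R n) (eq_rect _ (fun g => (0 < g (@punctured_ball R n))%E) B0 _ mE)
  (eq_rect _ (fun g => (g (@punctured_ball R n) < +oo)%E) B1 _ mE) (@measurable_radial R n).
exists s; rewrite -sE; apply/funext => A.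
by rewrite /surface_measure /lebesgue_measure_tuple /normalized_pushforward mE.
Qed.

Definition cone n (c : R) (w : n.-tuple R) : set (n.-tuple R) :=
  [set x | 0 < enorm x <= 1 /\ c * enorm x <= dotp w x].

Lemma measurable_cone n (c : R) (w : n.-tuple R) : measurable (cone c w).
Proof.
rewrite (_ : cone c w = @punctured_ball R n `&` [set x | c * enorm x <= dotp w x])//.
apply: measurableI; first exact: measurable_punctured_ball.
apply: measurable_le; last exact: measurable_dotp1.
by apply: measurable_funM => //; exact: measurable_enorm.
Qed.

Lemma preimage_radial_ge n (c : R) (w : n.-tuple R) :
  @punctured_ball R n `&` @radial_proj R n @^-1` [set y | c <= dotp w y] = cone c w.
Proof.
apply/seteqP; split => x; rewrite /punctured_ball /cone /=.
  move=> [xb]; have /andP[x0 _] := xb; rewrite dotpC dotp_radial ler_pdivlMr//.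
  by rewrite dotpC.
move=> [xb cx]; split => //; have /andP[x0 _] := xb.
by rewrite dotpC dotp_radial ler_pdivlMr// dotpC.
Qed.

Lemma preimage_radial_cap n theta (w : n.-tuple R) :
  @punctured_ball R n `&` @radial_proj R n @^-1` (cap theta w) = cone (cos theta) w.
Proof.
rewrite -preimage_radial_ge; apply/seteqP; split => x /=.
  by move=> [xb [_ cx]].
move=> [xb cx]; split => //; split => //; apply: sphere_radial.
by move: xb; rewrite /punctured_ball /= => /andP[].
Qed.

Lemma cone_scale n (c r : R) (w : n.-tuple R) : 0 < r -> r <= 1 ->
  (lebn n (cone c w `&` [set x | (enorm x <= r)%R]) = (r ^+ n)%:E * lebn n (cone c w))%E.
Proof.
move=> r0 r1; pose z := [tuple (0 : R) | i < n].
have mr : measurable (cone c w `&` [set x | (enorm x <= r)%R]).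
  apply: measurableI; first exact: measurable_cone.
  by apply: measurable_le => //; exact: measurable_enorm.
rewrite (mpower_affine z r0 mr); congr (_ * mpower _ _ _)%E.
have z0 (x : n.-tuple R) : dotp z x = 0.
  by rewrite /dotp big1// => i _; rewrite tnth_mktuple mul0r.
have nrm (x : n.-tuple R) : enorm (affine_tuple r z x) = r * enorm x.
  rewrite /enorm dotp_affine2 !z0 mulr0 !addr0 sqrtrM ?sqr_ge0//.
  by rewrite sqrtr_sqr ger0_norm// ltW.
have dt (x : n.-tuple R) : dotp w (affine_tuple r z x) = r * dotp w x.
  by rewrite dotpC dotp_affine z0 addr0 dotpC.
apply/seteqP; split => x; rewrite /cone /= nrm dt mulrCA ler_pM2l//.
  move=> [[/andP[x0 x1] cx] xr]; split => //.
  by rewrite -(pmulr_rgt0 _ r0) x0/= -(ler_pM2l r0) mulr1.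
move=> [/andP[x0 x1] cx].
have xr : r * enorm x <= r by rewrite -[leRHS]mulr1 ler_pM2l.
by split => //; split => //; rewrite mulr_gt0//= (le_trans xr).
Qed.

(** The ball is centred at t w. For x in the cone with r = |x|, the squared distance to t w is at
    most r ^ 2 - 2 t ^ 2 r + t ^ 2 = (1 - r) ^ 2 + (1 - t ^ 2)(2 r - 1), and 1 - r < eps in the
    outer shell. *)
Lemma cone_shell_subset n (t eps rho : R) (w : n.-tuple R) : dotp w w = 1 -> 0 <= t ->
  t <= 1 -> 0 < eps -> 1 - t ^+ 2 + eps ^+ 2 <= rho ^+ 2 ->
  cone t w `\` [set x | enorm x <= 1 - eps] `<=`
  [set x | eball rho (affine_tuple 1 [tuple - t * tnth w i | i < n] x)].
Proof.
move=> w1 t0 t1 e0 rh x [[/andP[x0 x1] cx]] /negP; rewrite -ltNge => ex.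
rewrite /eball /= dotp_affine2 expr1n mul1r mulr1.
have dw (y : n.-tuple R) : dotp [tuple - t * tnth w i | i < n] y = - t * dotp w y.
  rewrite /dotp mulr_sumr; apply: eq_bigr => i _.
  by rewrite tnth_mktuple mulrA.
rewrite !dw [dotp w [tuple _ | _ < _]]dotpC dw w1 -sqr_enorm.
apply: le_trans rh; set r := enorm x in x0 x1 cx ex *.
have : t * (t * r) <= t * dotp w x by rewrite ler_wpM2l.
have : 0 <= (1 - r) * (1 - t ^+ 2).
  by rewrite mulr_ge0 ?subr_ge0// -[leRHS](expr1n _ 2) lerXn2r// nnegrE.
have : (1 - r) ^+ 2 <= eps ^+ 2.
  by rewrite lerXn2r ?nnegrE ?subr_ge0// ?(ltW e0)// lerBlDr addrC -lerBlDr ltW.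
lra.
Qed.

(** The outer shell of the cone fits in a ball of radius [rho], a share rho ^ n of the unit ball. By
    scaling, the inner part is at most a proportion 1 - eps of the cone, hence the factor [eps] on
    the left. *)
Lemma surface_ge_upper n (t eps rho : R) (w : n.-tuple R) : (0 < n)%N ->
  dotp w w = 1 -> 0 <= t -> t <= 1 -> 0 < eps -> eps < 1 -> 0 < rho ->
  1 - t ^+ 2 + eps ^+ 2 <= rho ^+ 2 ->
  fine (surface_measure [set y | t <= dotp w y]) * eps <= rho ^+ n.
Proof.
move=> n0 w1 t0 t1 e0 e1 r0 rh.
have [m mE] := mpower_measure (@lebesgue_measure R) n.
have := punctured_ball_gt0 n0; have := punctured_ball_lty n0; rewrite mE => B1 B0.
rewrite /surface_measure /lebesgue_measure_tuple preimage_radial_ge.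
have mA := measurable_cone t w; set A := cone t w in mA *.
pose E1 := [set x : n.-tuple R | enorm x <= 1 - eps].
have mE1 : measurable E1.
  by apply: measurable_le => //; exact: measurable_enorm.
have Afin : m A \is a fin_num.
  rewrite ge0_fin_numE//; apply: le_lt_trans B1; apply: le_measure; rewrite ?inE//.
    exact: measurable_punctured_ball.
  by move=> x [].
have Bfin : m (@punctured_ball R n) \is a fin_num by rewrite ge0_fin_numE.
have mD : measurable (A `\` E1) by exact: measurableD.
have e1' : 0 < 1 - eps by rewrite subr_gt0.
have A1 : m (A `&` E1) = (((1 - eps) ^+ n)%:E * m A)%E.
  by rewrite -mE cone_scale// lerBlDr lerDl ltW.
have A2 : (m (A `\` E1) <= (rho ^+ n)%:E * m (@punctured_ball R n))%E.
  rewrite -mE punctured_ballE// -eball_scale// -(eball_translate rho [tuple - t * tnth w i | i < n]).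
  apply: le_mpower => //; last exact: cone_shell_subset.
  have := measurable_affine_tuple 1 [tuple - t * tnth w i | i < n] measurableT
    (@measurable_eball R n rho).
  by rewrite setTI.
have AE : m A = (m (A `\` E1) +
    m (A `&` E1))%E.
  by rewrite -measureDI.
have : (m A <= (rho ^+ n)%:E * m (@punctured_ball R n) + ((1 - eps) ^+ n)%:E * m A)%E.
  by rewrite {1}AE A1 leeD2r.
rewrite mE -(fineK Afin) -(fineK Bfin) -!EFinM -EFinD lee_fin /=.
set a := fine (m A); set v := fine (m _).
have v0 : 0 < v by rewrite fine_gt0// B0.
have a0 : 0 <= a by exact: fine_ge0.
have en : (1 - eps) ^+ n <= 1 - eps.
  by rewrite -[leRHS]expr1 ler_wiXn2l// ?(ltW e1')// lerBlDr lerDl ltW.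
move=> h; rewrite mulrAC ler_pdivrMr//.
have : (1 - eps) ^+ n * a <= (1 - eps) * a by rewrite ler_wpM2r.
lra.
Qed.

(** The cap bound at t = 1 with rho = eps = e gives measure times e at most e ^ n <= e ^ 2 for all
    small e. *)
Lemma surface_point n (x : n.-tuple R) : (1 < n)%N -> dotp x x = 1 ->
  fine (surface_measure [set x]) = 0.
Proof.
move=> n1 x1; have n0 := ltnW n1.
have [s sE] := surface_probability n0; rewrite sE.
have mx : measurable [set y : n.-tuple R | 1 <= dotp x y].
  by apply: measurable_le => //; exact: measurable_dotp1.
have m1 : measurable [set x].
  rewrite (_ : [set x] = \bigcap_(i in setT) ((fun t => tnth t i) @^-1` [set tnth x i])).
    apply: fin_bigcap_measurable => [|i _]; first exact: finite_finset.
    by rewrite -[X in measurable X]setTI; exact: measurable_tnth.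
  apply/seteqP; split => y /=; first by move=> -> i.
  by move=> h; apply: eq_from_tnth => i; exact: h.
have key e : 0 < e -> e < 1 -> fine (s [set x]) <= e.
  move=> e0 e1.
  have := @surface_ge_upper n 1 e e x n0 x1 ler01 (lexx 1) e0 e1 e0.
  rewrite expr1n subrr add0r lexx sE => /(_ isT) h.
  rewrite -(ler_pM2r e0) -expr2; apply: le_trans (_ : e ^+ n <= _); last first.
    by rewrite ler_wiXn2l// ltW.
  apply: le_trans h; rewrite ler_wpM2r ?(ltW e0)// fine_le ?fin_num_measure//.
  by apply: le_measure; rewrite ?inE// => y ->/=; rewrite x1.
have s0 : 0 <= fine (s [set x]) by exact: fine_ge0.
apply/eqP; rewrite eq_le s0 andbT; apply/ler_addgt0Pr => e e0; rewrite add0r.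
apply: le_trans (key (Num.min e 2^-1) _ _) _; rewrite ?lt_min ?gt_min ?ge_min ?lexx//.
  by rewrite e0/= invr_gt0.
by rewrite invf_lt1 ?ltr1n ?orbT.
Qed.

Lemma dotp_pole n x (t : n.-tuple R) : dotp (pole R n.+1) [tuple of x :: t] = x.
Proof.
rewrite /dotp big_ord_recl tnth_mktuple tnth0 mul1r big1 ?addr0// => i _.
by rewrite tnth_mktuple mul0r.
Qed.

(** The cone over the cap contains the cylinder of heights between cos theta - eta and cos theta
    whose radius is that of the cone at the lower height. The unit ball lies in a cylinder of height
    2 and radius 1, and the volume of the n-dimensional unit ball cancels. *)
Lemma cap_measure_lower n theta (eta : R) : 0 < cos theta -> 0 < sin theta ->
  0 < eta -> eta < cos theta ->
  eta / 2 * ((cos theta - eta) * sin theta / cos theta) ^+ n <= cap_measure n.+1 theta.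
Proof.
move=> c0 s0 e0 ec; have cs : cos theta ^+ 2 + sin theta ^+ 2 = 1 by exact: cos2Dsin2.
rewrite /cap_measure /surface_measure /lebesgue_measure_tuple preimage_radial_cap.
move: c0 s0 ec cs; set c := cos theta; set sn := sin theta => c0 s0 ec cs.
set rho := (c - eta) * sn / c.
have rc : rho * c = (c - eta) * sn by rewrite /rho divfK// gt_eqF.
have rho0 : 0 < rho by rewrite divr_gt0 ?mulr_gt0 ?subr_gt0.
have [m mE] := mpower_measure (@lebesgue_measure R) n.+1.
have mcons (C : set (n.-tuple R)) (u v : R) : measurable C ->
    measurable [set t : n.+1.-tuple R | u <= thead t <= v /\ C [tuple of behead t]].
  move=> mC; rewrite (_ : [set t | _] = (@thead n R @^-1` `[u, v]) `&`
      ((fun t : n.+1.-tuple R => [tuple of behead t] : n.-tuple R) @^-1` C)).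
    apply: measurableI.
      by rewrite -[X in measurable X]setTI; exact: measurable_tnth.
    by rewrite -[X in measurable X]setTI; exact: measurable_behead.
  by apply/seteqP; split => t /=; rewrite in_itv.
pose V := fine (lebn n (@eball R n 1)).
have Vfin : lebn n (@eball R n 1) \is a fin_num.
  rewrite ge0_fin_numE; last exact: mpower_ge0.
  exact: le_lt_trans (eball_le2 n) (ltry _).
have VE : lebn n (@eball R n 1) = V%:E by rewrite fineK.
have V0 : 0 < V.
  by rewrite fine_gt0// eball_gt0/= -ge0_fin_numE//; exact: mpower_ge0.
have loQ : ((eta * (rho ^+ n * V))%:E <= lebn n.+1 (cone c (pole R n.+1)))%E.
  have -> : ((eta * (rho ^+ n * V))%:E = (c - (c - eta))%:E * lebn n (@eball R n rho))%E.
    rewrite (eball_scale n rho0) VE -!EFinM; congr EFin.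
    by rewrite opprB addrCA subrr addr0.
  rewrite -mpower_rect//; [|by rewrite lerBlDr lerDl ltW|exact: measurable_eball].
  apply: le_mpower; [|exact: measurable_cone|].
    by apply: mcons; exact: measurable_eball.
  move=> t /= []; rewrite [t]tuple_eta theadE.
  set x := thead t; set t' := [tuple of behead t].
  have -> : [tuple of behead [tuple of x :: t']] = t' by apply: val_inj.
  move=> /andP[x1 x2]; rewrite /eball /= => tr.
  have xp : 0 < x by apply: lt_le_trans x1; rewrite subr_gt0.
  rewrite /cone /= dotp_pole.
  have dE : dotp [tuple of x :: t'] [tuple of x :: t'] = x ^+ 2 + dotp t' t'.
    by rewrite dotp_cons expr2.
  have tt0 := dotp_ge0 t'.
  have dpos : 0 < dotp [tuple of x :: t'] [tuple of x :: t'].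
    by rewrite dE ltr_pwDl// exprn_gt0.
  have tb : c ^+ 2 * dotp t' t' <= sn ^+ 2 * x ^+ 2.
    apply: le_trans (_ : (rho * c) ^+ 2 <= _).
      by rewrite exprMn mulrC ler_wpM2r// sqr_ge0.
    rewrite rc exprMn mulrC ler_wpM2l ?sqr_ge0// lerXn2r// nnegrE ?(ltW xp)//.
    by rewrite subr_ge0 ltW.
  have rs : rho <= sn.
    rewrite /rho ler_pdivrMr// [leRHS]mulrC ler_wpM2r ?(ltW s0)//.
    by rewrite lerBlDr lerDl ltW.
  split.
    rewrite sqrtr_gt0 dpos/= -sqrtr1 ler_wsqrtr// dE -cs lerD//.
      by rewrite lerXn2r// nnegrE ltW.
    by apply: le_trans tr _; rewrite lerXn2r// nnegrE ltW.
  rewrite -[leRHS]ger0_norm ?(ltW xp)// -sqrtr_sqr -[c]ger0_norm ?(ltW c0)//.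
  rewrite -sqrtr_sqr -sqrtrM ?sqr_ge0// ler_wsqrtr// dE mulrDr.
  have : c ^+ 2 * x ^+ 2 + sn ^+ 2 * x ^+ 2 = x ^+ 2 by rewrite -mulrDl cs mul1r.
  by move: tb; lra.
have upB : (lebn n.+1 (@punctured_ball R n.+1) <= (2 * V)%:E)%E.
  have -> : ((2 * V)%:E = (1 - (-1))%:E * lebn n (@eball R n 1))%E.
    by rewrite VE -EFinM opprK.
  have N11 : (-1 : R) <= 1 by lra.
  rewrite -(mpower_rect N11 (@measurable_eball R n 1)).
  apply: le_mpower; first exact: measurable_punctured_ball.
    by apply: mcons; exact: measurable_eball.
  move=> t; rewrite [t]tuple_eta /punctured_ball /=.
  set x := thead t; set t' := [tuple of behead t]; rewrite theadE.
  have -> : [tuple of behead [tuple of x :: t']] = t' by apply: val_inj.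
  move=> /andP[_ t1]; have : enorm [tuple of x :: t'] ^+ 2 <= 1.
    by rewrite -[leRHS](expr1n _ 2) lerXn2r// nnegrE// enorm_ge0.
  rewrite sqr_enorm dotp_cons -expr2 => h; have tt0 := dotp_ge0 t'; have x0 := sqr_ge0 x.
  split; last by rewrite /eball /= expr1n; lra.
  rewrite -ler_norml -(ler_pXn2r (n := 2)) ?nnegrE// -normrX ger0_norm// expr1n; lra.
have B0 := punctured_ball_gt0 (ltn0Sn n); have B1 := punctured_ball_lty (ltn0Sn n).
have Bfin : lebn n.+1 (@punctured_ball R n.+1) \is a fin_num.
  by rewrite ge0_fin_numE//; exact: mpower_ge0.
have Cfin : lebn n.+1 (cone c (pole R n.+1)) \is a fin_num.
  rewrite ge0_fin_numE; last exact: mpower_ge0.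
  apply: le_lt_trans B1; apply: le_mpower; first exact: measurable_cone.
    exact: measurable_punctured_ball.
  by move=> t [].
move: loQ upB; rewrite -(fineK Cfin) -(fineK Bfin) -EFinM !lee_fin /=.
have b0 : 0 < fine (lebn n.+1 (@punctured_ball R n.+1)) by rewrite fine_gt0// B0.
move: b0; set b := fine _; set a := fine _ => b0 la ub.
rewrite ler_pdivlMr//; apply: le_trans la.
have : eta / 2 * rho ^+ n * b <= eta / 2 * rho ^+ n * (2 * V).
  rewrite ler_wpM2l// mulr_ge0 ?exprn_ge0 ?(ltW rho0)//.
  by rewrite divr_ge0 ?(ltW e0).
by move=> /le_trans; apply; rewrite le_eqVlt; apply/orP; left; apply/eqP; field.
Qed.

End surface.

(** * Rotation invariance of the cap measure *)

Section rotation.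
Context {R : realType}.
Local Notation leb := (@lebesgue_measure R).
Local Notation lebn := (mpower (@lebesgue_measure R)).
Implicit Types n : nat.

Lemma tuple_consP n (t : n.+1.-tuple R) :
  exists (x : R) (u : n.-tuple R), t = [tuple of x :: u].
Proof. by exists (thead t), [tuple of behead t]; exact: tuple_eta. Qed.

Definition preserves_volume n (g : n.-tuple R -> n.-tuple R) : Prop :=
  measurable_fun setT g /\
  forall A, measurable A -> lebn n (g @^-1` A) = lebn n A.

Definition rigid n (g : n.-tuple R -> n.-tuple R) : Prop :=
  preserves_volume g /\ forall x y, dotp (g x) (g y) = dotp x y.

Lemma preserves_volume_comp n (g1 g2 : n.-tuple R -> n.-tuple R) :
  preserves_volume g1 -> preserves_volume g2 -> preserves_volume (g1 \o g2).
Proof.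
move=> [m1 v1] [m2 v2]; split; first exact: measurableT_comp.
move=> A mA; rewrite comp_preimage v2 ?v1//.
by rewrite -[X in measurable X]setTI; exact: m1.
Qed.

Lemma rigid_comp n (g1 g2 : n.-tuple R -> n.-tuple R) :
  rigid g1 -> rigid g2 -> rigid (g1 \o g2).
Proof.
move=> [v1 d1] [v2 d2]; split; first exact: preserves_volume_comp.
by move=> x y /=; rewrite d1 d2.
Qed.

Lemma rigid_id n : rigid (@id (n.-tuple R)).
Proof. by split => //; split. Qed.

Definition lift_tail n (g : n.-tuple R -> n.-tuple R) (t : n.+1.-tuple R) :
  n.+1.-tuple R := [tuple of thead t :: g [tuple of behead t]].

Lemma lift_tailE n (g : n.-tuple R -> n.-tuple R) x (t : n.-tuple R) :
  lift_tail g [tuple of x :: t] = [tuple of x :: g t].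
Proof.
rewrite /lift_tail theadE.
have -> : [tuple of behead [tuple of x :: t]] = t by apply: val_inj.
by [].
Qed.

Lemma rigid_lift_tail n (g : n.-tuple R -> n.-tuple R) :
  rigid g -> rigid (lift_tail g).
Proof.
move=> [[mg vg] dg]; split; last first.
  move=> x y; have [a [u ->]] := tuple_consP x; have [b [v ->]] := tuple_consP y.
  by rewrite !lift_tailE !dotp_cons dg.
split.
  apply: (measurable_cons (f := @thead _ _) (g := fun t => g [tuple of behead t])).
    exact: measurable_tnth.
  exact: (measurableT_comp mg (@measurable_behead _ R n)).
move=> A mA; rewrite !mpowerS; congr integral; apply/funext => x.
have mA1 : measurable [set t : n.-tuple R | A [tuple of x :: t]].
  by have := measurable_tuple_cons1 (n := n) x measurableT mA; rewrite setTI.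
rewrite -(vg _ mA1); congr (mpower _ _ _); apply/seteqP.
by split => t /=; rewrite lift_tailE.
Qed.

Definition map2 n (F : R * R -> R * R) (t : n.+2.-tuple R) : n.+2.-tuple R :=
  let u := [tuple of behead t] in
  let p := F (thead t, thead u) in
  [tuple of p.1 :: [tuple of p.2 :: [tuple of behead u]]].

Lemma map2E n F x y (t : n.-tuple R) :
  map2 F [tuple of x :: [tuple of y :: t]] =
  [tuple of (F (x, y)).1 :: [tuple of (F (x, y)).2 :: t]].
Proof.
by rewrite /map2; apply: val_inj => /=; rewrite !theadE.
Qed.

Lemma map2_comp n F G (t : n.+2.-tuple R) : map2 F (map2 G t) = map2 (F \o G) t.
Proof.
have [x [u ->]] := tuple_consP t; have [y [v ->]] := tuple_consP u.
by rewrite !map2E /=; case: (G _).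
Qed.

Lemma measurable_map2 n F : measurable_fun setT F -> measurable_fun setT (@map2 n F).
Proof.
move=> mF.
have mu : measurable_fun setT (fun t : n.+2.-tuple R => [tuple of behead t] : n.+1.-tuple R).
  exact: measurable_behead.
have mp : measurable_fun setT (fun t : n.+2.-tuple R =>
    F (thead t, thead [tuple of behead t])).
  apply: (measurableT_comp mF); apply: measurable_fun_pair.
    exact: measurable_tnth.
  exact: (measurableT_comp (@measurable_tnth _ R n.+1 ord0) mu).
apply: measurable_cons; first exact: (measurableT_comp measurable_fst mp).
apply: measurable_cons; first exact: (measurableT_comp measurable_snd mp).
exact: (measurableT_comp (@measurable_behead _ R n) mu).
Qed.

Lemma mpower2 n (A : set (n.+2.-tuple R)) :
  lebn n.+2 A = (\int[leb]_x \int[leb]_y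
    lebn n [set t : n.-tuple R | A [tuple of x :: [tuple of y :: t]]])%E.
Proof. by rewrite mpowerS; congr integral; apply/funext => x; rewrite mpowerS. Qed.

Lemma measurable_section2 n (A : set (n.+2.-tuple R)) : measurable A ->
  measurable_fun setT (fun p : R * R =>
    lebn n [set t : n.-tuple R | A [tuple of p.1 :: [tuple of p.2 :: t]]]).
Proof.
move=> mA; apply: (measurable_mpower_section lebesgue_measure
  (A := [set z : (R * R) * n.-tuple R | A [tuple of z.1.1 :: [tuple of z.1.2 :: z.2]]])).
have : measurable_fun setT (fun z : (R * R) * n.-tuple R =>
    [tuple of z.1.1 :: [tuple of z.1.2 :: z.2]] : n.+2.-tuple R).
  apply: measurable_cons; first exact: (measurableT_comp measurable_fst measurable_fst).
  apply: measurable_cons => //.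
  exact: (measurableT_comp measurable_snd measurable_fst).
by move=> /(_ measurableT _ mA); rewrite setTI.
Qed.

Lemma preserves_volume_shear2 n (a : R) :
  preserves_volume (@map2 n (fun p => (p.1, p.2 + a * p.1))).
Proof.
have mF : measurable_fun setT (fun p : R * R => (p.1, p.2 + a * p.1)).
  apply: measurable_fun_pair => //; apply: measurable_funD => //.
  exact: measurable_funM.
split; first exact: measurable_map2.
move=> A mA; rewrite !mpower2; congr integral; apply/funext => x.
have mS := measurable_section2 mA.
pose f y := lebn n [set t : n.-tuple R | A [tuple of x :: [tuple of y :: t]]].
have mf : measurable_fun setT f.
  exact: (measurableT_comp mS (pair1_measurable x)).
rewrite [RHS](ge0_integral_affine (a * x) ltr01 mf); last by move=> y; exact: mpower_ge0.
rewrite mul1e; congr integral; apply/funext => y; rewrite mul1r /f.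
by congr (mpower _ _ _); apply/seteqP; split => t /=; rewrite map2E.
Qed.

(** Here the translation acts on the coordinate integrated last, so Tonelli is used to bring it
    innermost and then to restore the order. *)
Lemma preserves_volume_shear1 n (a : R) :
  preserves_volume (@map2 n (fun p => (p.1 + a * p.2, p.2))).
Proof.
have mF : measurable_fun setT (fun p : R * R => (p.1 + a * p.2, p.2)).
  apply: measurable_fun_pair => //; apply: measurable_funD => //.
  exact: measurable_funM.
split; first exact: measurable_map2.
move=> A mA.
have mA' : measurable (@map2 n (fun p => (p.1 + a * p.2, p.2)) @^-1` A).
  by rewrite -[X in measurable X]setTI; apply: measurable_map2.
pose f (p : R * R) :=
  lebn n [set t : n.-tuple R | A [tuple of p.1 :: [tuple of p.2 :: t]]].
have mf : measurable_fun setT f := measurable_section2 mA.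
have f0 p : (0 <= f p)%E by exact: mpower_ge0.
have f'E : (fun p : R * R => lebn n [set t : n.-tuple R |
    (@map2 n (fun p => (p.1 + a * p.2, p.2)) @^-1` A) [tuple of p.1 :: [tuple of p.2 :: t]]]) =
    fun p => f (p.1 + a * p.2, p.2).
  apply/funext => p; rewrite /f; congr (mpower _ _ _).
  by apply/seteqP; split => t /=; rewrite map2E.
have mf' : measurable_fun setT (fun p : R * R => f (p.1 + a * p.2, p.2)).
  exact: (measurableT_comp mf mF).
transitivity (\int[leb]_x \int[leb]_y f (x + a * y, y)%R)%E.
  rewrite mpower2; congr integral; apply/funext => x; congr integral.
  by apply/funext => y; have := congr1 (fun g => g (x, y)) f'E.
rewrite (fubini_tonelli (m1 := leb) (m2 := leb) (fun p => f (p.1 + a * p.2, p.2)))//.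
transitivity (\int[leb]_y \int[leb]_x f (x, y))%E.
  congr integral; apply/funext => y /=.
  have mfy : measurable_fun setT (fun x => f (x, y)).
    exact: (measurableT_comp mf (pair2_measurable y)).
  rewrite [RHS](ge0_integral_affine (a * y) ltr01 mfy)// mul1e.
  by congr integral; apply/funext => x; rewrite mul1r.
by rewrite -(fubini_tonelli (m1 := leb) (m2 := leb) f)// mpower2.
Qed.

(* A rotation by an angle other than pi is a product of three shears. *)
Lemma rigid_rot n (cs sn : R) : cs ^+ 2 + sn ^+ 2 = 1 -> cs != -1 ->
  rigid (@map2 n (fun p => (cs * p.1 - sn * p.2, sn * p.1 + cs * p.2))).
Proof.
(* [tau] is the tangent of half the rotation angle, finite because the angle is not pi. *)
move=> cs1 csN; pose tau := sn / (1 + cs).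
have c1 : 1 + cs != 0 by rewrite addrC addr_eq0.
have tc : tau * (1 + cs) = sn by rewrite divfK.
have ts : tau * sn = 1 - cs.
  rewrite /tau mulrAC -expr2 (_ : sn ^+ 2 = (1 - cs) * (1 + cs)) ?mulfK//.
  by rewrite mulrBl !mulrDr; move: cs1; rewrite expr2; lra.
split; last first.
  move=> x y; have [x1 [u ->]] := tuple_consP x; have [x2 [v ->]] := tuple_consP u.
  have [y1 [p ->]] := tuple_consP y; have [y2 [q ->]] := tuple_consP p.
  rewrite !map2E !dotp_cons /= !addrA; congr (_ + _).
  transitivity ((cs ^+ 2 + sn ^+ 2) * (x1 * y1 + x2 * y2)); first by ring.
  by rewrite cs1 mul1r.
rewrite (_ : map2 _ = @map2 n (fun p => (p.1 + (- tau) * p.2, p.2)) \o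
   (@map2 n (fun p => (p.1, p.2 + sn * p.1)) \o @map2 n (fun p => (p.1 + (- tau) * p.2, p.2)))).
  apply: preserves_volume_comp; first exact: preserves_volume_shear1.
  apply: preserves_volume_comp; [exact: preserves_volume_shear2|exact: preserves_volume_shear1].
apply/funext => t /=; rewrite !map2_comp; congr (map2 _ t).
apply/funext => -[x y] /=; congr pair.
  rewrite (_ : x + _ + _ = (1 - tau * sn) * x - (tau * (1 + (1 - tau * sn))) * y); last by ring.
  by rewrite ts opprB addrCA subrr addr0 tc.
rewrite (_ : y + _ = sn * x + (1 - tau * sn) * y); last by ring.
by rewrite ts opprB addrCA subrr addr0.
Qed.

Lemma rigid_rot_to_axis n (a b : R) : exists2 g : n.+2.-tuple R -> n.+2.-tuple R,
  rigid g & forall t : n.-tuple R, g [tuple of a :: [tuple of b :: t]] =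
    [tuple of Num.sqrt (a ^+ 2 + b ^+ 2) :: [tuple of 0 :: t]].
Proof.
set r := Num.sqrt _.
have r2 : r ^+ 2 = a ^+ 2 + b ^+ 2 by rewrite sqr_sqrtr// addr_ge0 ?sqr_ge0.
have r_ge0 : 0 <= r by exact: sqrtr_ge0.
clearbody r.
have [r0|r0] := eqVneq r 0.
  have : a ^+ 2 + b ^+ 2 == 0 by rewrite -r2 r0 expr0n.
  rewrite paddr_eq0 ?sqr_ge0// !sqrf_eq0 => /andP[/eqP a0 /eqP b0].
  by exists id; [exact: rigid_id|move=> t; rewrite r0 a0 b0].
have rp : 0 < r by rewrite lt_def r0.
have [ar|ar] := eqVneq (a / r) (-1); last first.
  exists (@map2 n (fun p => (a / r * p.1 - (- b / r) * p.2, (- b / r) * p.1 + a / r * p.2))).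
    apply: rigid_rot => //; rewrite !expr_div_n sqrrN -mulrDl -r2 divff//.
    by rewrite expf_neq0.
  move=> t; rewrite map2E /=; congr [tuple of _ :: [tuple of _ :: t]].
    transitivity ((a ^+ 2 + b ^+ 2) / r); first by move: (r) r0 => q q0; field.
    by rewrite -r2 expr2 mulfK.
  by move: (r) r0 => q q0; field.
have aE : a = - r by rewrite -[a](divfK r0) ar mulN1r.
have b0 : b = 0.
  apply/eqP; rewrite -sqrf_eq0; move: r2; rewrite aE sqrrN => /eqP.
  by rewrite -subr_eq0 opprD addrA subrr add0r oppr_eq0 => /eqP ->.
have N1 : (0 : R) != -1 by rewrite eq_sym oppr_eq0 oner_eq0.
have q1 : (0 : R) ^+ 2 + 1 ^+ 2 = 1 by rewrite expr0n expr1n add0r.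
(* The excluded half turn is performed as two quarter turns. *)
exists (@map2 n (fun p => (0 * p.1 - 1 * p.2, 1 * p.1 + 0 * p.2)) \o
        @map2 n (fun p => (0 * p.1 - 1 * p.2, 1 * p.1 + 0 * p.2))).
  by apply: rigid_comp; exact: rigid_rot.
move=> t; rewrite /comp !map2E; apply: val_inj; rewrite /= aE b0.
by congr [:: _, _ & _]; ring.
Qed.

(** Planar rotations clear the coordinates one by one from the last; isometry then identifies the
    remaining coordinate up to sign. *)
Lemma rigid_to_axis n (x : n.+2.-tuple R) : exists2 g : n.+2.-tuple R -> n.+2.-tuple R,
  rigid g & g x = [tuple of enorm x :: [tuple of nseq n.+1 0]].
Proof.
(* The sign is claimed only for k > 0: in dimension 1 nothing has been rotated yet. *)
have step k : forall y : k.+1.-tuple R, exists2 g : k.+1.-tuple R -> k.+1.-tuple R,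
    rigid g & exists2 b, (0 < k)%N -> 0 <= b & g y = [tuple of b :: [tuple of nseq k 0]].
  elim: k => [|k IH] y.
    exists id; first exact: rigid_id.
    exists (thead y) => //; have [a [u ->]] := tuple_consP y.
    by apply: val_inj; rewrite (tuple0 u) /= theadE.
  have [g' rg' [b' _ gb']] := IH [tuple of behead y].
  have [g'' rg'' g''E] := rigid_rot_to_axis k (thead y) b'.
  exists (g'' \o lift_tail g'); first exact: (rigid_comp rg'' (rigid_lift_tail rg')).
  exists (Num.sqrt (thead y ^+ 2 + b' ^+ 2)); first by rewrite sqrtr_ge0.
  have lE : lift_tail g' y = [tuple of thead y :: [tuple of b' :: [tuple of nseq k 0]]].
    by rewrite /lift_tail gb'.
  by rewrite /comp lE g''E; apply: val_inj.
have [g rg [b b0 gx]] := step _ x; exists g => //; rewrite gx.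
congr [tuple of _ :: _]; rewrite /enorm -(rg.2 x x) gx dotp_cons.
rewrite [dotp _ _]big1 ?addr0; last by move=> i _; rewrite (tnth_nth 0) nth_nseq if_same mul0r.
by rewrite -expr2 sqrtr_sqr ger0_norm// b0.
Qed.

Lemma surface_cap_rotate n theta (x : n.+2.-tuple R) : dotp x x = 1 ->
  surface_measure (cap theta x) = surface_measure (cap theta (pole R n.+2)).
Proof.
move=> x1; have [g [[mg vg] dg] gx] := rigid_to_axis x.
have nrm y : enorm (g y) = enorm y by rewrite /enorm dg.
have px : pole R n.+2 = g x.
  rewrite gx /enorm x1 sqrtr1; apply: eq_from_tnth => i; rewrite tnth_mktuple.
  have [j ->|->] := unliftP ord0 i; last by rewrite tnth0.
  by rewrite tnthS (tnth_nth 0) nth_nseq if_same.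
have coneE : cone (cos theta) x = g @^-1` cone (cos theta) (pole R n.+2).
  by apply/seteqP; split => y; rewrite /cone /= nrm px dg.
have lE : lebn n.+2 (cone (cos theta) x) = lebn n.+2 (cone (cos theta) (pole R n.+2)).
  by rewrite coneE vg//; exact: measurable_cone.
rewrite /surface_measure /lebesgue_measure_tuple.
by rewrite preimage_radial_cap lE preimage_radial_cap.
Qed.

End rotation.

(** * The hard cap model *)

Definition neq_rel {T : eqType} (x y : T) : bool := x != y.

Section weighted_pushforward.
Context {R : realType} d1 d2 (T : measurableType d1) (V : measurableType d2).
Variables (m : {measure set T -> \bar R}) (B : set T) (f : T -> V) (c : {nonneg R}).
Hypotheses (mB : measurable B) (mf : measurable_fun setT f).

(** One shape for three measures: the terms of the Poisson series, the conditioned law, and its part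
    with exactly k points. *)
Definition weighted_pushforward (A : set V) : \bar R :=
  ((c%:num)%:E * m (B `&` f @^-1` A))%E.

Let wp0 : weighted_pushforward set0 = 0%E.
Proof. by rewrite /weighted_pushforward preimage_set0 setI0 measure0 mule0. Qed.

Let wp_ge0 A : (0 <= weighted_pushforward A)%E.
Proof. by rewrite /weighted_pushforward mule_ge0// lee_fin. Qed.

Let wpE : weighted_pushforward = pushforward (mscale c (mrestr m mB)) f.
Proof.
apply/funext => A; rewrite /pushforward /mscale /= /mrestr.
by rewrite /weighted_pushforward setIC.
Qed.

Let wp_sigma_additive : semi_sigma_additive weighted_pushforward.
Proof. by rewrite wpE; exact: measure_semi_sigma_additive. Qed.

HB.instance Definition _ := isMeasure.Build _ _ _ weighted_pushforward
  wp0 wp_ge0 wp_sigma_additive.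

Lemma weighted_pushforward_measure :
  {m' : {measure set V -> \bar R} | weighted_pushforward = m' :> (set V -> \bar R)}.
Proof. by exists weighted_pushforward. Qed.

End weighted_pushforward.

(** * Product measure of tuples with all pairs related *)

Section good_tuples.
Context {R : realType} d (T : measurableType d) (s : probability T R).
Variable r : T -> T -> bool.
Hypothesis mr : measurable [set z : T * T | r z.1 z.2].

Definition rel_fun (x y : T) : R := (r x y)%:R.

(** Only pairs i < j are constrained, to match [coef], where each point restricts those that come
    after it. *)
Definition good_tuples k (A : set T) : set (k.-tuple T) :=
  [set t | (forall i, A (tnth t i)) /\
           (forall i j : 'I_k, (i < j)%N -> r (tnth t i) (tnth t j))].

Lemma bmeas_rel_fun : bmeas (fun z : T * T => rel_fun z.1 z.2).
Proof.
rewrite (_ : (fun _ => _) = \1_[set z : T * T | r z.1 z.2]); first exact: bmeas_indic.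
apply/funext => z; rewrite indicE /rel_fun; congr (nat_of_bool _)%:R.
by apply/idP/idP; rewrite inE.
Qed.

Lemma measurable_rel1 x : measurable [set y | r x y].
Proof. by have := pair1_measurable x measurableT mr; rewrite setTI. Qed.

Lemma good_tuples_cons k A x (t : k.-tuple T) :
  good_tuples A [tuple of x :: t] <-> A x /\ good_tuples (A `&` [set y | r x y]) t.
Proof.
split.
  move=> [tA tr]; split; first by have := tA ord0; rewrite tnth0.
  split.
    move=> i; split; first by have := tA (lift ord0 i); rewrite tnthS.
    by have := tr ord0 (lift ord0 i) isT; rewrite tnth0 tnthS.
  by move=> i j ij; have := tr (lift ord0 i) (lift ord0 j); rewrite !tnthS; apply.
move=> [xA [tA tr]]; split.
  by move=> i; have [j ->|->] := unliftP ord0 i; rewrite ?tnth0// tnthS; case: (tA j).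
move=> i j; have [i' ->|->] := unliftP ord0 i; have [j' ->|->] := unliftP ord0 j => //.
  by rewrite !tnthS => ij; apply: tr.
by rewrite tnth0 tnthS => _; case: (tA j').
Qed.

Lemma measurable_good_tuples k A : measurable A -> measurable (@good_tuples k A).
Proof.
move=> mA.
rewrite (_ : good_tuples A =
  (\bigcap_(i in setT) ((fun t => tnth t i) @^-1` A)) `&`
  (\bigcap_(p in [set p : 'I_k * 'I_k | (p.1 < p.2)%N])
     [set t | r (tnth t p.1) (tnth t p.2)])).
  apply: measurableI; apply: fin_bigcap_measurable.
  - exact: finite_finset.
  - by move=> i _; rewrite -[X in measurable X]setTI; exact: measurable_tnth.
  - exact: finite_finset.
  - move=> p _.
    have mp : measurable_fun setT (fun t : k.-tuple T => (tnth t p.1, tnth t p.2)).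
      by apply: measurable_fun_pair; exact: measurable_tnth.
    by have := mp measurableT _ mr; rewrite setTI.
apply/seteqP; split => t.
  by move=> [tA tr]; split => [i _|p /= p12]; [exact: tA|exact: tr].
by move=> [tA tr]; split => [i|i j ij]; [exact: tA|exact: (tr (i, j))].
Qed.

Lemma mpower_good_tuples k : forall A, measurable A ->
  mpower s k (@good_tuples k A) = (coef s rel_fun k \1_A)%:E.
Proof.
elim: k => [|k IH] A mA.
  by rewrite /= diracE mem_set//; split => -[].
rewrite mpowerS [coef _ _ _ _]/=.
have bA : bmeas (\1_A : T -> R) by exact: bmeas_indic.
have mAx x : measurable (A `&` [set y | r x y]).
  by apply: measurableI => //; exact: measurable_rel1.
have indicM x : \1_(A `&` [set y | r x y]) = (fun y => \1_A y * rel_fun x y) :> (T -> R).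
  apply/funext => y; rewrite /rel_fun !indicE in_setI -natrM mulnb.
  congr (nat_of_bool _)%:R; congr (_ && _); by apply/idP/idP; rewrite inE.
have -> : (fun x => mpower s k [set t : k.-tuple T | good_tuples A [tuple of x :: t]]) =
    (fun x => (\1_A x * coef s rel_fun k (fun y => \1_A y * rel_fun x y))%:E).
  apply/funext => x; rewrite -indicM EFinM -(IH _ (mAx x)) indicE.
  case: (boolP (x \in A)) => [/set_mem xA|xA].
    rewrite mul1e; congr (mpower _ _ _); apply/seteqP.
    by split => t /=; [move=> /good_tuples_cons[]|move=> ?; apply/good_tuples_cons].
  rewrite mul0e (_ : [set t | _] = set0).
    by have [m ->] := mpower_measure s k; rewrite measure0.
  apply/seteqP; split => t //= /good_tuples_cons[xA' _].
  by move: xA; rewrite notin_setE.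
rewrite /Rintegral fineK//; apply: integrable_fin_num => //.
by apply: bmeas_integrable; apply: bmeas_coef_step => //; exact: bmeas_rel_fun.
Qed.

End good_tuples.

Section mpower_probability.
Context {R : realType} d (T : measurableType d) (s : probability T R).

Lemma mpower_setT k : mpower s k setT = 1%E.
Proof.
elim: k => [|k IH]; first by rewrite /= diracE in_setT.
rewrite mpowerS (_ : (fun _ => _) = cst 1%E); last by apply/funext => x; rewrite -IH.
by rewrite integral_cst// mul1e; exact: probability_setT.
Qed.

Hypothesis mneq : measurable [set z : T * T | neq_rel z.1 z.2].

(** Turning a tuple into a finite set forgets repetitions; this makes repetitions negligible. *)
Lemma mpower_distinct (A : set T) k : measurable A -> s A = 1%E ->
  (forall x, A x -> s [set x] = 0%E) ->
  mpower s k (good_tuples neq_rel A (k := k)) = 1%E.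
Proof.
move=> mA sA sx; rewrite mpower_good_tuples//; congr EFin.
elim: k A mA sA sx => [//|k IH] A mA sA sx.
have mx (x : T) : measurable [set y | neq_rel x y].
  by have := pair1_measurable x measurableT mneq; rewrite setTI.
have indicM x : \1_(A `&` [set y | neq_rel x y]) =
    (fun y => \1_A y * rel_fun neq_rel x y) :> (T -> R).
  apply/funext => y; rewrite /rel_fun !indicE in_setI -natrM mulnb.
  congr (nat_of_bool _)%:R; congr (_ && _); by apply/idP/idP; rewrite inE.
transitivity (\int[s]_x (\1_A x : R)); last by rewrite Rintegral_indicT// sA.
apply: eq_Rintegral => x _; rewrite -indicM indicE.
case: (boolP (x \in A)) => [/set_mem xA|xA]; last by rewrite mul0r.
rewrite mul1r; apply: IH.
- exact: measurableI.
- have m1 : measurable [set x].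
    rewrite (_ : [set x] = ~` [set y | neq_rel x y]); first exact: measurableC.
    apply/seteqP; split => y; rewrite /neq_rel /=; first by move=> ->; rewrite eqxx.
    by move=> /negP; rewrite negbK => /eqP.
  apply/eqP; rewrite eq_le; apply/andP; split.
    by apply: probability_le1; exact: measurableI.
  rewrite -sA; apply: (@le_trans _ _ (s ((A `&` [set y | neq_rel x y]) `|` [set x]))).
    apply: le_measure; rewrite ?inE//; first by apply: measurableU => //; exact: measurableI.
    move=> y yA; have [->|xy] := eqVneq y x; first by right.
    by left; split => //=; rewrite /neq_rel eq_sym.
  apply: le_trans (measureU2 _ _ _) _ => //; first exact: measurableI.
  by rewrite [X in (_ + X)%E](sx x xA) adde0.
- by move=> y [yA _]; exact: sx.
Qed.

End mpower_probability.

Section full_measure.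
Context {R : realType} d (T : measurableType d) (m : {measure set T -> \bar R}).

Lemma full_measureI (D X : set T) : measurable D -> measurable X ->
  m setT = 1%E -> m D = 1%E -> m (X `&` D) = m X.
Proof.
move=> mD mX mT D1.
have DC0 : m (~` D) = 0%E.
  have := measureDI m measurableT mD; rewrite setTI setTD => E.
  have {E} : (1 = m (~` D) + 1)%E by rewrite -[in LHS]mT -[in RHS]D1.
  case: (m (~` D)) (measure_ge0 m (~` D)) => [y| |]//= _.
  by rewrite -EFinD => -[] /eqP; rewrite eq_sym -subr_eq0 addrK => /eqP ->.
have -> : m X = (m (X `\` D) + m (X `&` D))%E by exact: measureDI.
rewrite [X in _ = (X + _)%E](_ : _ = 0%E) ?add0e//.
apply/eqP; rewrite eq_le measure_ge0 andbT -DC0.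
apply: le_measure; rewrite ?inE; [exact: measurableD|exact: measurableC|].
by move=> x [].
Qed.

End full_measure.

Section configuration_size.
Context {R : realType} d (T : measurableType d).
Hypothesis mneq : measurable [set z : T * T | neq_rel z.1 z.2].

(** Prepending a point adds one to the number of distinct entries exactly when it differs from all
    the others, a measurable condition. *)
Lemma measurable_size_undup k :
  measurable_fun setT (fun t : k.-tuple T => (size (undup t))%:R : R).
Proof.
elim: k => [|k IH].
  rewrite (_ : (fun _ => _) = cst 0) //.
  by apply/funext => t; rewrite (tuple0 t).
pose F := [set z : T * k.-tuple T | forall i, z.1 != tnth z.2 i].
have mF : measurable F.
  rewrite (_ : F = \bigcap_(i in setT) [set z : T * k.-tuple T | z.1 != tnth z.2 i]).
    apply: fin_bigcap_measurable => [|i _]; first exact: finite_finset.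
    have mp : measurable_fun setT (fun z : T * k.-tuple T => (z.1, tnth z.2 i)).
      apply: measurable_fun_pair => //.
      exact: (measurableT_comp (measurable_tnth i) measurable_snd).
    by have := mp measurableT _ mneq; rewrite setTI.
  by apply/seteqP; split => z /= h i; [move=> _; exact: h|exact: (h i I)].
rewrite (_ : (fun _ => _) = fun t : k.+1.-tuple T =>
    (\1_F (tuple_uncons t) : R) + (size (undup [tuple of behead t]))%:R).
  apply: measurable_funD.
    have : measurable_fun setT ((\1_F : _ -> R) \o @tuple_uncons _ T k).
      apply: measurableT_comp; [exact: measurable_indic|exact: measurable_tuple_uncons].
    by [].
  have : measurable_fun setT ((fun t : k.-tuple T => (size (undup t))%:R : R) \o
      (fun t : k.+1.-tuple T => [tuple of behead t])).
    by apply: measurableT_comp; [exact: IH|exact: measurable_behead].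
  by [].
apply/funext => t; rewrite indicE -natrD; congr (_%:R).
case/tupleP: t => x t.
have -> : [tuple of behead [tuple of x :: t]] = t by apply: val_inj.
have -> : tuple_uncons [tuple of x :: t] = (x, t) by exact: (tuple_uncons_cons (x, t)).
rewrite /=; have -> : ((x, t) \in F) = (x \notin t :> bool).
  apply/idP/idP; rewrite inE /F /=.
    by move=> h; apply/negP => /tnthP[i xi]; have := h i; rewrite xi eqxx.
  by move=> h i; apply: contra h => /eqP ->; exact: mem_tnth.
by case: (x \in t).
Qed.

Lemma measurable_config_of_tuple k : measurable_fun setT (@config_of_tuple _ T k).
Proof. by move=> _ B mB; rewrite setTI; exact: mB. Qed.

Lemma measurable_config_size :
  measurable_fun setT (fun X : configuration T => (#|` (X : {fset _})|%:R : R)%:E).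
Proof.
move=> _ Y mY; rewrite setTI; set f := (X in X @^-1` Y).
suff : config_measurable (f @^-1` Y) by [].
move=> k; have := @measurable_size_undup k; move=> /measurable_EFinP mk.
have := mk measurableT _ mY; rewrite setTI; congr measurable.
by apply/seteqP; split => t; rewrite /f /= /config_of_tuple card_fseq.
Qed.

End configuration_size.

(** * The expected size as the ratio of mean-size sum and partition function *)

Section hard_cap_expectation.
Context {R : realType} (n : nat) (theta : R).
Hypothesis n_gt1 : (1 < n)%N.
Hypothesis cos_lt1 : cos theta < 1.
Local Notation T := (n.-tuple R).

Definition code_rel (x y : T) : bool := dotp x y <= cos theta.

Lemma measurable_code_rel : measurable [set z : T * T | code_rel z.1 z.2].
Proof. by apply: measurable_le => //; exact: measurable_dotp. Qed.

Lemma measurable_tuple_neq : measurable [set z : T * T | neq_rel z.1 z.2].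
Proof.
rewrite (_ : [set z | _] = ~` (\bigcap_(i in setT) [set z : T * T | tnth z.1 i = tnth z.2 i])).
  apply: measurableC; apply: fin_bigcap_measurable => [|i _]; first exact: finite_finset.
  have m1 : measurable_fun setT (fun z : T * T => tnth z.1 i).
    exact: (measurableT_comp (measurable_tnth i) measurable_fst).
  have m2 : measurable_fun setT (fun z : T * T => tnth z.2 i).
    exact: (measurableT_comp (measurable_tnth i) measurable_snd).
  have := measurable_fun_eqr m1 m2 measurableT (Y := [set true]) I; rewrite setTI.
  by congr measurable; apply/seteqP; split => z /=; [move=> /eqP|move=> /eqP].
apply/seteqP; split => z; rewrite /neq_rel /=.
  by move=> /eqP h h'; apply: h; apply: eq_from_tnth => i; exact: h'.
by move=> h; apply/eqP => zz; apply: h => i _; rewrite /= zz.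
Qed.

Lemma measurable_sphere : measurable (@sphere R n).
Proof.
rewrite (_ : @sphere R n = [set x | enorm x <= 1] `&` [set x | 1 <= enorm x]).
  by apply: measurableI; apply: measurable_le => //; exact: measurable_enorm.
apply/seteqP; split => x /=; first by rewrite /sphere /= => ->.
by move=> [h1 h2]; apply/eqP; rewrite eq_le h1 h2.
Qed.

Variable s : probability T R.
Hypothesis sE : @surface_measure R n = s :> (set T -> \bar R).

Lemma surface_sphere : s (@sphere R n) = 1%E.
Proof.
rewrite -(probability_setT s) -sE /surface_measure; congr (lebesgue_measure_tuple _ * _)%E.
rewrite preimage_setT setIT; apply/seteqP; split => x; first by case.
by move=> xb; split => //; apply: sphere_radial; move: xb; rewrite /punctured_ball /= => /andP[].
Qed.

Lemma surface_set1 x : @sphere R n x -> s [set x] = 0%E.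
Proof.
move=> /sphereE x1; have := surface_point n_gt1 x1; rewrite sE => s0.
rewrite -[LHS]fineK ?s0//; apply: fin_num_measure.
have := pair1_measurable x measurableT measurable_tuple_neq; rewrite setTI => mx.
rewrite (_ : [set x] = ~` [set y | neq_rel x y]); first exact: measurableC.
apply/seteqP; split => y; rewrite /neq_rel /=; first by move=> ->; rewrite eqxx.
by move=> /negP; rewrite negbK => /eqP.
Qed.

Definition code_coef k : R := coef s (rel_fun code_rel) k \1_(@sphere R n).

Local Notation good k := (@good_tuples _ _ code_rel k (@sphere R n)).

Lemma mem_config k (t : k.-tuple T) x : (x \in (config_of_tuple t : {fset _})) = (x \in t).
Proof. by rewrite /config_of_tuple !inE. Qed.

(** A repeated entry would be a unit vector with inner product 1 > cos theta with itself. *)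
Lemma good_uniq k (t : k.-tuple T) : good k t -> uniq t.
Proof.
move=> [tS tr]; apply/(uniqP (pole R n)) => i j.
rewrite !inE size_tuple => ik jk; apply: contra_eq => ij.
wlog lt_ij : i j ik jk ij / (i < j)%N.
  move=> W; move: ij; rewrite neq_ltn => /orP[ij|ij]; first by apply: W; rewrite ?ltn_eqF.
  by rewrite eq_sym; apply: W; rewrite ?ltn_eqF.
have := tr (Ordinal ik) (Ordinal jk) lt_ij.
rewrite /code_rel !(tnth_nth (pole R n)) /=.
apply: contraTneq => ->.
have /sphereE := tS (Ordinal jk).
by rewrite (tnth_nth (pole R n)) /= => ->; rewrite -ltNge.
Qed.

(** A repeated entry is invisible in the underlying set, so the hard cap condition agrees with
    [code_rel] on all pairs only for tuples with distinct entries. *)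
Lemma hard_cap_good k :
  (@config_of_tuple _ T k @^-1` hard_cap theta) `&`
    good_tuples neq_rel (@sphere R n) (k := k) = good k.
Proof.
apply/seteqP; split => t.
  move=> [hc [tS tr]]; split => // i j ij; apply: hc; rewrite ?mem_config ?mem_tnth//.
  exact: tr.
move=> gt; have [tS tr] := gt; split.
  move=> x y; rewrite !mem_config => /tnthP[i ->] /tnthP[j ->] xy.
  have [ij|ij|/val_inj ij] := ltngtP i j.
  - exact: tr.
  - by rewrite dotpC; exact: tr.
  - by rewrite ij eqxx in xy.
split => // i j ij; have := good_uniq gt; apply: contraTN => /eqP tij.
apply/negP => /(uniqP (tnth t i))/(_ i j).
rewrite !inE size_tuple !ltn_ord -!tnth_nth => /(_ isT isT tij) ij'.
by rewrite ij' ltnn in ij.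
Qed.

Lemma measurable_hard_cap : measurable (@hard_cap R n theta).
Proof.
suff : config_measurable (@hard_cap R n theta) by [].
move=> k; rewrite (_ : _ @^-1` _ = \bigcap_(p in [set: 'I_k * 'I_k])
    ([set t : k.-tuple T | code_rel (tnth t p.1) (tnth t p.2)] `|`
    ~` [set t : k.-tuple T | neq_rel (tnth t p.1) (tnth t p.2)])).
  apply: fin_bigcap_measurable => [|p _]; first exact: finite_finset.
  have mp : measurable_fun setT (fun t : k.-tuple T => (tnth t p.1, tnth t p.2)).
    by apply: measurable_fun_pair; exact: measurable_tnth.
  apply: measurableU; first by have := mp measurableT _ measurable_code_rel; rewrite setTI.
  by apply: measurableC; have := mp measurableT _ measurable_tuple_neq; rewrite setTI.
apply/seteqP; split => t.
  move=> hc p _ /=; have [e|ne] := eqVneq (tnth t p.1) (tnth t p.2).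
    by right; rewrite /neq_rel e eqxx.
  by left; apply: hc; rewrite ?mem_config ?mem_tnth.
move=> h x y; rewrite !mem_config => /tnthP[i ->] /tnthP[j ->] xy.
by have [//|] := h (i, j) I; rewrite /= /neq_rel xy.
Qed.

Lemma mpower_hard_cap k (E : set (k.-tuple T)) : measurable E ->
  mpower s k ((@config_of_tuple _ T k @^-1` hard_cap theta) `&` E) =
  mpower s k (good k `&` E).
Proof.
move=> mE; have [m mE'] := mpower_measure s k.
have mD := measurable_good_tuples (r := neq_rel (T := T)) measurable_tuple_neq (k := k) measurable_sphere.
have mH : measurable (@config_of_tuple _ T k @^-1` hard_cap theta).
  exact: measurable_hard_cap.
have D1 := mpower_distinct measurable_tuple_neq k measurable_sphere surface_sphere
  surface_set1.
have T1 := mpower_setT s k; move: D1 T1; rewrite mE' => D1 T1.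
rewrite -(full_measureI mD _ T1 D1); last exact: measurableI.
by rewrite setIAC hard_cap_good.
Qed.

Lemma mpower_good k : mpower s k (good k) = (code_coef k)%:E.
Proof.
by rewrite mpower_good_tuples//; [exact: measurable_code_rel|exact: measurable_sphere].
Qed.

Variables (lam : R) (N : nat).
Hypothesis lam_gt0 : 0 < lam.
Hypothesis code_coef0 : forall k, (N < k)%N -> code_coef k = 0.

Let w k : {nonneg R} := NngNum (poisson_pmf_ge0 lam k).
Let mk k := sval (mpower_measure s k).
Let mkE k : mpower s k = mk k :> (set _ -> \bar R) := svalP (mpower_measure s k).

Let muk k := weighted_pushforward_measure (mk k) (w k) measurableT
  (@measurable_config_of_tuple _ T k).

Let pois : {measure set (configuration T) -> \bar R} := mseries (fun k => sval (muk k)) 0.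

Let poisE B : poisson_process (@surface_measure R n) lam B = pois B.
Proof.
rewrite /pois /= /mseries /poisson_process; apply: eq_eseriesr => k _.
rewrite -(svalP (muk k)) /weighted_pushforward setTI /pushforward sE.
by rewrite mkE.
Qed.

Let z : R := (fine (pois (hard_cap theta)))^-1.
Let z_ge0 : 0 <= z. Proof. by rewrite invr_ge0 fine_ge0. Qed.

Let law := sval (weighted_pushforward_measure pois (NngNum z_ge0)
  measurable_hard_cap (@measurable_id _ _ setT)).

Let lawE : hard_cap_law theta lam = law :> (set _ -> \bar R).
Proof.
rewrite /law -(svalP (weighted_pushforward_measure pois (NngNum z_ge0)
  measurable_hard_cap (@measurable_id _ _ setT))).
apply/funext => B; rewrite /hard_cap_law /weighted_pushforward !poisE muleC.
by rewrite setIC.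
Qed.

Let zw k : {nonneg R} := NngNum (mulr_ge0 z_ge0 (poisson_pmf_ge0 lam k)).

Let mgood k : measurable (good k).
Proof.
by apply: measurable_good_tuples; [exact: measurable_code_rel|exact: measurable_sphere].
Qed.

Let nuk k := weighted_pushforward_measure (mk k) (zw k) (@mgood k)
  (@measurable_config_of_tuple _ T k).

Let nu k := sval (nuk k).

(** The Poisson series becomes a finite sum because good tuples with more than N entries form a null
    set. *)
Let pois_hardE B : measurable B ->
  pois (hard_cap theta `&` B) =
  (\sum_(k < N.+1) (poisson_pmf lam k)%:E * mk k (good k `&` @config_of_tuple _ T k @^-1` B))%E.
Proof.
move=> mB; rewrite -poisE /poisson_process.
have tE k : pushforward (mpower (@surface_measure R n) k) (@config_of_tuple _ T k)
    (hard_cap theta `&` B) = mk k (good k `&` @config_of_tuple _ T k @^-1` B).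
  by rewrite /pushforward preimage_setI sE mpower_hard_cap ?mkE//; exact: mB.
under eq_eseriesr => k _ do rewrite tE.
rewrite (nneseries_split 0 N.+1); last by move=> k _; rewrite mule_ge0// lee_fin poisson_pmf_ge0.
rewrite add0n eseries0 ?adde0 ?big_mkord// => k Nk _.
rewrite [X in (_ * X)%E](_ : _ = 0%E) ?mule0//.
apply/eqP; rewrite eq_le measure_ge0 andbT.
apply: (@le_trans _ _ (mk k (good k))).
  apply: le_measure; last by move=> t [].
    by rewrite inE; apply: measurableI; [exact: mgood|exact: mB].
  by rewrite inE; exact: mgood.
by rewrite -mkE mpower_good code_coef0.
Qed.

(** The law is a finite sum of measures [nu k], and under [nu k] the configuration has exactly k
    points almost everywhere. The factor exp (- lam) cancels between numerator and normalisation. *)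
Lemma expected_size_ratio :
  expected_size n theta lam = Msum N code_coef lam / Zsum N code_coef lam.
Proof.
have pmfE k : poisson_pmf lam k = fugw lam k * expR (- lam).
  by rewrite /poisson_pmf lam_gt0.
have mkgood k : mk k (good k) = (code_coef k)%:E by rewrite -mkE mpower_good.
have poisH : pois (hard_cap theta) = (expR (- lam) * Zsum N code_coef lam)%:E.
  have := pois_hardE measurableT; rewrite setIT => ->.
  rewrite /Zsum mulr_sumr -sumEFin; apply: eq_bigr => k _.
  by rewrite preimage_setT setIT mkgood pmfE -EFinM; congr EFin; ring.
have zE : z = (expR (- lam) * Zsum N code_coef lam)^-1 by rewrite /z poisH.
rewrite /expected_size lawE.
have mf := measurable_config_size (R := R) measurable_tuple_neq.
have f0 (X : configuration T) : (0 <= (#|` (X : {fset _})|%:R : R)%:E)%E by rewrite lee_fin.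
rewrite (eq_measure_integral (msum nu N.+1)); last first.
  move=> B mB _; rewrite /law -(svalP (weighted_pushforward_measure pois (NngNum z_ge0)
    measurable_hard_cap (@measurable_id _ _ setT))) /weighted_pushforward preimage_id.
  rewrite pois_hardE// /msum /= ge0_sume_distrr; last first.
    by move=> k _; rewrite mule_ge0// lee_fin poisson_pmf_ge0.
  apply: eq_bigr => k _; rewrite /nu -(svalP (nuk k)) /weighted_pushforward /=.
  by rewrite EFinM muleA.
rewrite ge0_integral_measure_sum//.
have intE k : (\int[nu k]_X (#|` (X : {fset _})|%:R)%:E =
    (k%:R * (z * poisson_pmf lam k * code_coef k))%:E)%E.
  have nuE B : nu k B = ((z * poisson_pmf lam k)%:E *
      mk k (good k `&` @config_of_tuple _ T k @^-1` B))%E by rewrite /nu -(svalP (nuk k)).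
  rewrite (ae_eq_integral (cst (k%:R%:E)))//; last first.
    exists [set X : configuration T | (#|` (X : {fset _})|%:R : R)%:E != (k%:R : R)%:E]; split.
    - rewrite (_ : [set X | _] = ~` [set X : configuration T |
        (#|` (X : {fset _})|%:R : R)%:E = (k%:R : R)%:E]).
        apply: measurableC; have := mf measurableT _ (emeasurable_set1 (k%:R : R)%:E).
        by rewrite setTI.
      by apply/seteqP; split => X /= /eqP.
    - rewrite nuE (_ : _ `&` _ = set0) ?measure0 ?mule0//.
      apply/seteqP; split => // t [gt] /=; rewrite /config_of_tuple card_fseq.
      by rewrite undup_id ?size_tuple ?eqxx//; exact: good_uniq.
    - by move=> X /= h; apply/eqP => e; apply: h => _; rewrite e.
  rewrite integral_cst// nuE preimage_setT setIT mkgood -EFinM.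
  by congr EFin.
under eq_bigr do rewrite intE.
rewrite sumEFin /= /Msum zE invfM mulr_suml; apply: eq_bigr => k _.
rewrite pmfE.
have e0 : expR (- lam) != 0 by rewrite gt_eqF// expR_gt0.
by move: (Zsum _ _ _)^-1 (expR _) e0 => y x x0; field.
Qed.

End hard_cap_expectation.

(** * Finiteness of the maximal code size *)

Section code_size.
Context {R : realType} (n : nat) (theta : R).
Hypothesis cos_lt1 : cos theta < 1.
Local Notation T := (n.-tuple R).

Lemma sphere_tnth (x : T) i : sphere x -> `|tnth x i| <= 1.
Proof.
move=> /sphereE x1; rewrite -(ler_pXn2r (n := 2))// ?nnegrE// expr1n -normrX.
rewrite ger0_norm ?sqr_ge0// -x1 /dotp (bigD1 i)//= -expr2 lerDl.
by apply: sumr_ge0 => j _; rewrite -expr2 sqr_ge0.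
Qed.

Lemma code_far (C : {fset T}) x y : spherical_code theta C -> x \in C -> y \in C ->
  x != y -> 2 * (1 - cos theta) <= \sum_(i < n) (tnth x i - tnth y i) ^+ 2.
Proof.
move=> [CS hC] xC yC xy; have := hC x y xC yC xy.
have /sphereE x1 := CS x xC; have /sphereE y1 := CS y yC.
have -> : \sum_(i < n) (tnth x i - tnth y i) ^+ 2 = dotp x x + dotp y y - 2 * dotp x y.
  by rewrite /dotp mulr_sumr -big_split -sumrB /=; apply: eq_bigr => i _; ring.
by rewrite x1 y1; lra.
Qed.

(* Cutting the cube into small cells puts at most one codeword in each cell. *)
Lemma code_size_bounded :
  exists B : nat, forall C : {fset T}, spherical_code theta C -> (#|` C| <= B)%N.
Proof.
(* Cells of side 1 / m: two points of one cell are at squared distance at most n / m ^ 2 <= n / m,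
   below the least squared distance 2 (1 - cos theta) between codewords. *)
have [m mP] : exists m : nat, n%:R / (2 * (1 - cos theta)) < m%:R :> R.
  by exists (Num.truncn (n%:R / (2 * (1 - cos theta)))).+1; rewrite truncnS_gt.
have c0 : 0 < 2 * (1 - cos theta) by rewrite mulr_gt0// subr_gt0.
have m0 : 0 < m%:R :> R by rewrite (le_lt_trans _ mP)// divr_ge0// ltW.
pose M := (2 * m)%N.
pose cell (x : T) : {ffun 'I_n -> 'I_M.+1} :=
  [ffun i => inord (Num.truncn (m%:R * (tnth x i + 1)))].
exists #|{: {ffun 'I_n -> 'I_M.+1}}| => C code.
have [CS _] := code.
have cell_inj : {in C &, injective cell}.
  move=> x y xC yC xy; apply/eqP/negPn/negP => neq.
  have := code_far code xC yC neq; apply/negP; rewrite -ltNge.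
  have sq_le i : (tnth x i - tnth y i) ^+ 2 <= m%:R^-1.
    have := congr1 (fun f : {ffun 'I_n -> 'I_M.+1} => val (f i)) xy; rewrite !ffunE.
    have tr z : z \in C -> 0 <= m%:R * (tnth z i + 1) /\
        (Num.truncn (m%:R * (tnth z i + 1)) < M.+1)%N.
      move=> zC; have := sphere_tnth i (CS z zC); rewrite ler_norml => /andP[z1 z2].
      have z0 : 0 <= m%:R * (tnth z i + 1) by rewrite mulr_ge0//; lra.
      split => //; rewrite ltnS -(ler_nat R); have /andP[+ _] := truncn_itv z0.
      move=> /le_trans; apply; rewrite /M natrM mulrC ler_wpM2r//; lra.
    have [x0 xM] := tr x xC; have [y0 yM] := tr y yC.
    rewrite /= !inordK// => e.
    have /andP[xl xu] := truncn_itv x0; have /andP[yl yu] := truncn_itv y0.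
    rewrite e -natr1 in xl xu; rewrite -natr1 in yu.
    have m1 : 1 <= m%:R :> R by rewrite ler1n lt0n; apply: contraTneq m0 => ->; rewrite ltxx.
    have dm : `|m%:R * (tnth x i - tnth y i)| <= 1 by rewrite ler_norml; apply/andP; split; lra.
    have : (m%:R * (tnth x i - tnth y i)) ^+ 2 <= 1.
      by rewrite -real_normK ?num_real// exprn_ile1.
    rewrite exprMn => sq; rewrite -(ler_pM2l m0) divff ?gt_eqF//.
    apply: le_trans sq; rewrite ler_wpM2r ?sqr_ge0// expr2 ler_pMl//.
  apply: (@le_lt_trans _ _ (\sum_(i < n) m%:R^-1)); first by apply: ler_sum => i _; exact: sq_le.
  rewrite sumr_const card_ord -[ltLHS]mulr_natl ltr_pdivrMr// mulrC -ltr_pdivrMr//.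
rewrite -(size_map cell) -(card_uniqP _) ?max_card//.
by rewrite map_inj_in_uniq ?fset_uniq.
Qed.

(** Code sizes are bounded and the empty code exists, so a maximum exists and [xget] does not fall
    back on its default 0. *)
Lemma code_size_le (C : {fset T}) : spherical_code theta C ->
  (#|` C| <= max_code_size n theta)%N.
Proof.
have [B BP] := code_size_bounded.
pose P k := `[< exists2 C : {fset T}, spherical_code theta C & #|` C| = k >].
have exP : exists k, P k.
  by exists 0%N; apply/asboolP; exists fset0; rewrite ?cardfs0//; split=> x; rewrite inE.
have ubP k : P k -> (k <= B)%N by move=> /asboolP[D cD <-]; exact: BP.
rewrite /max_code_size; move: C; set S := [set k | _].
suff : S (xget 0%N S) by case.
apply: xgetPex; case: (ex_maxnP exP ubP) => k /asboolP Pk kmax; exists k; split => // C cC.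
by apply: kmax; apply/asboolP; exists C.
Qed.

Variable s : probability T R.

Lemma code_coef_gt_max k : (max_code_size n theta < k)%N -> code_coef theta s k = 0.
Proof.
move=> k_gt; have := mpower_good theta s k.
have -> : good_tuples (code_rel theta) (@sphere R n) (k := k) = set0.
  apply/seteqP; split => // t gt; have [tS tr] := gt.
  have : spherical_code theta (config_of_tuple t).
    split=> [x|x y]; rewrite !mem_config; first by move=> /tnthP[i ->]; exact: tS.
    move=> /tnthP[i ->] /tnthP[j ->] xy.
    have [ij|ij|/val_inj ij] := ltngtP i j; [exact: tr|by rewrite dotpC; exact: tr|].
    by rewrite ij eqxx in xy.
  move=> /code_size_le; rewrite /config_of_tuple card_fseq undup_id.
    by rewrite size_tuple leqNgt k_gt.
  exact: good_uniq gt.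
have [m ->] := mpower_measure s k; rewrite measure0 => /eqP; rewrite eq_sym.
by move=> /eqP[].
Qed.

End code_size.

(** * Spherical correlations *)

Section spherical_correlation.
Context {R : realType} (n : nat) (theta : R).
Hypothesis n_gt1 : (1 < n)%N.
Local Notation T := (n.-tuple R).
Local Notation S := (@sphere R n).
Variable s : probability T R.
Hypothesis sE : @surface_measure R n = s :> (set T -> \bar R).
Local Notation h := (rel_fun (code_rel theta)).
Implicit Types (psi D : T -> R) (w x y : T).

Definition vsum (xs : seq T) : T := [tuple \sum_(x <- xs) tnth x i | i < n].

Lemma dotp_vsum xs y : dotp (vsum xs) y = \sum_(x <- xs) dotp x y.
Proof.
rewrite /dotp exchange_big /=; apply: eq_bigr => i _.
by rewrite tnth_mktuple mulr_suml.
Qed.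

Lemma gram_dotp xs : gram (@dotp R n) xs = dotp (vsum xs) (vsum xs).
Proof.
rewrite dotp_vsum; apply: eq_bigr => x _; rewrite dotpC dotp_vsum.
by apply: eq_bigr => y _; rewrite dotpC.
Qed.

Lemma weight_indic (A : set T) : measurable A -> weight (\1_A : T -> R).
Proof.
move=> mA; split; first exact: bmeas_indic.
by move=> x; rewrite indicE; case: (_ \in _); rewrite /= ?lexx ?ler01.
Qed.

Lemma on_sphere psi x : weight psi -> (forall y, psi y <= (\1_S y : R)) ->
  psi x = 0 \/ S x.
Proof.
move=> [_ /(_ x)/andP[p0 _]] /(_ x); rewrite indicE.
have [xS _|_ px] := boolP (x \in S); first by right; rewrite inE in xS.
by left; apply/eqP; rewrite eq_le px p0.
Qed.

Lemma sphere_indic x : 0 < (\1_S x : R) -> S x.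
Proof. by rewrite indicE; case: (boolP (x \in S)) => [|_]; rewrite ?ltxx// inE. Qed.

Lemma dotp_abs_le x y : S y -> `|dotp x y| <= enorm x.
Proof.
move=> /sphereE y1; rewrite -sqrtr_sqr /enorm ler_wsqrtr//.
by rewrite (le_trans (dotp_cauchy x y))// y1 mulr1.
Qed.

Lemma bmeas_dotp psi x : weight psi -> (forall y, psi y <= (\1_S y : R)) ->
  bmeas (fun y => psi y * dotp x y).
Proof.
move=> wp pS; have [[mp _] p01] := wp; split.
  by apply: measurable_funM => //; exact: measurable_dotp1.
exists (enorm x) => y; have [->|yS] := on_sphere y wp pS.
  by rewrite mul0r normr0 enorm_ge0.
have /andP[p0 p1] := p01 y; rewrite normrM ger0_norm//.
by rewrite (le_trans _ (dotp_abs_le x yS))// ler_piMl.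
Qed.

(** Outside the cap the inner product is below t; inside it the integrand is at most 1. *)
Lemma dotp_mean_le psi w (t : R) : weight psi -> (forall y, psi y <= (\1_S y : R)) ->
  dotp w w = 1 -> 0 <= t ->
  \int[s]_y (psi y * dotp w y) <=
    t * \int[s]_y psi y + fine (s [set y | t <= dotp w y]).
Proof.
move=> wp pS w1 t0; have [bp p01] := wp.
have mA : measurable [set y | t <= dotp w y].
  by apply: measurable_le => //; exact: measurable_dotp1.
rewrite -Rintegral_indicT// -bRintegralZl// -bRintegralD; last 2 first.
- by apply: bmeasM => //; exact: bmeas_cst.
- exact: bmeas_indic.
apply: le_bRintegral.
- exact: bmeas_dotp.
- apply: bmeasD; last exact: bmeas_indic.
  by apply: bmeasM => //; exact: bmeas_cst.
move=> y; have /andP[p0 p1] := p01 y; rewrite indicE.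
have [->|yS] := on_sphere y wp pS; first by rewrite mul0r mulr0 add0r; case: (_ \in _).
have [ty|yt] := leP t (dotp w y).
  rewrite mem_set//= -[leLHS]add0r lerD ?mulr_ge0//.
  have /sphereE wS := w1; have /= := dotp_abs_le w yS; rewrite wS.
  rewrite ler_norml => /andP[_ d1]; rewrite (le_trans _ p1)// ler_piMr//.
rewrite memNset; last by rewrite /= leNgt yt.
by rewrite addr0 mulrC ler_wpM2r// ltW.
Qed.

(** The sum over [xs] is the inner product with one vector, whose norm is the square root of the
    Gram sum. In its direction the mean is at most t plus the cap mass, and the slack r - t absorbs
    that mass. *)
Lemma dotp_mean_bound psi xs (r t m : R) : weight psi ->
  (forall y, psi y <= (\1_S y : R)) -> 0 <= t -> t <= r ->
  (forall w, dotp w w = 1 -> fine (s [set y | t <= dotp w y]) <= m) ->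
  m <= (r - t) * \int[s]_y psi y ->
  \int[s]_y (psi y * \sum_(x <- xs) dotp x y) <=
    r * Num.sqrt (gram (@dotp R n) xs) * \int[s]_y psi y.
Proof.
move=> wp pS t0 tr wm mp; have [bp p01] := wp.
have I0 : 0 <= \int[s]_y psi y by apply: Rintegral_ge0 => y _; have /andP[] := p01 y.
under eq_Rintegral do rewrite -dotp_vsum.
rewrite gram_dotp; set u := vsum xs; rewrite -/(enorm u).
have [u0|] := eqVneq (enorm u) 0.
  rewrite u0 mulr0 mul0r -(bRintegral_cst s 0); apply: le_bRintegral.
  - exact: bmeas_dotp.
  - exact: bmeas_cst.
  move=> y; have [->|yS] := on_sphere y wp pS; first by rewrite mul0r.
  by have := dotp_abs_le u yS; rewrite u0 normr_le0 => /eqP ->; rewrite mulr0.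
rewrite neq_lt ltNge enorm_ge0 /= => u0.
have /sphereE w1 := sphere_radial u0.
rewrite (_ : \int[s]_y _ = enorm u * \int[s]_y (psi y * dotp (radial_proj u) y)).
  rewrite -mulrA mulrCA ler_pM2l//.
  apply: (le_trans (dotp_mean_le wp pS w1 t0)).
  have := le_trans (wm _ w1) mp; rewrite mulrBl; lra.
rewrite -bRintegralZl; last exact: bmeas_dotp.
apply: eq_Rintegral => y _; rewrite dotp_radial.
by field; rewrite gt_eqF.
Qed.

Lemma code_rel01 x y : 0 <= (h x y : R) <= 1.
Proof. by rewrite /rel_fun; case: (code_rel _ _ _); rewrite ?lexx ?ler01. Qed.

Lemma code_rel_sym x y : h x y = h y x :> R.
Proof. by rewrite /rel_fun /code_rel dotpC. Qed.

Lemma bmeas_code_rel : bmeas (fun z : T * T => h z.1 z.2 : R).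
Proof. by apply: bmeas_rel_fun; exact: measurable_code_rel. Qed.

(** Conflict is a strict inequality with cos theta, adjacency a weak one. *)
Lemma conflict_le_density D : weight D ->
  conflict s h D <= density s (@dotp R n) (cos theta) D.
Proof.
move=> wD; have [bD D01] := wD.
have b1h : bmeas (fun z : T * T => 1 - h z.1 z.2 : R).
  by apply: bmeasB; [exact: bmeas_cst|exact: bmeas_code_rel].
have b1hx x : bmeas (fun y => 1 - h x y : R).
  by apply: (bmeas_comp (g := pair x) _ b1h); exact: pair1_measurable.
have bA := @bmeas_adj _ _ T (@dotp R n) (@measurable_dotp R n) (cos theta).
have bAx := @bmeas_adj1 _ _ T (@dotp R n) (@measurable_dotp R n) (cos theta).
apply: le_bRintegral.
- apply: bmeasM => //.
  apply: (bmeas_Rintegral s (F := fun x y => D y * (1 - h x y))).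
  by apply: bmeasM; [exact: bmeas_comp bD|exact: b1h].
- by apply: bmeasM => //; apply: bmeas_degree => //; exact: measurable_dotp.
move=> x; have /andP[D0 _] := D01 x; rewrite ler_wpM2l//.
apply: le_bRintegral.
- by apply: bmeasM => //; exact: b1hx.
- by apply: bmeasM => //; exact: bAx.
move=> y; have /andP[Dy0 _] := D01 y; rewrite ler_wpM2l//.
rewrite /rel_fun /code_rel /adj; have [_|/ltW ->] := leP (dotp x y) (cos theta).
  by rewrite subrr.
by rewrite subr0.
Qed.

(** The bootstrap is started at level cos theta. The last hypothesis says that every weight met on
    the way outweighs a cap of level t, whose measure is at most rho ^ n / eps; this supplies the
    mean bound. *)
Lemma conflict_small D (r t eps rho eta p : R) (k m : nat) :
  weight D -> (forall y, D y <= (\1_S y : R)) -> 0 < \int[s]_y D y ->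
  0 <= cos theta -> 0 <= eta -> 0 < p -> p <= 1 -> (0 < k)%N ->
  0 <= t -> t < r -> r <= 1 -> r ^+ 2 <= cos theta ->
  r ^+ 2 * (k%:R^-1 + eta) < cos theta * (cos theta - r ^+ 2) ->
  1 < cos theta + m%:R * eta ->
  0 < eps -> eps < 1 -> 0 < rho -> 1 - t ^+ 2 + eps ^+ 2 <= rho ^+ 2 ->
  rho ^+ n / eps <=
    (r - t) * ((p / (8 * k.+1%:R)) ^+ (k.+1 * 4 ^ m) * \int[s]_y D y) ->
  conflict s h D <= p * (\int[s]_y D y) ^+ 2.
Proof.
move=> wD DS I0 c0 eta0 p0 p1 k0 t0 tr r1 rc gap cm e0 e1 rho0 rhoP mass.
have n0 : (0 < n)%N by exact: ltnW.
apply: (le_trans (conflict_le_density wD)); apply: ltW.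
have capm w : dotp w w = 1 -> fine (s [set y | t <= dotp w y]) <= rho ^+ n / eps.
  move=> w1; rewrite ler_pdivlMr// -sE; apply: surface_ge_upper => //.
  by rewrite (le_trans _ r1)// ltW.
apply: (@density_bootstrap _ _ _ s _ \1_S _ _ _ r ((p / (8 * k.+1%:R)) ^+ (k.+1 * 4 ^ m))
  D _ _ _ _ _ _ (cos theta) eta p k m) => //.
- exact: measurable_dotp.
- exact: dotpC.
- move=> x y /sphere_indic xS /sphere_indic yS; have := dotp_abs_le x yS.
  by rewrite xS ler_norml => /andP[].
- by rewrite (le_trans t0)// ltW.
- move=> psi xs wp pS bp _; apply: (@dotp_mean_bound psi xs r t (rho ^+ n / eps)) => //.
    exact: ltW.
  apply: (le_trans mass); rewrite ler_wpM2l// subr_ge0; exact: ltW.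
- by move=> psi x wp pS _; exact: bmeas_dotp.
Qed.

Lemma conflict_cap_le x (kappa : R) : (forall x, S x -> fine (s (cap theta x)) <= kappa) ->
  \1_S x * \int[s]_v (\1_S v * (1 - h v x)) <= kappa * (\1_S x : R).
Proof.
move=> capk; rewrite [in X in _ <= _ * X]indicE [in X in X * _ <= _]indicE.
have [xS|_] := boolP (x \in S); last by rewrite mul0r mulr0.
rewrite mulr1 mul1r; rewrite inE in xS; apply: le_trans (capk x xS).
have mc : measurable (cap theta x).
  rewrite (_ : cap theta x = S `&` [set y | cos theta <= dotp x y])//.
  apply: measurableI; first exact: measurable_sphere.
  by apply: measurable_le => //; exact: measurable_dotp1.
rewrite -Rintegral_indicT//; apply: le_bRintegral.
- apply: bmeasM; first by apply: bmeas_indic; exact: measurable_sphere.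
  apply: bmeasB; first exact: bmeas_cst.
  by apply: (bmeas_comp (g := fun v => (v, x)) _ bmeas_code_rel); exact: pair2_measurable.
- exact: bmeas_indic.
move=> v; rewrite !indicE; have [vS|_] := boolP (v \in S); last by rewrite mul0r.
rewrite mul1r /rel_fun /code_rel; have [_|lt] := leP (dotp v x) (cos theta).
  by rewrite subrr.
rewrite inE in vS; rewrite subr0 mem_set//; split => //.
by rewrite dotpC ltW.
Qed.

End spherical_correlation.

(** * Monotonicity and bounds for the expected size *)

Section expected_size.
Context {R : realType} (d : nat) (theta : R).
Hypothesis cos_lt1 : cos theta < 1.
Local Notation n := d.+2.
Local Notation T := (n.-tuple R).
Local Notation S := (@sphere R n).

Lemma expected_sizeE : exists a : nat -> R,
  [/\ a 0%N = 1, forall k, 0 <= a k & forall lam, 0 < lam ->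
    expected_size n theta lam =
      Msum (max_code_size n theta) a lam / Zsum (max_code_size n theta) a lam].
Proof.
have [s sE] := @surface_probability R n isT.
exists (code_coef theta s); split => [//|k|lam l0].
  apply: coef_ge0; [exact: bmeas_code_rel|exact: code_rel01|].
  by apply: weight_indic; exact: measurable_sphere.
by apply: expected_size_ratio => // k; exact: code_coef_gt_max.
Qed.

Lemma expected_size_ge0 (lam : R) : 0 < lam -> 0 <= expected_size n theta lam.
Proof.
move=> l0; have [a [a0 a_ge0 ->//]] := expected_sizeE.
have l0' := ltW l0; apply: divr_ge0; first exact: Msum_ge0.
by apply: (le_trans ler01); exact: Zsum_ge1.
Qed.

Lemma expected_size_le (lam : R) : 0 < lam ->
  expected_size n theta lam <= (max_code_size n theta)%:R.
Proof.
move=> l0; have [a [a0 a_ge0 ->//]] := expected_sizeE.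
have Z0 N : 0 < Zsum N a lam by rewrite (lt_le_trans ltr01)// Zsum_ge1// ltW.
rewrite ler_pdivrMr// /Zsum mulr_sumr; apply: ler_sum => k _.
rewrite -mulrA; apply: ler_wpM2r; first by rewrite mulr_ge0// fugw_ge0// ltW.
by rewrite ler_nat -ltnS ltn_ord.
Qed.

Lemma expected_size_le2 (lam1 lam2 : R) : 0 < lam1 -> lam1 <= lam2 ->
  expected_size n theta lam1 <= expected_size n theta lam2.
Proof.
move=> l1 l12; have l2 := lt_le_trans l1 l12.
have [a [a0 a_ge0 aE]] := expected_sizeE; rewrite !aE//.
have Z0 N (lam : R) : 0 < lam -> 0 < Zsum N a lam.
  by move=> l0; rewrite (lt_le_trans ltr01)// Zsum_ge1// ltW.
by rewrite ler_pdivrMr ?Z0// mulrAC ler_pdivlMr ?Z0// Msum_Zsum_cross// ltW.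
Qed.

Lemma expected_size_lower (lam K K' e r t eps rho eta p : R) (k m : nat) :
  0 < lam -> 0 <= K -> 0 < K' -> 0 <= e -> K * expR K' <= e -> K <= K' - K' ^+ 2 * p ->
  0 <= cos theta -> 0 <= eta -> 0 < p -> p <= 1 -> (0 < k)%N ->
  0 <= t -> t < r -> r <= 1 -> r ^+ 2 <= cos theta ->
  r ^+ 2 * (k%:R^-1 + eta) < cos theta * (cos theta - r ^+ 2) ->
  1 < cos theta + m%:R * eta ->
  0 < eps -> eps < 1 -> 0 < rho -> 1 - t ^+ 2 + eps ^+ 2 <= rho ^+ 2 ->
  rho ^+ n / eps <=
    (r - t) * ((p / (8 * k.+1%:R)) ^+ (k.+1 * 4 ^ m) * (K' / lam)) ->
  K <= (cap_measure n theta + e / lam) * expected_size n theta lam.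
Proof.
move=> l0 K0 K'0 e0 Ke KK' c0 eta0 p0 p1 k0 t0 tr r1 rc gap cm eps0 eps1 rho0 rhoP mass.
have [s sE] := @surface_probability R n isT.
set N := max_code_size n theta.
pose h : T -> T -> R := rel_fun (code_rel theta).
have bh : bmeas (fun z : T * T => h z.1 z.2) by exact: bmeas_code_rel.
have h01 x y : 0 <= h x y <= 1 by exact: code_rel01.
have hsym x y : h x y = h y x by exact: code_rel_sym.
have wS : weight (\1_S : T -> R) by apply: weight_indic; exact: measurable_sphere.
have a0 k' : (N < k')%N -> coef s h k' \1_S = 0 by exact: code_coef_gt_max.
have a_ge0 k' : 0 <= code_coef theta s k' by apply: coef_ge0.
have Z0 : 0 < Zsum N (code_coef theta s) lam.
  by rewrite (lt_le_trans ltr01)// Zsum_ge1// ltW.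
rewrite (@expected_size_ratio R n theta isT cos_lt1 s sE lam N l0 a0).
rewrite mulrA ler_pdivlMr//.
apply: (@occupancy_bound _ _ _ s h) => //.
- move=> D wD DS; apply: (@local_occupancy _ _ _ s h _ _ D N lam K K' p) => //.
    apply/eqP; rewrite eq_le coef_ge0// andbT.
    by rewrite -(a0 N.+1)//; apply: le_coef.
  (* In the branch where the conflict bound is needed, D has mass above [K' / lam], which is the
     mass assumed in the last hypothesis. *)
  move=> Kl; have I0 : K' / lam < \int[s]_x D x by rewrite ltr_pdivrMr// mulrC.
  have I1 : 0 < \int[s]_x D x by rewrite (le_lt_trans _ I0)// divr_ge0// ltW.
  apply: (@conflict_small R n theta isT s sE D r t eps rho eta p k m) => //.
  apply: (le_trans mass); rewrite ler_wpM2l ?subr_ge0 ?ltW//.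
  by rewrite ltr_pM2l// exprn_gt0// divr_gt0// mulr_gt0.
- rewrite Rintegral_indicT; last exact: measurable_sphere.
  by rewrite (@surface_sphere R n s sE).
- move=> x; apply: conflict_cap_le => y /sphereE yS.
  by rewrite /cap_measure -sE surface_cap_rotate.
Qed.

End expected_size.

(** * Asymptotics *)

(** With l = ln y / (E + 1), y ^ d = exp (d l) ^ (E + 1) is at least (d l) ^ (E + 1), and the one
    extra power of d outgrows C. *)
Lemma expn_dominates_poly (R : realType) (C y : R) (E : nat) : 1 < y ->
  exists d0 : nat, forall d, (d0 <= d)%N -> C * d%:R ^+ E <= y ^+ d.
Proof.
move=> y1; have y0 : 0 < y by rewrite (lt_trans ltr01).
pose l := ln y / E.+1%:R; have l0 : 0 < l by rewrite divr_gt0// ln_gt0.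
have lE : 0 < l ^+ E.+1 by rewrite exprn_gt0.
exists (Num.truncn (C / l ^+ E.+1)).+1 => d d0d.
have Cd : C <= d%:R * l ^+ E.+1.
  rewrite -ler_pdivrMr// (le_trans (ltW (truncnS_gt _)))// ler_nat //.
apply: (@le_trans _ _ ((d%:R * l) ^+ E.+1)).
  by rewrite exprMn exprSr -mulrA mulrC ler_wpM2l ?exprn_ge0.
have -> : y ^+ d = expR (d%:R * l) ^+ E.+1.
  rewrite -expRM_natl mulrCA (_ : E.+1%:R * l = ln y); last by rewrite mulrC divfK ?pnatr_eq0.
  by rewrite expRM_natl lnK.
have dl0 : 0 <= d%:R * l by rewrite mulr_ge0// ltW.
rewrite lerXn2r ?nnegrE ?expR_ge0//.
by rewrite (le_trans _ (expR_ge1Dx _))// lerDr.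
Qed.

Section asymptotics.
Context {R : realType} (theta q : R).
Hypothesis c_gt0 : 0 < cos theta.
Hypothesis c_lt1 : cos theta < 1.
Hypothesis s_gt0 : 0 < sin theta.
Hypothesis q_gt0 : 0 < q.
Hypothesis q2 : q ^+ 2 = 1 - cos theta.
Local Notation c := (cos theta).
Local Notation L := (ln (sin theta / q)).

Lemma cap_measure_gt0 d : 0 < cap_measure d.+1 theta.
Proof.
have e0 : 0 < c / 2 by rewrite divr_gt0.
apply: lt_le_trans (cap_measure_lower d c_gt0 s_gt0 e0 _); last by lra.
by rewrite mulr_gt0 ?divr_gt0// exprn_gt0// divr_gt0// mulr_gt0//; lra.
Qed.

(* In terms of the d-th root: [(q + delta) * expR L'] is below [sin theta], the
   exponential rate of the cap measure. *)
Lemma cap_fugacity_dominates (L' a0 delta tau : R) : 0 < a0 -> a0 < 1 ->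
  0 < delta -> 0 < tau -> 0 <= L' ->
  (q + delta) * expR L' < (1 - a0) * sin theta ->
  exists d0 : nat, forall d, (d0 <= d)%N ->
    L' * d.+1%:R * expR (L' * d.+1%:R) <=
      tau * cap_measure d.+1 theta * (q + delta) ^- d.+1.
Proof.
move=> a00 a01 de0 tau0 L0 lt.
have sg0 : 0 < (1 - a0) * sin theta by rewrite mulr_gt0// subr_gt0.
have q0 : 0 < q + delta by rewrite addr_gt0.
have qe0 : 0 < (q + delta) * expR L' by rewrite mulr_gt0// expR_gt0.
have z1 : 1 < (1 - a0) * sin theta / ((q + delta) * expR L') by rewrite ltr_pdivlMr// mul1r.
have C0 : 0 < tau * (c * a0 / 2) by rewrite !mulr_gt0.
have [d0 d0P] := expn_dominates_poly (L' / (tau * (c * a0 / 2))) 1 z1.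
exists d0 => d d0d; have := d0P d.+1 (leq_trans d0d (leqnSn d)); rewrite expr1.
rewrite mulrAC ler_pdivrMr// expr_div_n mulrAC ler_pdivlMr ?exprn_gt0//.
rewrite ler_pdivlMr ?exprn_gt0// [L' * d.+1%:R]mulrC expRM_natl exprMn => le1.
rewrite -mulrA [expR L' ^+ _ * _]mulrC; apply: (le_trans le1).
have a0c : c * a0 < c by rewrite gtr_pMr.
have low := cap_measure_lower d c_gt0 s_gt0 (mulr_gt0 c_gt0 a00) a0c.
rewrite mulrCA ler_pM2l//; apply: le_trans low.
rewrite mulrC ler_pM2l ?divr_gt0 ?mulr_gt0//.
rewrite (_ : (c - c * a0) * sin theta / c = (1 - a0) * sin theta); last first.
  by field; rewrite gt_eqF.
rewrite exprS ler_piMl ?exprn_ge0 ?(ltW sg0)//.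
have a0' : 0 <= 1 - a0 <= 1 by rewrite subr_ge0 lerBlDr lerDl !ltW.
by have /andP[? ?] := a0'; rewrite mulr_ile1 ?sin_le1// ltW.
Qed.

(** [expected_size_lower] is applied in dimension D with lam = (q + delta) ^ (- D), K' = L' D, p = a
    / D and e = tau times cap measure times lam, so that e / lam is a small proportion of the cap
    measure. The loss [eps] is shared among [L'], [a] and [tau]. *)
Lemma expected_size_asymptotic (eps : R) : 0 < eps -> eps < L ->
  exists (delta : R) (d0 : nat), 0 < delta /\
    forall (d : nat) (lambda : R), (d0 <= d)%N -> (q + delta) ^- d.+2 <= lambda ->
      (L - eps) * d.+2%:R * (cap_measure d.+2 theta)^-1 <= expected_size d.+2 theta lambda.
Proof.
have [cgt0 clt1 qgt0] := And3 c_gt0 c_lt1 q_gt0.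
move=> eps0 epsL; have L0 : 0 < L by exact: lt_trans epsL.
have sq0 : 0 < sin theta / q by rewrite divr_gt0.
pose L' := L - eps / 4; have L'E : L' = L - eps / 4 by [].
have L'0 : 0 < L' by lra.
pose x := expR (- (eps / 4)).
have x0 : 0 < x by exact: expR_gt0.
have x1 : x < 1 by rewrite expR_lt1 oppr_lt0 divr_gt0.
have eL' : expR L' = sin theta / q * x by rewrite /L' expRD lnK.
(* Chosen so that (1 + a0) x < 1 - a0: the gain x = exp (- eps / 4) pays both for [delta] and for
   the loss in the cap measure. *)
pose a0 := (1 - x) / 4.
have a00 : 0 < a0 by rewrite /a0; lra.
have a01 : a0 < 1 by rewrite /a0; lra.
have q1 : q < 1.
  have [//|/(exprn_ege1 2)] := ltP q 1.
  by rewrite q2 lerDl oppr_ge0 leNgt c_gt0.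
(* The first bound gives q + delta <= q (1 + a0); the second serves for G < c, which keeps the
   square roots below meaningful. *)
pose delta := Num.min (q * a0) (c / 2).
have de0 : 0 < delta by rewrite lt_min mulr_gt0//= divr_gt0.
have deq : delta <= q * a0 by rewrite ge_min lexx.
have dec : delta <= c / 2 by rewrite ge_min lexx orbT.
(* [rho] lies halfway: above q, so that caps of measure about rho ^ d have level below sqrt (cos
   theta), and below q + delta, so that rho ^ d is exponentially smaller than 1 / lam. [G] is rho ^
   2 - q ^ 2. *)
pose rho := q + delta / 2; pose G := q * delta + delta ^+ 2 / 4.
have G0 : 0 < G by rewrite /G addr_gt0 ?mulr_gt0 ?exprn_gt0.
have rhoG : rho ^+ 2 = 1 - c + G by rewrite -q2 /rho /G; field.
have Gc : G < c.
  have : q * delta < delta by rewrite gtr_pMl.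
  have : delta ^+ 2 <= delta by rewrite expr2 ger_pMl//; lra.
  rewrite /G; lra.
(* The levels satisfy t < r < sqrt c, and 1 - t ^ 2 = q ^ 2 + G / 2 leaves room for the squared
   shell width (G / 2) ^ 2 below rho ^ 2. *)
pose t := Num.sqrt (c - G / 2); pose r := Num.sqrt (c - G / 4).
have t2 : t ^+ 2 = c - G / 2 by rewrite sqr_sqrtr//; lra.
have r2 : r ^+ 2 = c - G / 4 by rewrite sqr_sqrtr//; lra.
have t0 : 0 <= t by exact: sqrtr_ge0.
have tr : t < r by rewrite ltr_sqrt; lra.
have r1 : r <= 1 by rewrite -sqrtr1 ler_wsqrtr//; lra.
(* With k > 8 / G, 1 / k + eta < G / 8 + G / 16 < G / 4 = c - r ^ 2; with m > 16 / G, m rounds of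
   [eta] exceed 1. *)
pose eta := G / 16; have eta0 : 0 < eta by rewrite divr_gt0.
pose k := (Num.truncn (8 / G)).+1; pose m := (Num.truncn (16 / G)).+1.
have kP : 8 / G < k%:R by exact: truncnS_gt.
have mP : 16 / G < m%:R by exact: truncnS_gt.
have kG : k%:R^-1 < G / 8.
  rewrite -[ltRHS]invrK ltf_pV2 ?posrE ?invr_gt0 ?divr_gt0//.
  by rewrite invf_div.
have gap : r ^+ 2 * (k%:R^-1 + eta) < c * (c - r ^+ 2).
  apply: (@le_lt_trans _ _ (c * (k%:R^-1 + eta))).
    by rewrite ler_wpM2r ?addr_ge0 ?invr_ge0 ?(ltW eta0)// r2; lra.
  by rewrite ltr_pM2l// r2 /eta; lra.
have cm : 1 < c + m%:R * eta.
  have : 1 < m%:R * eta by rewrite /eta mulrA ltr_pdivlMr// mul1r -ltr_pdivrMr.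
  lra.
have ep0 : 0 < G / 2 by rewrite divr_gt0.
have ep1 : G / 2 < 1 by lra.
have rho0 : 0 < rho by rewrite /rho addr_gt0// divr_gt0.
have rhoP : 1 - t ^+ 2 + (G / 2) ^+ 2 <= rho ^+ 2.
  have : (G / 2) ^+ 2 <= G / 2 by rewrite expr2 ger_pMl// ltW.
  rewrite t2 rhoG; lra.
(* For p = a / D the correction K' ^ 2 p equals L' ^ 2 a D, at most eps / 4 per dimension. *)
pose a := Num.min 1 (eps / (4 * L' ^+ 2)).
have L'2 : 0 < L' ^+ 2 by rewrite exprn_gt0.
have ap : 0 < a by rewrite lt_min ltr01 divr_gt0// mulr_gt0.
have a1 : a <= 1 by rewrite ge_min lexx.
have aL : L' ^+ 2 * a <= eps / 4.
  rewrite mulrC -ler_pdivlMr// (_ : eps / 4 / L' ^+ 2 = eps / (4 * L' ^+ 2)).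
    by rewrite ge_min lexx orbT.
  by field; rewrite gt_eqF.
pose L2 := L' - L' ^+ 2 * a.
have L20 : 0 < L2 by rewrite /L2; lra.
(* Then (L - eps)(1 + tau) <= L - eps / 2 <= [L2], so the factor 1 + tau in front of the cap measure
   is affordable. *)
pose tau := eps / (2 * L); have tau0 : 0 < tau by rewrite divr_gt0// mulr_gt0.
have zP : (q + delta) * expR L' < (1 - a0) * sin theta.
  rewrite eL'; apply: (@le_lt_trans _ _ (q * (1 + a0) * (sin theta / q * x))).
    have sx0 : 0 <= sin theta / q * x by apply/ltW/mulr_gt0.
    by rewrite ler_wpM2r// mulrDr mulr1 lerD2l.
  rewrite (_ : q * (1 + a0) * (sin theta / q * x) = (1 + a0) * x * sin theta); last first.
    by field; rewrite gt_eqF.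
  rewrite ltr_pM2r//; have : a0 * x < a0 by rewrite gtr_pMr.
  rewrite mulrDl mul1r /a0; lra.
have [d1 d1P] := cap_fugacity_dominates a00 a01 de0 tau0 (ltW L'0) zP.
pose E := (k.+1 * 4 ^ m)%N.
pose b := a / (8 * k.+1%:R).
have b0 : 0 < b by rewrite divr_gt0// mulr_gt0.
have q0 : 0 < q + delta by rewrite addr_gt0.
have y1 : 1 < (q + delta) / rho by rewrite ltr_pdivlMr// mul1r /rho; lra.
pose C2 := G / 2 * ((r - t) * (b ^+ E * L')).
have C20 : 0 < C2 by rewrite mulr_gt0// mulr_gt0 ?subr_gt0// mulr_gt0// exprn_gt0.
(* Starting the bootstrap from a / D costs D ^ E, beaten by the exponential ratio of (q + delta) ^ D
   to rho ^ D. *)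
have [d2 d2P] := expn_dominates_poly C2^-1 E y1.
exists delta, (maxn d1 d2); split => // d lam; rewrite geq_max => /andP[d1d d2d] lamP.
have dn0 : 0 < d.+2%:R :> R by [].
have dn1 : 1 <= d.+2%:R :> R by rewrite ler1n.
have l0 : 0 < (q + delta) ^- d.+2 by rewrite invr_gt0 exprn_gt0.
(* By monotonicity only the smallest admissible fugacity matters. *)
apply: le_trans (expected_size_le2 d c_lt1 l0 lamP).
have kap0 := cap_measure_gt0 d.+1.
rewrite ler_pdivrMr//.
have main : L2 * d.+2%:R <= (cap_measure d.+2 theta +
    tau * cap_measure d.+2 theta * (q + delta) ^- d.+2 / (q + delta) ^- d.+2) *
    expected_size d.+2 theta ((q + delta) ^- d.+2).
  apply: (@expected_size_lower R d theta c_lt1 _ _ (L' * d.+2%:R) _ r t (G / 2) rho eta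
    (a / d.+2%:R) k m) => //.
  - by rewrite mulr_ge0// ltW.
  - by rewrite mulr_gt0.
  - by apply: ltW; rewrite mulr_gt0// mulr_gt0.
  - apply: le_trans (d1P d.+1 (leq_trans d1d (leqnSn d))).
    rewrite ler_wpM2r ?expR_ge0// ler_wpM2r// /L2 lerBlDr lerDl.
    by apply/ltW; exact: mulr_gt0.
  - rewrite /L2 le_eqVlt; apply/orP; left; apply/eqP.
    by move: d.+2%:R dn0 => D D0; field; rewrite gt_eqF.
  - exact: ltW.
  - exact: ltW.
  - by rewrite divr_gt0.
  - by rewrite ler_pdivrMr// mul1r (le_trans a1).
  - by rewrite r2; lra.
  rewrite -/E.
  have le2 : d.+2%:R ^+ E * rho ^+ d.+2 <= (q + delta) ^+ d.+2 * C2.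
    have := d2P d.+2 (leq_trans d2d (leq_trans (leqnSn _) (leqnSn _))).
    rewrite expr_div_n ler_pdivlMr ?exprn_gt0// -mulrA [leLHS]mulrC.
    by rewrite ler_pdivrMr.
  have -> : a / d.+2%:R / (8 * k.+1%:R) = b / d.+2%:R by rewrite /b mulrAC.
  have DE0 : 0 < d.+2%:R ^+ E :> R by rewrite exprn_gt0.
  have Q0 : 0 < (q + delta) ^+ d.+2 by rewrite exprn_gt0.
  rewrite expr_div_n invrK ler_pdivrMr//.
  rewrite (_ : _ * (G / 2) = (q + delta) ^+ d.+2 * C2 * d.+2%:R / d.+2%:R ^+ E).
    rewrite ler_pdivlMr// [leLHS]mulrC (le_trans le2)// ler_peMr//.
    by apply/ltW; exact: mulr_gt0.
  rewrite /C2; move: ((q + delta) ^+ d.+2) (d.+2%:R ^+ E) DE0 (b ^+ E) => Q DE DE0 B.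
  by move: d.+2%:R => D; field; rewrite gt_eqF.
rewrite mulfK ?gt_eqF// in main.
have tau1 : (L - eps) * (1 + tau) <= L2.
  have : tau * L = eps / 2 by rewrite /tau; field; rewrite gt_eqF.
  have : 0 < tau * eps by rewrite mulr_gt0.
  rewrite /L2 mulrDr mulr1 [(_ - eps) * tau]mulrC mulrBr; lra.
have tau2 : 0 < 1 + tau by rewrite addr_gt0.
rewrite -(ler_pM2r tau2).
apply: (@le_trans _ _ (L2 * d.+2%:R)); first by rewrite mulrAC ler_wpM2r.
apply: (le_trans main); rewrite le_eqVlt; apply/orP; left; apply/eqP; ring.
Qed.

End asymptotics.

Lemma half_angle_chord (R : realType) (theta : R) :
  (Num.sqrt 2 * sin (theta / 2)) ^+ 2 = 1 - cos theta.
Proof.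
have e : theta / 2 *+ 2 = theta by rewrite -mulr_natl; field.
have := cos_mulr2n (theta / 2); rewrite e => ->; have := cos2Dsin2 (theta / 2).
by rewrite exprMn sqr_sqrtr// -[in X in 1 - X]mulr_natl; lra.
Qed.

(** Comparing squares, 1 - cos theta < 1 - (cos theta) ^ 2 because 0 < cos theta < 1. *)
Lemma ln_sin_chord_gt0 (R : realType) (theta : R) : 0 < theta < pi / 2 ->
  0 < ln (sin theta / (Num.sqrt 2 * sin (theta / 2))).
Proof.
move=> /andP[t0 t1]; have p0 := pi_gt0 R.
have c0 : 0 < cos theta by apply: cos_gt0_pihalf; apply/andP; split; lra.
have s0 : 0 < sin theta by apply: sin_gt0_pihalf; rewrite t0.
have h0 : 0 < sin (theta / 2) by apply: sin_gt0_pihalf; apply/andP; split; lra.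
have q0 : 0 < Num.sqrt 2 * sin (theta / 2) by rewrite mulr_gt0// sqrtr_gt0.
apply: ln_gt0; rewrite ltr_pdivlMr// mul1r -(ltr_pXn2r (n := 2)) ?nnegrE ?ltW//.
rewrite half_angle_chord; have := cos2Dsin2 theta => cs.
have c1 : cos theta < 1.
  have [//|/(exprn_ege1 2)] := ltP (cos theta) 1.
  have : 0 < sin theta ^+ 2 by rewrite exprn_gt0.
  lra.
have : cos theta ^+ 2 < cos theta by rewrite expr2 gtr_pMr.
lra.
Qed.

Theorem theorem13 (R : realType) (theta : R) (theta_itv : 0 < theta < pi / 2) :
  (forall eps : R, 0 < eps ->
     exists (delta : R) (d0 : nat), 0 < delta /\
       forall (d : nat) (lambda : R), (d0 <= d)%N ->
         (Num.sqrt 2 * sin (theta / 2) + delta) ^- d <= lambda ->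
         (ln (sin theta / (Num.sqrt 2 * sin (theta / 2))) - eps) *
           d%:R * (cap_measure d theta)^-1
         <= expected_size d theta lambda)
  /\
  (exists o1 : nat -> R, o1 @ \oo --> (0 : R) /\
     \forall d \near \oo,
       (1 + o1 d) * ln (sin theta / (Num.sqrt 2 * sin (theta / 2))) *
         d%:R * (cap_measure d theta)^-1
       <= (max_code_size d theta)%:R).
Proof.
have L0 := ln_sin_chord_gt0 theta_itv; have q2 := half_angle_chord theta.
have /andP[t0 t1] := theta_itv; have p0 := pi_gt0 R.
have c0 : 0 < cos theta by apply: cos_gt0_pihalf; apply/andP; split; lra.
have s0 : 0 < sin theta by exact: sin_gt0_pihalf.
have h0 : 0 < sin (theta / 2) by apply: sin_gt0_pihalf; apply/andP; split; lra.
have q0 : 0 < Num.sqrt 2 * sin (theta / 2) by rewrite mulr_gt0// sqrtr_gt0.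
move: (Num.sqrt 2 * sin (theta / 2)) q2 q0 L0 => q q2 q0.
set L := ln _ => L0.
have c1 : cos theta < 1 by have : 0 < q ^+ 2 by [rewrite exprn_gt0]; rewrite q2; lra.
have part1 (eps : R) : 0 < eps ->
     exists (delta : R) (d0 : nat), 0 < delta /\
       forall (d : nat) (lambda : R), (d0 <= d)%N -> (q + delta) ^- d <= lambda ->
         (L - eps) * d%:R * (cap_measure d theta)^-1 <= expected_size d theta lambda.
  move=> eps0; have [Leps|epsL] := leP L eps.
    (* When eps >= L the bound to prove is non-positive. *)
    exists 1, 2%N; split => // -[//|[//|d]] lam _ laml.
    have lam0 : 0 < lam by rewrite (lt_le_trans _ laml)// invr_gt0 exprn_gt0// addr_gt0.
    rewrite (le_trans _ (expected_size_ge0 d c1 lam0))// pmulr_lle0.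
      by rewrite pmulr_lle0// subr_le0.
    by rewrite invr_gt0; exact: cap_measure_gt0.
  have [delta [d0 [de0 dP]]] := expected_size_asymptotic c0 c1 s0 q0 q2 eps0 epsL.
  exists delta, d0.+2; split => // -[//|[//|d]] lam d0d; exact: dP.
split; first exact: part1.
(* The ratio of code size to the target may stay well above 1; the minimum with 0 discards this
   excess, so that the lower bound from the first part, used with [eps * L], gives convergence. *)
exists (fun d => Num.min 0 ((max_code_size d theta)%:R * cap_measure d theta / (L * d%:R) - 1)).
split.
  apply/cvgrPdist_le => eps eps0.
  have [delta [d0 [de0 dP]]] := part1 (eps * L) (mulr_gt0 eps0 L0).
  exists (maxn d0 2) => // d /=; rewrite geq_max => /andP[d0d].
  case: d d0d => [//|[//|d]] d0d _.
  have kap0 := cap_measure_gt0 c0 s0 d.+1.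
  have l0 : 0 < (q + delta) ^- d.+2 by rewrite invr_gt0 exprn_gt0// addr_gt0.
  have := le_trans (dP d.+2 _ d0d (lexx _)) (expected_size_le d c1 l0).
  rewrite ler_pdivrMr// => le1.
  have LD0 : 0 < L * d.+2%:R by rewrite mulr_gt0.
  have : 1 - eps <= (max_code_size d.+2 theta)%:R * cap_measure d.+2 theta / (L * d.+2%:R).
    by rewrite ler_pdivlMr// (le_trans _ le1)// mulrA mulrBl mul1r.
  move: (_ / (L * _)) => z zP.
  rewrite sub0r normrN; rewrite ler_norml; apply/andP; split.
    rewrite le_min; apply/andP; split; lra.
  by rewrite ge_min; apply/orP; left; exact: ltW.
exists 2%N => // -[//|[//|d]] _ /=.
have kap0 := cap_measure_gt0 c0 s0 d.+1.
rewrite ler_pdivrMr// -mulrA -ler_pdivlMr; last by rewrite mulr_gt0.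
by rewrite -lerBrDl ge_min lexx orbT.
Qed.
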